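(* Let $p_1,p_2,p_3\in S^2$ be three distinct points and let $\zeta$ be Aarnes' 3-point quasi-state on $S^2$ associated with $p_1,p_2,p_3$. For $F,G\in C(S^2)$ put $\Pi(F,G)=|\zeta(F+G)-\zeta(F)-\zeta(G)|$. Then $$\max_{F,G\in C^\infty(S^2)}\frac{\Pi(F,G)^2}{\Vert\{F,G\}\Vert_{L_1}}=1,$$ where the maximum is taken over pairs $F,G\in C^\infty(S^2)$ with $\Vert\{F,G\}\Vert_{L_1}\neq 0$ (in particular, the value $1$ is attained).
   Context: $C(S^2)$ is the space of real continuous functions on the 2-sphere $S^2$, and $C^\infty(S^2)$ is the space of smooth real functions. Quasi-states. For $F\in C(S^2)$ let $C(F)=\{\varphi\circ F:\varphi\in C(\mathrm{Im}(F))\}$. A quasi-state on $S^2$ is a functional $\zeta:C(S^2)\to\mathbb{R}$ such that (1) $\zeta(F)\ge 0$ whenever $F\ge 0$; (2) for every $F\in C(S^2)$, $\zeta$ is linear on $C(F)$; (3) $\zeta(1)=1$. Quasi-measures. Let $\mathcal{C}$ and $\mathcal{O}$ be the collections of closed and open subsets of $S^2$, and $\mathcal{A}=\mathcal{C}\cup\mathcal{O}$. A quasi-measure on $S^2$ is a function $\tau:\mathcal{A}\to[0,1]$ such that (1) $\tau(S^2)=1$; (2) $\tau(B_1)\le\tau(B_2)$ for $B_1\subset B_2$ in $\mathcal{A}$; (3) if $A_1,\dots,A_n\in\mathcal{A}$ are pairwise disjoint and $\bigcup_k A_k\in\mathcal{A}$, then $\tau(\bigcup_k A_k)=\sum_k\tau(A_k)$;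 (4) for $U\in\mathcal{O}$, $\tau(U)=\sup\{\tau(K):K\in\mathcal{C},\,K\subset U\}$. Quasi-measures and quasi-states are in bijection (Aarnes): the quasi-state corresponding to $\tau$ is $$\zeta(F)=\max_{S^2}F-\int_{\min_{S^2} F}^{\max_{S^2} F} b_F(x)\,dx,\qquad b_F(x)=\tau(\{F<x\}).$$ Aarnes' 3-point quasi-state. A subset $S\subseteq S^2$ is solid if both $S$ and $S^2\setminus S$ are connected. Given distinct $p_1,p_2,p_3\in S^2$, define $\tau$ on closed solid sets $C$ by $\tau(C)=0$ if $\#(C\cap\{p_1,p_2,p_3\})\le 1$ and $\tau(C)=1$ if $\#(C\cap\{p_1,p_2,p_3\})\ge 2$. By a theorem of Aarnes, $\tau$ extends (uniquely) to a quasi-measure on $S^2$; this extension takes only the values $0,1$, and on every closed or open solid set $S$ it equals $0$ if $\#(S\cap\{p_1,p_2,p_3\})\le1$ and $1$ if $\#(S\cap\{p_1,p_2,p_3\})\ge2$. Aarnes' 3-point quasi-state associated with $p_1,p_2,p_3$ is the quasi-state corresponding to this extended quasi-measure. Poisson bracket. Fix an area form $\omega$ on $S^2$. For a smooth function $F$ the Hamiltonian vector field $I\,dF$ is defined by $dF(x)(\eta)=\omega(\eta,I\,dF(x))$ for $x\in S^2$, $\eta\in T_xS^2$, and $\{F,G\}=dF(I\,dG)=-\omega(I\,dF,I\,dG)$. Then $dF\wedge dG=-\{F,G\}\,\omega$ and $$\Vert\{F,G\}\Vert_{L_1}=\int_{S^2}|\{F,G\}|\,\omega=\int_{S^2}|dF\wedge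 dG|,$$ which does not depend on the choice of $\omega$. *)

(* Defs.v *)
From HB Require Import structures.
From mathcomp Require Import all_boot all_order all_algebra.
From mathcomp Require Import all_classical all_reals all_analysis.
Import Order.TTheory GRing.Theory Num.Theory.
Import numFieldNormedType.Exports.

Set Implicit Arguments.
Unset Strict Implicit.
Unset Printing Implicit Defensive.

Local Open Scope classical_set_scope.
Local Open Scope ring_scope.

Definition dot (R : realType) (u v : 'rV[R]_3) : R :=
  \sum_(i < 3) u 0 i * v 0 i.

(* The norm [`|u|] of the library on ['rV[R]_3] is the sup norm, hence [dot]. *)
(* The coercion [set_type] turns [sphere R] into a type, which carries the    *)
(* topology induced by ['rV[R]_3].                                            *)
Definition sphere (R : realType) : set 'rV[R]_3 := [set u | dot u u = 1].
Arguments sphere : clear implicits.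

Section QuasiStates.
Variable R : realType.

(* Elements of C(S^2) are functions [F] with [continuous F]; the values of a  *)
(* functional on other functions are irrelevant.                              *)
Record is_quasi_state (zeta : (sphere R -> R) -> R) : Prop := {
  quasi_state_ge0 : forall F : sphere R -> R,
    continuous F -> (forall x, 0 <= F x) -> 0 <= zeta F;
  quasi_state_linear : forall F : sphere R -> R, continuous F ->
    forall (phi psi : R -> R) (a b : R),
      {within range F, continuous phi} -> {within range F, continuous psi} ->
      zeta (fun x => a * phi (F x) + b * psi (F x)) =
      a * zeta (phi \o F) + b * zeta (psi \o F);
  quasi_state_1 : zeta (cst 1) = 1 }.

(* A quasi-measure is only meaningful on sets that are open or closed. *)
Record is_quasi_measure (tau : set (sphere R) -> R) : Prop := {
  quasi_measure_itv : forall A, open A \/ closed A -> 0 <= tau A <= 1;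
  quasi_measure_setT : tau setT = 1;
  quasi_measure_le : forall A B,
    open A \/ closed A -> open B \/ closed B -> A `<=` B -> tau A <= tau B;
  quasi_measure_additive : forall (n : nat) (A : 'I_n -> set (sphere R)),
    (forall i, open (A i) \/ closed (A i)) -> trivIset setT A ->
    open (\bigcup_i A i) \/ closed (\bigcup_i A i) ->
    tau (\bigcup_i A i) = \sum_(i < n) tau (A i);
  quasi_measure_regular : forall U, open U ->
    tau U = sup [set tau K | K in [set K | closed K /\ K `<=` U]] }.

Definition quasi_state_of (tau : set (sphere R) -> R) (F : sphere R -> R) : R :=
  sup (range F) -
  \int[lebesgue_measure]_(x in `[inf (range F), sup (range F)])
    tau [set y | F y < x].

Definition solid (S : set (sphere R)) : Prop := connected S /\ connected (~` S).

Definition extends_three_point (p1 p2 p3 : sphere R)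
    (tau : set (sphere R) -> R) : Prop :=
  forall S, closed S -> solid S ->
    ((S `&` [set p1; p2; p3] #<= `I_1)%card -> tau S = 0) /\
    ((`I_2 #<= S `&` [set p1; p2; p3])%card -> tau S = 1).

(* The extension [tau] is unique by a theorem of Aarnes. *)
Definition is_aarnes_three_point (p1 p2 p3 : sphere R)
    (zeta : (sphere R -> R) -> R) : Prop :=
  is_quasi_state zeta /\
  exists tau, [/\ is_quasi_measure tau, extends_three_point p1 p2 p3 tau &
    forall F : sphere R -> R, continuous F -> zeta F = quasi_state_of tau F].

End QuasiStates.

Section SmoothFunctions.
Variable R : realType.

Definition iter_derive (vs : seq 'rV[R]_3) (f : 'rV[R]_3 -> R) :
    'rV[R]_3 -> R :=
  foldr (fun v (g : 'rV[R]_3 -> R) (x : 'rV[R]_3) => 'D_v g x) f vs.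

(* Meaningful for [U] open: all iterated directional derivatives exist and    *)
(* are (Frechet) differentiable, hence continuous, on [U].                    *)
Definition smooth_on (U : set 'rV[R]_3) (f : 'rV[R]_3 -> R) : Prop :=
  forall (vs : seq 'rV[R]_3) x, U x -> differentiable (iter_derive vs f) x.

(* A function on S^2 is smooth when it is locally the restriction of a smooth *)
(* function on an open subset of R^3.                                         *)
Definition smooth (F : sphere R -> R) : Prop :=
  forall x : sphere R, exists (U : set 'rV[R]_3) (f : 'rV[R]_3 -> R),
    [/\ open U, U (val x), smooth_on U f &
        forall y : sphere R, U (val y) -> F y = f (val y)].

Definition tangent (x : sphere R) (v : 'rV[R]_3) : Prop := dot (val x) v = 0.

(* The extension of [F] to R^3 minus the origin that is constant on rays;     *)
(* [valL_ 0 F] is [F] extended by 0 outside the sphere.                       *)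
Definition radial_extension (F : sphere R -> R) (y : 'rV[R]_3) : R :=
  valL_ 0 F ((Num.sqrt (dot y y))^-1 *: y).

(* dF(x)(eta) for [eta] tangent at [x]: since y |-> y/|y| is a retraction on  *)
(* S^2 whose differential at [x] fixes the tangent space, this is also        *)
(* df(x)(eta) for any smooth local extension f of F.                          *)
Definition differential (F : sphere R -> R) (x : sphere R) (eta : 'rV[R]_3) : R :=
  'D_eta (radial_extension F) (val x).

End SmoothFunctions.

Section PoissonBracket.
Variable R : realType.

Definition tangent_proj (x : sphere R) (v : 'rV[R]_3) : 'rV[R]_3 :=
  v - dot (val x) v *: val x.

(* A 2-form is a family of forms on R^3, of which only the restrictions to    *)
(* the tangent planes matter. It is smooth when the coefficients, in the      *)
(* coordinates of R^3, of its pullback by the tangential projections are.     *)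
Record is_area_form (omega : sphere R -> 'rV[R]_3 -> 'rV[R]_3 -> R) : Prop := {
  area_form_linear : forall x (a : R) u v w,
    tangent x u -> tangent x v -> tangent x w ->
    omega x (a *: u + v) w = a * omega x u w + omega x v w;
  area_form_antisym : forall x u v,
    tangent x u -> tangent x v -> omega x u v = - omega x v u;
  area_form_neq0 : forall x, exists u v,
    [/\ tangent x u, tangent x v & omega x u v != 0];
  area_form_smooth : forall u v,
    smooth (fun x => omega x (tangent_proj x u) (tangent_proj x v)) }.

Variable omega : sphere R -> 'rV[R]_3 -> 'rV[R]_3 -> R.

(* The vector I dF(x); it exists and is unique when [omega] is an area form. *)
Definition hamiltonian_field (F : sphere R -> R) (x : sphere R) : 'rV[R]_3 :=
  xget 0 [set v | tangent x v /\
    forall eta, tangent x eta -> differential F x eta = omega x eta v].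

Definition poisson_bracket (F G : sphere R -> R) (x : sphere R) : R :=
  differential F x (hamiltonian_field G x).

Definition spherical_coord (theta phi : R) : 'rV[R]_3 :=
  \row_(i < 3) [:: sin theta * cos phi; sin theta * sin phi; cos theta]`_i.

Lemma spherical_coord_in (theta phi : R) :
  spherical_coord theta phi \in sphere R.
Proof.
rewrite inE /sphere /= /dot !big_ord_recl big_ord0 !mxE /= addr0.
by rewrite -!expr2 !exprMn addrA -mulrDr cos2Dsin2 mulr1 addrC cos2Dsin2.
Qed.

Definition spherical (theta phi : R) : sphere R :=
  exist _ (spherical_coord theta phi) (spherical_coord_in theta phi).

(* The integral of [h omega] over S^2 oriented by [omega], in spherical       *)
(* coordinates: these parametrize bijectively, for 0 < theta < pi and         *)
(* 0 < phi < 2 pi, the complement of a null set.                              *)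
Definition area_integral (h : sphere R -> R) : R :=
  \int[(lebesgue_measure \x lebesgue_measure)%E]_(z in
      `[0, pi] `*` `[0, 2 * pi])
    (h (spherical z.1 z.2) *
     `|omega (spherical z.1 z.2)
         (derive1 (fun t => spherical_coord t z.2) z.1)
         (derive1 (fun t => spherical_coord z.1 t) z.2)|).

Definition bracket_L1 (F G : sphere R -> R) : R :=
  area_integral (fun x => `|poisson_bracket F G x|).

End PoissonBracket.

Definition quasi_defect (R : realType) (zeta : (sphere R -> R) -> R)
    (F G : sphere R -> R) : R :=
  `|zeta (F \+ G) - zeta F - zeta G|.

(* Main.v *)
Require Import Defs.
From HB Require Import structures.
From mathcomp Require Import all_boot all_order all_algebra.
From mathcomp Require Import all_classical all_reals all_analysis.
From mathcomp Require Import measurable_realfun.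
From mathcomp Require Import ring lra.
Import Order.TTheory GRing.Theory Num.Theory.
Import numFieldNormedType.Exports.

Local Open Scope classical_set_scope.
Local Open Scope ring_scope.

(** Write [zeta] for the quasi-state, [tau] for its quasi-measure, and
    [c = zeta (F + G) - zeta F - zeta G].

    Upper bound: [c ^+ 2] is at most the L1 norm of the bracket.  The
    quasi-measure takes only the values 0 and 1 on open and on closed sets
    ([tau_connected], [tau_open]), so [zeta F] is the one value of [F] whose
    fibre has quasi-measure 1 ([tau_level]), and two closed sets of
    quasi-measure 1 always meet ([tau_meet]).  Consider the right triangle T in
    the plane bounded by the lines x = zeta F, y = zeta G and
    x + y = zeta (F + G); its legs have length [|c|].  The point is that
    (F, G) takes every value y inside T at least twice ([another_preimage]).
    Otherwise the direction of (F, G) - y would have a continuous angle on the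
    sphere, apart from a small disc around the only preimage of y, if any: both
    this complement and the sphere allow angles to be lifted ([angle_lift],
    [angle_lift_sphere]).  Extend the angle over the disc.  Its fibre of
    quasi-measure 1 meets the fibres {F = zeta F}, {G = zeta G} and
    {F + G = zeta (F + G)}; so some ray from y meets the three side lines of
    T, which is impossible.  Hence twice the area of T, that is [c ^+ 2],
    is at most the integral of the absolute Jacobian of (F, G)
    ([area_inequality]), and in spherical coordinates this integral is
    the L1 norm of the bracket ([bracket_L1E]).

    Attainment.  Take [F = s (1 - t)] and [G = s t] with s and t smooth and
    valued in [0, 1].  A closed cap that contains two of the marked points has
    quasi-measure 1; if F, G and F + G are respectively 0, 0 and 1 on such caps
    then [c = 1] ([defect_attained]), and by the upper bound it remains to
    have an integral of |s ds /\ dt| at most 1.  If one marked point is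
    strictly extreme in height ([defect_attained_extreme]), s is a step of the
    height: on each parallel t is a step of a linear function, of total
    variation at most 2, while s ds integrates to at most 1/2.  Otherwise the
    three points have the same height ([defect_attained_level]); let q2 and q3
    be the closest two.  Now s is a step of the linear function x that has
    the same maximum over the marked points at q2 and q3, and, where s does not
    vanish, t is a step of the longitude, with increments of total at most 1;
    along each meridian x is unimodal, and s ds integrates to at most 1. *)

Set Implicit Arguments.
Unset Strict Implicit.
Unset Printing Implicit Defensive.

(** * Connectedness and compactness *)

Section GeneralTopology.
Variable T : topologicalType.
Implicit Types A B C K : set T.

(** The sets [A] for which [P] holds on the part of [K] outside [A] form a
    filter; if [P K] failed, it would be proper and would cluster at a point
    of [K]. *)
Lemma compact_induction K (P : set T -> Prop) : compact K ->
  P set0 -> (forall A B, P A -> P B -> P (A `|` B)) ->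
  (forall A B, A `<=` B -> P B -> P A) ->
  (forall x, K x -> exists2 U, nbhs x U & P U) -> P K.
Proof.
move=> cK P0 PU Psub Ploc; apply: contrapT => nPK.
pose F : set (set T) := fun A => P (K `\` A).
have FF : Filter F.
  split.
  - by rewrite /F setDT.
  - by move=> A B PA PB; rewrite /F setDIr; exact: PU.
  - by move=> A B AB; apply: Psub; exact: setDS.
have PF : ProperFilter F by split => //; rewrite /F setD0.
have [|x [Kx clx]] := cK F PF; first by rewrite /F setDv.
have [U xU PUx] := Ploc x Kx.
have /(clx _ U)/(_ xU) [y []] : F (~` U).
  by rewrite /F setDE setCK; apply: Psub PUx; exact: subIsetr.
by [].
Qed.

Lemma separatedUr A B C : separated A B -> separated A C ->
  separated A (B `|` C).
Proof.
move=> [AB1 AB2] [AC1 AC2]; split; first by rewrite setIUr AB1 AC1 setU0.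
by rewrite closureU setIUr AB2 AC2 setU0.
Qed.

Lemma separatedS A B C : separated A B -> C `<=` B -> separated A C.
Proof.
move=> [AB1 AB2] CB; split; apply/seteqP; split => // x [].
  by move=> Ax /CB Bx; rewrite -AB1.
by move=> Ax /(closureS CB) Bx; rewrite -AB2.
Qed.

(** The part of a separation of the complement of a component that misses [C]
    could be added to that component. *)
Lemma connected_setC_component C x : connected [set: T] -> connected C ->
  connected (~` connected_component (~` C) x).
Proof.
move=> cT cC; set U := connected_component _ _.
have [Cx|nCx] := pselect (C x).
  by rewrite /U connected_component_out ?setC0//= => /(_ Cx).
have cU : connected U by exact: component_connected.
have Ux : U x by exact: connected_component_refl.
have UC : U `<=` ~` C by exact: connected_component_sub.
apply/connectedP => E [E0 UE sE].
wlog CE : E E0 UE sE / C `<=` E false.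
  move=> wl.
  have : C `<=` E false `|` E true by rewrite -UE; apply/subsetCr.
  move=> /(connected_subset sE)/(_ cC) [/wl|CE]; first exact.
  apply: (wl (E \o negb)) => /=; first by case => /=.
  - by rewrite UE setUC.
  - by rewrite separatedC.
  - by [].
suff cUE : connected (U `|` E true).
  have [y Ey] := E0 true.
  have /(_ y) : U `|` E true `<=` U.
    apply: connected_component_max => //; first by left.
    move=> z [/UC//|Ez Cz].
    have := separated_disjoint sE; rewrite predeqE => /(_ z) [+ _].
    apply; split => //. exact: CE.
  move=> /(_ (or_intror Ey)) Uy.
  have : (~` U) y by rewrite UE; right.
  by apply.
apply/connectedP => D [D0 UED sD].
wlog UD : D D0 UED sD / U `<=` D false.
  move=> wl; have : U `<=` D false `|` D true by rewrite -UED; exact: subsetUl.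
  move=> /(connected_subset sD)/(_ cU) [/wl|UD]; first exact.
  apply: (wl (D \o negb)) => /=; first by case => /=.
  - by rewrite UED setUC.
  - by rewrite separatedC.
  - by [].
have DE : D true `<=` E true.
  move=> z Dz; have : (U `|` E true) z by rewrite UED; right.
  case=> // /UD Dfz; have := separated_disjoint sD.
  by rewrite predeqE => /(_ z) [+ _] => /(_ (conj Dfz Dz)).
move/connectedP : cT => /(_ (fun b => if b then D false `|` E false else D true)).
apply; split.
- by case => //; have [z ?] := D0 false; exists z; left.
- apply/seteqP; split => // z _.
  have [Uz|nUz] := pselect (U z); first by right; left; exact: UD.
  have : (~` U) z by []; rewrite UE => -[Ez|Ez]; first by right; right.
  by have : (U `|` E true) z by [right]; rewrite UED => -[Dz|Dz]; [right; left|left].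
- apply: separatedUr; first by rewrite separatedC.
  by rewrite separatedC; exact: separatedS DE.
Qed.

End GeneralTopology.

(** * The sphere *)

Section SphereBasics.
Variable R : realType.
Implicit Types (u v w : 'rV[R]_3) (x y m : sphere R).

Lemma dotE u v : dot u v = u 0 0 * v 0 0 + u 0 1 * v 0 1 + u 0 2%:R * v 0 2%:R.
Proof.
rewrite /dot !big_ord_recl big_ord0 addr0 addrA.
by congr (_ + _ + _); congr (_ * _); congr (_ _ _); apply/val_inj.
Qed.

Lemma dotC u v : dot u v = dot v u.
Proof. by rewrite !dotE !(mulrC (u _ _)). Qed.

Lemma dotDl u v w : dot (u + v) w = dot u w + dot v w.
Proof. by rewrite !dotE !mxE; ring. Qed.

Lemma dotZl (a : R) u w : dot (a *: u) w = a * dot u w.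
Proof. by rewrite !dotE !mxE; ring. Qed.

Lemma dotDr u v w : dot w (u + v) = dot w u + dot w v.
Proof. by rewrite !dotE !mxE; ring. Qed.

Lemma dotZr (a : R) u w : dot w (a *: u) = a * dot w u.
Proof. by rewrite !dotE !mxE; ring. Qed.

Lemma dotNl u w : dot (- u) w = - dot u w.
Proof. by rewrite -scaleN1r dotZl mulN1r. Qed.

Lemma dotNr u w : dot w (- u) = - dot w u.
Proof. by rewrite -scaleN1r dotZr mulN1r. Qed.

Lemma dot_ge0 u : 0 <= dot u u.
Proof. by rewrite dotE -!expr2 !addr_ge0 ?sqr_ge0. Qed.

Lemma row3P u v : u 0 0 = v 0 0 -> u 0 1 = v 0 1 -> u 0 2%:R = v 0 2%:R -> u = v.
Proof.
move=> e0 e1 e2; apply/rowP => -[[|[|[|//]]] i].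
- by have -> : Ordinal i = 0 by exact/val_inj.
- by have -> : Ordinal i = 1 by exact/val_inj.
- by have -> : Ordinal i = 2%:R by exact/val_inj.
Qed.

Lemma dot_eq0 u : dot u u = 0 -> u = 0.
Proof.
rewrite dotE -!expr2 => e.
have := sqr_ge0 (u 0 0); have := sqr_ge0 (u 0 1); have := sqr_ge0 (u 0 2%:R).
move=> h2 h1 h0; apply: row3P; rewrite mxE; apply/eqP; rewrite -sqrf_eq0; apply/eqP; lra.
Qed.

Lemma sqr_normr_le_dot u : `|u| ^+ 2 <= dot u u.
Proof.
have h : `|u| <= Num.sqrt (dot u u).
  rewrite [leLHS]mx_normrE; apply/bigmax_leP; split; first exact: sqrtr_ge0.
  move=> [i j] _ /=; rewrite -sqrtr_sqr ler_wsqrtr// (ord1 i) dotE -!expr2.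
  have := sqr_ge0 (u 0 0); have := sqr_ge0 (u 0 1); have := sqr_ge0 (u 0 2%:R).
  case: j => -[|[|[|//]]] hj.
  - have -> : Ordinal hj = 0 by exact/val_inj.
    lra.
  - have -> : Ordinal hj = 1 by exact/val_inj.
    lra.
  - have -> : Ordinal hj = 2%:R by exact/val_inj.
    lra.
by rewrite -(sqr_sqrtr (dot_ge0 u)) lerXn2r ?nnegrE ?sqrtr_ge0.
Qed.

Lemma sphere_dot x : dot (val x) (val x) = 1.
Proof. by case: x => v /= /set_mem. Qed.

Definition mk_sphere v (h : dot v v = 1) : sphere R := exist _ v (mem_set h).

Lemma dotB_sphere x y :
  dot (val x - val y) (val x - val y) = 2 - 2 * dot (val x) (val y).
Proof.
by rewrite dotDl !dotDr !dotNl !dotNr !sphere_dot (dotC (val y)); ring.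
Qed.

Lemma sphere_dot_le1 x y : dot (val x) (val y) <= 1.
Proof. by have := dot_ge0 (val x - val y); rewrite dotB_sphere; lra. Qed.

Lemma sphere_dot_eq1 x y : dot (val x) (val y) = 1 -> x = y.
Proof.
move=> e; apply/val_inj/eqP; rewrite -subr_eq0; apply/eqP/dot_eq0.
by rewrite dotB_sphere e; ring.
Qed.

Lemma sphere_dot_geN1 x y : -1 <= dot (val x) (val y).
Proof.
have := dot_ge0 (val x + val y); rewrite dotDl !dotDr !sphere_dot (dotC (val y)); lra.
Qed.

Lemma sphere_dot_eqN1 x y : dot (val x) (val y) = -1 -> val x = - val y.
Proof.
move=> e; apply/eqP; rewrite -addr_eq0; apply/eqP/dot_eq0.
by rewrite dotDl !dotDr !sphere_dot (dotC (val y)) e; ring.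
Qed.

Lemma coord_continuous_row i : continuous (fun u : 'rV[R]_3 => u 0 i).
Proof. exact: coord_continuous. Qed.

Lemma continuous_row3 (T : topologicalType) (f : T -> 'rV[R]_3) :
  continuous (fun t => f t 0 0) -> continuous (fun t => f t 0 1) ->
  continuous (fun t => f t 0 2%:R) -> continuous f.
Proof.
move=> c0 c1 c2 t; apply/cvg_ballP => e e0.
near=> s; rewrite /ball/= /mx_ball; split => // i j.
rewrite (ord1 i); case: j => -[|[|[|//]]] hj.
- have -> : Ordinal hj = 0 by exact/val_inj.
  by near: s; exact: (cvg_ball (c0 t)).
- have -> : Ordinal hj = 1 by exact/val_inj.
  by near: s; exact: (cvg_ball (c1 t)).
- have -> : Ordinal hj = 2%:R by exact/val_inj.
  by near: s; exact: (cvg_ball (c2 t)).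
Unshelve. all: by end_near. Qed.

Lemma continuous_dot (T : topologicalType) (f g : T -> 'rV[R]_3) :
  continuous f -> continuous g -> continuous (fun t => dot (f t) (g t)).
Proof.
move=> cf cg t; under eq_fun do rewrite dotE.
have c i : {for t, continuous (fun t => f t 0 i)}.
  by apply: (@continuous_comp _ _ _ f (fun u : 'rV[R]_3 => u 0 i) t (cf t)); exact: coord_continuous_row.
have d i : {for t, continuous (fun t => g t 0 i)}.
  by apply: (@continuous_comp _ _ _ g (fun u : 'rV[R]_3 => u 0 i) t (cg t)); exact: coord_continuous_row.
by apply: cvgD; [apply: cvgD|]; apply: cvgM; (exact: c || exact: d).
Qed.

Lemma sphere_val_continuous : continuous (fun x : sphere R => val x).
Proof. exact: initial_continuous. Qed.

Lemma continuous_into_sphere (T : topologicalType) (f : T -> sphere R) :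
  continuous (fun t => val (f t)) -> continuous f.
Proof. by move=> cf; apply: continuous_comp_initial. Qed.

Lemma continuous_sphere_dot u : continuous (fun x : sphere R => dot u (val x)).
Proof.
apply: continuous_dot; last exact: sphere_val_continuous.
exact: cst_continuous.
Qed.

Lemma sphere_compact : compact [set: sphere R].
Proof.
have cS : compact (sphere R : set 'rV[R]_3).
  apply: bounded_closed_compact.
    exists 1; split; first by rewrite realE ler01.
    move=> r r1 u /= du; apply: le_trans (ltW r1).
    rewrite -(@ler_pXn2r _ 2)// ?nnegrE// expr1n.
    by rewrite -du sqr_normr_le_dot.
  have -> : sphere R = (fun u => dot u u) @^-1` [set 1] by [].
  apply: (@preimage_closed _ _ (fun u : 'rV[R]_3 => dot u u) [set r : R | r = 1]).
    by move=> u _; apply: continuous_dot => v; exact: cvg_id.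
  exact: closed_eq.
move=> F PF _.
have FS : fmap (fun x : sphere R => val x) F (sphere R).
  by apply: (@filterS _ F _ setT); [move=> x _; exact: sphere_dot|exact: filterT].
have [v [Sv Fv]] := cS _ (fmap_proper_filter (fun x : sphere R => val x) PF) FS.
exists (mk_sphere Sv); split => // A B FA [_ [[C oC <-] /= Cv] CB].
have FA' : fmap (fun x : sphere R => val x) F [set val a | a in A].
  by apply: (@filterS _ F _ A) => // a Aa; exists a.
have [_ [[a Aa <-] Ca]] := Fv _ _ FA' (open_nbhs_nbhs (conj oC Cv)).
by exists a; split => //; exact: CB.
Qed.

Lemma closed_sphere_compact (K : set (sphere R)) : closed K -> compact K.
Proof. by move=> cK; apply: (subclosed_compact cK sphere_compact). Qed.

Lemma exists_unit_orthogonal m :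
  exists w, dot (val m) w = 0 /\ dot w w = 1.
Proof.
have unit u : u != 0 -> dot (val m) u = 0 ->
    exists w, dot (val m) w = 0 /\ dot w w = 1.
  move=> u0 mu; exists ((Num.sqrt (dot u u))^-1 *: u).
  rewrite dotZr mu mulr0 dotZl dotZr mulrA -expr2 exprVn sqr_sqrtr ?dot_ge0//.
  by split => //; rewrite mulVf//; apply: contra_neq u0; exact: dot_eq0.
pose u := \row_(i < 3) [:: - val m 0 1; val m 0 0; 0]`_i.
have [u0|/eqP u0] := eqVneq u 0; last first.
  by apply: (unit u) => //; [exact/eqP|rewrite dotE !mxE /=; ring].
have m1 : val m 0 1 = 0.
  by move/rowP : u0 => /(_ 0); rewrite !mxE /= => /eqP; rewrite oppr_eq0 => /eqP.
have m0 : val m 0 0 = 0 by move/rowP : u0 => /(_ 1); rewrite !mxE.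
exists (\row_(i < 3) [:: 1; 0; 0]`_i).
by rewrite !dotE !mxE /= m0 m1; split; ring.
Qed.

(** The great arc from [m] to [x]. *)
Lemma sphere_polar m x : exists w s, [/\ dot (val m) w = 0, dot w w = 1,
  0 <= s <= pi & val x = cos s *: val m + sin s *: w].
Proof.
set t := dot (val m) (val x).
have t1 : -1 <= t <= 1 by rewrite sphere_dot_geN1 sphere_dot_le1.
have ct : cos (acos t) = t by rewrite acosK// in_itv.
have st : sin (acos t) ^+ 2 = 1 - t ^+ 2.
  by rewrite -{2}ct; have := cos2Dsin2 (acos t); lra.
have s0 : 0 <= acos t <= pi by rewrite acos_ge0// acos_lepi.
have [w [mw ww]] := exists_unit_orthogonal m.
have [s00|sn0] := eqVneq (sin (acos t)) 0.
  exists w, (acos t); split=> //; rewrite ct s00 scale0r addr0.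
  have : t ^+ 2 = 1 by move: st; rewrite s00; lra.
  move=> /eqP; rewrite sqrf_eq1 => /orP[|] /eqP te.
    by rewrite te scale1r (sphere_dot_eq1 te).
  by rewrite te scaleN1r (sphere_dot_eqN1 te) opprK.
exists ((sin (acos t))^-1 *: (val x - t *: val m)), (acos t); split => //.
- by rewrite dotZr dotDr dotNr dotZr sphere_dot -/t mulr1 subrr mulr0.
- rewrite dotZl dotZr mulrA -expr2 exprVn st.
  rewrite dotDl !dotDr !dotNl !dotNr !dotZl !dotZr !sphere_dot (dotC (val x)) -/t.
  have d0 : 1 - t ^+ 2 != 0 by rewrite -st sqrf_eq0.
  by rewrite -[RHS](mulVf d0); congr (_ * _); ring.
- by rewrite ct scalerA divff// scale1r addrC subrK.
Qed.

(** A set that is upward closed for a linear functional is swept by the great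
    arcs that join its points to the maximum of the functional. *)
Lemma connected_dot_up u (S : set (sphere R)) :
  (forall x y, S x -> dot u (val x) <= dot u (val y) -> S y) -> connected S.
Proof.
wlog [m mE] : u / exists m, u = val m.
  move=> wl Sup; have [u0|u0] := eqVneq u 0.
    have h : dot (val (spherical 0 0 : sphere R)) (val (spherical 0 0 : sphere R)) = 1 by exact: sphere_dot.
    apply: (wl (val (spherical 0 0 : sphere R))); first by exists (spherical 0 0).
    by move=> x y Sx _; apply: (Sup x) => //; rewrite u0 !dotE !mxE !mul0r.
  have du : 0 < dot u u.
    by rewrite lt_neqAle dot_ge0 andbT eq_sym; apply: contra_neq u0; exact: dot_eq0.
  have h : dot ((Num.sqrt (dot u u))^-1 *: u) ((Num.sqrt (dot u u))^-1 *: u) = 1.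
    by rewrite dotZl dotZr mulrA -expr2 exprVn sqr_sqrtr ?dot_ge0// mulVf ?gt_eqF.
  apply: (wl (val (mk_sphere h))); first by exists (mk_sphere h).
  move=> x y Sx; rewrite /= !dotZl ler_pM2l ?invr_gt0 ?sqrtr_gt0// => uxy.
  exact: (Sup x).
rewrite mE => {u mE} Sup.
have [S0|/set0P [x0 Sx0]] := eqVneq S set0; first by rewrite S0; exact: connected0.
have Sm : S m by apply: (Sup x0) => //; rewrite sphere_dot sphere_dot_le1.
pose P (A : set (sphere R)) := [/\ connected A, A `<=` S & A m].
have -> : S = \bigcup_(A in P) A.
  apply/seteqP; split => [x Sx|x [A [_ AS _] /AS//]].
  have [w [s [mw ww s0 xE]]] := sphere_polar m x.
  have h r : dot (cos r *: val m + sin r *: w) (cos r *: val m + sin r *: w) = 1.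
    rewrite dotDl !dotDr !dotZl !dotZr (dotC w) mw ww sphere_dot !mulr0 addr0 add0r.
    by rewrite !mulr1 -!expr2 cos2Dsin2.
  pose g r := mk_sphere (h r).
  have cg : continuous g.
    apply: continuous_into_sphere => r /=.
    apply: cvgD; apply: cvgZr_tmp.
      exact: continuous_cos.
    exact: continuous_sin.
  exists (g @` `[0, s]).
    split.
    - apply: connected_continuous_connected; first exact: segment_connected.
      exact: continuous_subspaceT.
    - move=> _ [r /= /[!in_itv]/= /andP[r0 rs] <-]; apply: (Sup x) => //.
      rewrite xE !dotDr !dotZr mw sphere_dot !mulr0 !addr0 !mulr1.
      case/andP: s0 => s0 spi.
      by rewrite leNgt; apply/negP; rewrite ltr_cos ?in_itv/= ?r0 ?s0 ?spi ?(le_trans rs)// ltNge rs.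
    - exists 0; first by rewrite /= in_itv /= lexx; case/andP : s0.
      by apply/val_inj; rewrite /= cos0 sin0 scale1r scale0r addr0.
  exists s; first by rewrite /= in_itv /= lexx; case/andP : s0 => ->.
  by apply/val_inj; rewrite /= xE.
apply: bigcup_connected; first by exists m => A [].
by move=> A [].
Qed.

Lemma sphere_connected : connected [set: sphere R].
Proof. exact: (@connected_dot_up 0). Qed.

Lemma connected_closed_cap u (c : R) :
  connected [set x : sphere R | c <= dot u (val x)].
Proof. by apply: (@connected_dot_up u) => x y /=; exact: le_trans. Qed.

Lemma connected_open_cap u (c : R) :
  connected [set x : sphere R | c < dot u (val x)].
Proof. by apply: (@connected_dot_up u) => x y /=; exact: lt_le_trans. Qed.

Lemma closed_cap u (c : R) : closed [set x : sphere R | c <= dot u (val x)].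
Proof.
apply: (@preimage_closed _ _ (fun x : sphere R => dot u (val x)) [set r | c <= r]).
  by move=> x _; exact: continuous_sphere_dot.
exact: closed_ge.
Qed.

Lemma open_cap u (c : R) : open [set x : sphere R | c < dot u (val x)].
Proof.
apply: (@open_comp _ _ (fun x : sphere R => dot u (val x)) [set r | c < r]).
  by move=> x _; exact: continuous_sphere_dot.
exact: open_gt.
Qed.

(** Between unit vectors the square of the Euclidean distance is
    [2 - 2 * dot x y]. *)
Lemma cap_basis x (V : set (sphere R)) : nbhs x V ->
  exists2 e : R, 0 < e & [set y | 1 - e <= dot (val x) (val y)] `<=` V.
Proof.
move=> [_ [[B oB <-] /= Bx] BV].
have /nbhs_ballP [e /= e0 eB] : nbhs (val x) B by exact: open_nbhs_nbhs.
exists (e ^+ 2 / 4); first by rewrite divr_gt0 ?exprn_gt0.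
move=> y /= xy; apply: BV => /=; apply: eB; rewrite -ball_normE /=.
rewrite -(@ltr_pXn2r _ 2)// ?nnegrE ?(ltW e0)//.
apply: le_lt_trans (sqr_normr_le_dot _) _; rewrite dotB_sphere.
have := exprn_gt0 2 e0; lra.
Qed.

Lemma open_component (V : set (sphere R)) x : open V ->
  open (connected_component V x).
Proof.
rewrite !openE => oV y Vy; rewrite /interior.
have [e e0 eV] := cap_basis (oV _ (connected_component_sub Vy)).
have := open_nbhs_nbhs (conj (open_cap (val y) (1 - e)) (_ : [set _ | _] y)).
rewrite /= sphere_dot => /(_ ltac:(lra)); apply: filterS => z /= yz.
apply: connected_component_trans Vy _.
have cc := @connected_closed_cap (val y) (1 - e).
have yc : [set z | 1 - e <= dot (val y) (val z)] y by rewrite /= sphere_dot; lra.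
by apply: (connected_component_max yc eV cc); exact: ltW.
Qed.

End SphereBasics.

(** * The three-point quasi-measure *)

Section ThreePoint.
Variables (R : realType) (p1 p2 p3 : sphere R) (tau : set (sphere R) -> R).
Hypotheses (p12 : p1 <> p2) (p13 : p1 <> p3) (p23 : p2 <> p3).
Hypotheses (qm : is_quasi_measure tau) (ext : extends_three_point p1 p2 p3 tau).
Implicit Types A B C K S U V : set (sphere R).

Let oc A := open A \/ closed A.

Lemma quasi_measure0 : tau set0 = 0.
Proof.
have := @quasi_measure_additive _ _ qm 0 (fun=> set0).
rewrite big_ord0 (_ : \bigcup_i _ = set0); last by apply/seteqP; split => // x [[]].
apply => [i||].
- by left; exact: open0.
- by move=> [[]].
- by left; exact: open0.
Qed.

Lemma quasi_measureU A B : oc A -> oc B -> oc (A `|` B) -> A `&` B = set0 ->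
  tau (A `|` B) = tau A + tau B.
Proof.
move=> oA oB oAB AB0.
have := @quasi_measure_additive _ _ qm 2 (fun i => if i == 0 :> nat then A else B).
rewrite !big_ord_recl big_ord0 /= addr0 (_ : \bigcup_i _ = A `|` B); last first.
  apply/seteqP; split => [x [[[|[|//]] i] _ /=]|x]; [by left|by right|].
  by move=> [Ax|Bx]; [exists ord0|exists (lift ord0 ord0)].
apply => //; first by move=> [[|[|//]] i].
have nAB x : A x -> B x -> False by move=> Ax Bx; rewrite -[False]/(set0 x) -AB0.
by move=> [[|[|//]] i] [[|[|//]] j] _ _ /= [x [? ?]]; apply/val_inj => //=;
  exfalso; apply: (nAB x).
Qed.

Lemma quasi_measureC A : oc A -> tau (~` A) = 1 - tau A.
Proof.
move=> oA; rewrite -(quasi_measure_setT qm) -(setUv A) quasi_measureU ?setICr//.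
- by ring.
- by case: oA => [/open_closedC|/closed_openC]; [right|left].
- by rewrite setUv; left; exact: openT.
Qed.

Lemma quasi_measure_ge0 A : oc A -> 0 <= tau A.
Proof. by move=> /(quasi_measure_itv qm)/andP[]. Qed.

Lemma quasi_measure_le1 A : oc A -> tau A <= 1.
Proof. by move=> /(quasi_measure_itv qm)/andP[]. Qed.

Lemma quasi_measure_inner U (r : R) : open U -> r < tau U ->
  exists K, [/\ closed K, K `<=` U & r < tau K].
Proof.
move=> oU; rewrite (quasi_measure_regular qm oU) => /sup_gt.
case=> [|_ [K [cK KU] <-] rK]; last by exists K.
by exists (tau set0); exists set0 => //; split => //; exact: closed0.
Qed.

Lemma quasi_measure_open_eq0 U : open U ->
  (forall K, closed K -> K `<=` U -> tau K = 0) -> tau U = 0.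
Proof.
move=> oU UK; apply/eqP; rewrite eq_le quasi_measure_ge0 ?andbT; last by left.
rewrite leNgt; apply/negP => /(quasi_measure_inner oU)[K [cK KU]].
by rewrite UK// ltxx.
Qed.

(** A closed solid set has quasi-measure 1 exactly when it satisfies this. *)
Definition two_marked A := (A p1 /\ A p2) \/ (A p1 /\ A p3) \/ (A p2 /\ A p3).

Lemma two_markedC A : ~ two_marked A -> two_marked (~` A).
Proof.
rewrite /two_marked /=.
by case: (pselect (A p1)) (pselect (A p2)) (pselect (A p3)) => ? [?|?] [?|?];
  tauto.
Qed.

Lemma I2_card_le (A : set (sphere R)) x y : x <> y -> A x -> A y -> (`I_2 #<= A)%card.
Proof.
move=> xy Ax Ay; pose f (n : nat) := if n == 0%N then x else y.
have fA : (f @` `I_2 #<= A)%card.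
  by apply: subset_card_le => _ [n _ <-]; rewrite /f; case: ifP.
rewrite -(card_le_eql (inj_card_eq (_ : {in `I_2 &, injective f})))//.
by move=> [|[|k]] [|[|l]] //=; rewrite ?inE //= => _ _ e; case: xy.
Qed.

Lemma card_le_I1 (A : set (sphere R)) x : A `<=` [set x] -> (A #<= `I_1)%card.
Proof.
move=> Ax; apply: card_le_trans (subset_card_le Ax) _.
by rewrite (card_le_eql card_set1).
Qed.

Lemma tau_solid1 S : closed S -> solid S -> two_marked S -> tau S = 1.
Proof.
move=> cS sS tS; apply: (ext cS sS).2.
by case: tS => [[? ?]|[[? ?]|[? ?]]];
  [apply: (I2_card_le p12)|apply: (I2_card_le p13)|apply: (I2_card_le p23)];
  split => //=; tauto.
Qed.

Lemma tau_solid0 S : closed S -> solid S -> ~ two_marked S -> tau S = 0.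
Proof.
move=> cS sS tS; apply: (ext cS sS).1.
rewrite /two_marked in tS.
have [S1|S1] := pselect (S p1).
  by apply: (@card_le_I1 _ p1) => x [Sx /= [[->//|xE]|xE]]; subst x; tauto.
have [S2|S2] := pselect (S p2).
  by apply: (@card_le_I1 _ p2) => x [Sx /= [[xE|->//]|xE]]; subst x; tauto.
by apply: (@card_le_I1 _ p3) => x [Sx /= [[xE|xE]|->//]]; subst x; tauto.
Qed.

(** The components of the complement of [C] are open, with solid complements.
    Either one of them contains two marked points, and then its complement is
    a null set that contains [C]; or they are all null, and so are their
    finite unions, hence by compactness every closed subset of the complement
    of [C]. *)
Lemma tau_connected C : closed C -> connected C -> tau C = 0 \/ tau C = 1.
Proof.
move=> cC coC; have oV : open (~` C) by exact: closed_openC.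
pose comp x := connected_component (~` C) x.
have ocomp x : open (comp x) by exact: open_component.
have scomp x : solid (~` comp x).
  split; first exact: connected_setC_component (@sphere_connected R) coC.
  by rewrite setCK; exact: component_connected.
have ccomp x : closed (~` comp x) by exact: open_closedC.
have [[x tx]|nt] := pselect (exists x, two_marked (comp x)).
  left; apply/eqP; rewrite eq_le quasi_measure_ge0 ?andbT; last by right.
  suff <- : tau (~` comp x) = 0.
    apply: (quasi_measure_le qm); [by right|by right|].
    by apply/subsetCr; exact: connected_component_sub.
  by apply: tau_solid0 => //; move: tx; rewrite /two_marked /=; tauto.
have comp0 x : tau (comp x) = 0.
  have : tau (~` comp x) = 1.
    by apply: tau_solid1 => //; apply: two_markedC => tx; apply: nt; exists x.
  by rewrite quasi_measureC; [lra|left].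
right; suff : tau (~` C) = 0 by rewrite quasi_measureC; [lra|right].
apply: quasi_measure_open_eq0 => // K cK KV.
pose W (xs : seq (sphere R)) := [set y | exists2 x, x \in xs & comp x y].
have oW xs : open (W xs).
  have -> : W xs = \bigcup_(x in [set` xs]) comp x by [].
  by apply: bigcup_open.
have W0 xs : tau (W xs) = 0.
  elim: xs => [|x xs IH].
    by rewrite (_ : W _ = set0) ?quasi_measure0//; apply/seteqP; split => // y [].
  have WE : W (x :: xs) = comp x `|` W xs.
    apply/seteqP; split => y.
      by move=> [z]; rewrite inE => /orP[/eqP ->|zxs zy]; [left|right; exists z].
    by move=> [xy|[z zxs zy]]; [exists x|exists z]; rewrite // inE ?eqxx// zxs orbT.
  have [e|/set0P[y [xy [z zxs zy]]]] := eqVneq (comp x `&` W xs) set0.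
    by rewrite WE quasi_measureU// ?comp0 ?IH ?addr0//; left => //; exact: openU.
  rewrite (_ : W _ = W xs)// WE; apply/setUidPr => t xt; exists z => //.
  by rewrite /comp (same_connected_component zy) -(same_connected_component xy).
apply/eqP; rewrite eq_le quasi_measure_ge0 ?andbT; last by right.
have [xs KW] : exists xs, K `<=` W xs.
  apply: (compact_induction (P := fun A => exists xs, A `<=` W xs)
            (closed_sphere_compact cK)).
  - by exists [::].
  - move=> A B [xs AW] [ys BW]; exists (xs ++ ys) => y [/AW|/BW] [z zs zy];
      by exists z; rewrite // mem_cat zs ?orbT.
  - by move=> A B AB [xs BW]; exists xs; exact: subset_trans AB BW.
  - move=> x Kx; exists (comp x); last by exists [:: x] => y xy; exists x; rewrite ?inE.
    apply: open_nbhs_nbhs; split => //; apply: connected_component_refl; exact: KV.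
by rewrite -(W0 xs); apply: (quasi_measure_le qm) => //; [right|left].
Qed.

(** On these unions additivity and the case of one connected set give the
    value of [tau]. Any finite union of caps is of this form: a new cap is
    merged with the members that it meets. *)
Fixpoint disjoint_continua (s : seq (set (sphere R))) : Prop :=
  if s is C :: s' then
    [/\ closed C, connected C, C `&` \big[setU/set0]_(D <- s') D = set0 &
        disjoint_continua s']
  else True.

Lemma disjoint_continua_closed s :
  disjoint_continua s -> closed (\big[setU/set0]_(D <- s) D).
Proof.
elim: s => [_|C s IH [cC _ _ /IH cs]]; first by rewrite big_nil; exact: closed0.
by rewrite big_cons; exact: closedU.
Qed.

Lemma disjoint_continua_insert s C : disjoint_continua s -> closed C ->
  connected C -> exists2 s', disjoint_continua s' &
    \big[setU/set0]_(D <- s') D = C `|` \big[setU/set0]_(D <- s) D.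
Proof.
elim: s C => [|A s IH] C.
  move=> _ cC coC; exists [:: C]; last by rewrite big_cons.
  by split => //; rewrite big_nil setI0.
move=> [cA coA As ds] cC coC.
have [AC0|/set0P AC] := eqVneq (A `&` C) set0.
  have [s' ds' s'E] := IH C ds cC coC.
  exists (A :: s'); first by split => //; rewrite s'E setIUr AC0 As setU0.
  by rewrite !big_cons s'E setUCA.
have [s' ds' s'E] := IH (A `|` C) ds (closedU cA cC) (connectedU AC coA coC).
by exists s' => //; rewrite s'E big_cons setUA (setUC A).
Qed.

Lemma tau_disjoint_continua s : disjoint_continua s ->
  tau (\big[setU/set0]_(D <- s) D) = 0 \/ tau (\big[setU/set0]_(D <- s) D) = 1.
Proof.
elim: s => [_|C s IH]; first by rewrite big_nil quasi_measure0; left.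
move=> [cC coC Cs ds]; rewrite big_cons.
have cs := disjoint_continua_closed ds.
have := quasi_measure_le1 (or_intror (closedU cC cs)).
rewrite quasi_measureU//; [|by right|by right|by right; exact: closedU].
have := IH ds; have := tau_connected cC coC; lra.
Qed.

(** A closed subset of [V] with positive quasi-measure is covered by finitely
    many closed caps inside [V], whose union has quasi-measure 0 or 1. *)
Lemma tau_open V : open V -> tau V = 0 \/ tau V = 1.
Proof.
move=> oV; have [V0|Vn0] := pselect (tau V = 0); [by left|right].
have : 0 < tau V.
  by rewrite lt_neqAle quasi_measure_ge0 ?andbT; [apply/eqP => /esym|left].
move=> /(quasi_measure_inner oV)[K [cK KV K0]].
have [s [ds sV Ks]] : exists s, [/\ disjoint_continua s,
    \big[setU/set0]_(D <- s) D `<=` V & K `<=` \big[setU/set0]_(D <- s) D].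
  apply: (compact_induction (P := fun A => exists s, [/\ disjoint_continua s,
    \big[setU/set0]_(D <- s) D `<=` V & A `<=` \big[setU/set0]_(D <- s) D])
            (closed_sphere_compact cK)).
  - by exists [::]; split => //; rewrite big_nil.
  - move=> A B [s [ds sV As]] [t [dt tV Bt]].
    elim: s A ds sV As => [|C s IH] A.
      rewrite big_nil => _ _ A0; exists t; split => //; rewrite subUset; split => //.
      exact: subset_trans A0 _.
    move=> [cC coC _ ds]; rewrite big_cons subUset => -[CV sV] ACs.
    have [s' [ds' s'V sBs']] := IH (\big[setU/set0]_(D <- s) D) ds sV (@subset_refl _ _).
    have [s2 ds2 s2E] := disjoint_continua_insert ds' cC coC.
    exists s2; split => //; rewrite s2E.
      by rewrite subUset.
    move: sBs'; rewrite !subUset => -[ss' Bs']; split; last exact: subset_trans Bs' (@subsetUr _ _ _).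
    by apply: subset_trans ACs _; exact: setUS.
  - by move=> A B AB [s [ds sV Bs]]; exists s; split => //; exact: subset_trans AB Bs.
  - move=> x Kx.
    have [e e0 eV] := cap_basis (open_nbhs_nbhs (conj oV (KV _ Kx))).
    exists [set y | 1 - e <= dot (val x) (val y)]; last first.
      exists [:: [set y | 1 - e <= dot (val x) (val y)]]; split.
      + by split=> //; [exact: closed_cap|exact: connected_closed_cap|rewrite big_nil setI0].
      + by rewrite big_seq1.
      + by rewrite big_seq1.
    apply: (@filterS _ _ _ [set y | 1 - e < dot (val x) (val y)]).
      by move=> y; exact: ltW.
    apply: open_nbhs_nbhs; split; first exact: open_cap.
    by rewrite /= sphere_dot; lra.
have cs := disjoint_continua_closed ds.
have := quasi_measure_le1 (or_introl oV).
have := quasi_measure_le qm (or_intror cK) (or_intror cs) Ks.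
have := quasi_measure_le qm (or_intror cs) (or_introl oV) sV.
have := tau_disjoint_continua ds; lra.
Qed.

(** Otherwise their union would have quasi-measure 2. *)
Lemma tau_meet A B : closed A -> closed B -> tau A = 1 -> tau B = 1 ->
  exists x, A x /\ B x.
Proof.
move=> cA cB A1 B1.
have [AB0|/set0P[x [Ax Bx]]] := eqVneq (A `&` B) set0; last by exists x.
have := quasi_measure_le1 (or_intror (closedU cA cB)).
by rewrite quasi_measureU ?A1 ?B1 //; [lra|by right|by right|by right; exact: closedU].
Qed.

Section Levels.
Variable F : sphere R -> R.
Hypothesis cF : continuous F.

Lemma open_sublevel r : open [set x | F x < r].
Proof. by apply: (@open_comp _ _ F [set s | s < r]) => [x _|]; [exact: cF|exact: open_lt]. Qed.

Lemma open_superlevel r : open [set x | r < F x].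
Proof. by apply: (@open_comp _ _ F [set s | r < s]) => [x _|]; [exact: cF|exact: open_gt]. Qed.

Lemma closed_level r : closed [set x | F x = r].
Proof.
by apply: (@preimage_closed _ _ F [set s | s = r]) => [x _|];
  [exact: cF|exact: closed_eq].
Qed.

Let m := inf (range F).
Let M := sup (range F).

Let rangeF0 : range F !=set0.
Proof. by exists (F (spherical 0 0)); exists (spherical 0 0). Qed.

Let rangeF_bounded : has_sup (range F) /\ has_inf (range F).
Proof.
have cr : compact (range F).
  apply: continuous_compact; last exact: sphere_compact.
  exact: continuous_subspaceT.
have [N [_ /(_ (N + 1))]] := compact_bounded cr; rewrite ltrDl ltr01 => /(_ isT) FN.
split; split => //.
  by exists (N + 1) => r /FN; exact/le_trans/ler_norm.
by exists (- (N + 1)) => r /FN h; rewrite lerNl (le_trans (ler_norm _))// normrN; exact: h.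
Qed.

Lemma level_itv x : m <= F x <= M.
Proof.
have [hs hi] := rangeF_bounded.
have Fx : range F (F x) by exists x.
by apply/andP; split; [apply: ge_inf Fx; case: hi|apply: ub_le_sup Fx; case: hs].
Qed.

Let b r := tau [set x | F x < r].

Let b_le r s : r <= s -> b r <= b s.
Proof.
move=> rs; apply: (quasi_measure_le qm); try by left; exact: open_sublevel.
by move=> x /= /lt_le_trans; exact.
Qed.

Let b01 r : b r = 0 \/ b r = 1.
Proof. exact/tau_open/open_sublevel. Qed.

Let E := [set r | b r = 0].

Let Em : E m.
Proof.
rewrite /E /= /b (_ : mkset _ = set0) ?quasi_measure0//.
apply/seteqP; split => // x /=; have /andP[+ _] := level_itv x; lra.
Qed.

Let EM r : E r -> r <= M.
Proof.
move=> Er; rewrite leNgt; apply/negP => Mr.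
suff : b r = 1 by rewrite Er => /eqP; rewrite eq_sym oner_eq0.
rewrite /b (_ : mkset _ = setT) ?(quasi_measure_setT qm)//.
apply/seteqP; split => // x _ /=; have /andP[_] := level_itv x; lra.
Qed.

Let a := sup E.

Let has_supE : has_sup E.
Proof. by split; [exists m; exact: Em|exists M => r; exact: EM]. Qed.

Let b0 r : r < a -> b r = 0.
Proof.
move=> /sup_gt [|s Es rs]; first by exists m; exact: Em.
have := b_le (ltW rs); have -> : b s = 0 by exact: Es.
have := b01 r; lra.
Qed.

Let b1 r : a < r -> b r = 1.
Proof.
move=> ar; have [br|//] := b01 r.
by move: ar; rewrite ltNge ub_le_sup//; case: has_supE.
Qed.

Let ma : m <= a.
Proof. by rewrite ub_le_sup//; case: has_supE. Qed.

Let aM : a <= M.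
Proof. by apply: ge_sup; [exists m; exact: Em|move=> r; exact: EM]. Qed.

(** The function [b] is 0 below [a] and 1 above it, so its integral is
    [M - a]. *)
Let quasi_state_a : quasi_state_of tau F = a.
Proof.
rewrite /quasi_state_of -/m -/M.
suff -> : \int[lebesgue_measure]_(x in `[m, M]) b x = M - a by ring.
pose I := if b a == 0 then `]a, M] else `[a, M].
have IE : `[m, M]%classic `&` [set` I] = [set` I].
  apply/setIidPr => r; rewrite /I /=.
  by case: ifP => _; rewrite !in_itv /= => /andP[ar ->]; rewrite andbT (le_trans ma)// ltW.
rewrite /Rintegral (_ : (\int[_]_(x in _) _)%E =
    (\int[lebesgue_measure]_(x in `[m, M]) (\1_[set` I] x)%:E)%E); last first.
  apply: eq_integral => r; rewrite inE /= in_itv /= => /andP[mr rM]; congr (_%:E).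
  have [ra|ar|->] := ltgtP r a.
  - rewrite b0// indicE memNset// /I /=; case: ifP => _; rewrite in_itv /=; lra.
  - by rewrite b1// indicE mem_set// /I /=; case: ifP => _; rewrite in_itv /= ?ar ?(ltW ar).
  - rewrite indicE /I; have [-> |ba] := eqVneq (b a) 0.
      by rewrite memNset//= in_itv /= ltxx.
    rewrite mem_set//= ?in_itv /= ?lexx ?aM//; have := b01 a; move/eqP : ba; lra.
rewrite integral_indic//= setIC IE.
by rewrite /I; case: ifP => _; rewrite lebesgue_measure_itv /= lte_fin;
  move: aM; rewrite le_eqVlt => /orP[/eqP->|->//]; rewrite ltxx subrr.
Qed.

(** Both [{F < a}] and [{F > a}] are null: by inner regularity, a closed
    subset of either stays at a distance from the level [a]. *)
Let tau_level_a : tau [set x | F x = a] = 1.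
Proof.
have lt0 : tau [set x | F x < a] = 0.
  apply: quasi_measure_open_eq0; first exact: open_sublevel.
  move=> K cK Ka; have [->|/set0P K0] := eqVneq K set0; first exact: quasi_measure0.
  have [k Kk kmax] := @compact_EVT_max _ _ F K K0 (closed_sphere_compact cK) (continuous_subspaceT cF).
  move: Kk; rewrite inE => /[dup] Kk /Ka /= ka.
  apply/eqP; rewrite eq_le quasi_measure_ge0 ?andbT; last by right.
  have <- : b ((F k + a) / 2) = 0 by apply: b0; lra.
  apply: (quasi_measure_le qm); [by right|by left; exact: open_sublevel|].
  move=> x Kx /=; have := kmax x (mem_set Kx); lra.
have gt0 : tau [set x | a < F x] = 0.
  apply: quasi_measure_open_eq0; first exact: open_superlevel.
  move=> K cK Ka; have [->|/set0P K0] := eqVneq K set0; first exact: quasi_measure0.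
  have [k Kk kmin] := @compact_EVT_min _ _ F K K0 (closed_sphere_compact cK) (continuous_subspaceT cF).
  move: Kk; rewrite inE => /[dup] Kk /Ka /= ka.
  have b1' : b ((F k + a) / 2) = 1 by apply: b1; lra.
  have oS := @open_sublevel ((F k + a) / 2).
  apply/eqP; rewrite eq_le quasi_measure_ge0 ?andbT; last by right.
  have <- : tau (~` [set x | F x < (F k + a) / 2]) = 0.
    rewrite quasi_measureC; last by left.
    by move: b1'; rewrite /b => ->; ring.
  apply: (quasi_measure_le qm); [by right|by right; exact: open_closedC|].
  move=> x Kx /=; have := kmin x (mem_set Kx); lra.
have cL := @closed_level a.
have : tau (~` [set x | F x = a]) = 0.
  have -> : ~` [set x | F x = a] = [set x | F x < a] `|` [set x | a < F x].
    apply/seteqP; split => x /=; last by case; lra.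
    by move/eqP; rewrite neq_lt => /orP.
  rewrite quasi_measureU ?lt0 ?gt0 ?addr0//.
  - by left; exact: open_sublevel.
  - by left; exact: open_superlevel.
  - by left; apply: openU; [exact: open_sublevel|exact: open_superlevel].
  - by apply/seteqP; split => // x /=; lra.
by rewrite quasi_measureC; [lra|right].
Qed.

Lemma tau_level : tau [set x | F x = quasi_state_of tau F] = 1.
Proof. by rewrite quasi_state_a; exact: tau_level_a. Qed.

Lemma quasi_state_of_eq (C : set (sphere R)) (c : R) : closed C -> tau C = 1 ->
  (forall x, C x -> F x = c) -> quasi_state_of tau F = c.
Proof.
move=> cC C1 FC.
have [x [Cx /= <-]] := tau_meet cC (@closed_level _) C1 tau_level.
exact: FC.
Qed.

End Levels.
End ThreePoint.

(** * Lifting angles *)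

Section Angles.
Variable R : realType.

(** Polar coordinates, as a relation because the angle is only defined up to a
    period. *)
Definition angle (a b t : R) := exists2 r, 0 < r & a = r * cos t /\ b = r * sin t.

Lemma unit_angle_exists (a b : R) : a ^+ 2 + b ^+ 2 = 1 ->
  exists2 t, 0 <= t <= 2 * pi & a = cos t /\ b = sin t.
Proof.
move=> ab.
have a1 : -1 <= a <= 1.
  by rewrite -ler_norml -(@ler_pXn2r _ 2)// ?nnegrE// expr1n real_normK ?num_real//; have := sqr_ge0 b; lra.
have sE : sin (acos a) = `|b|.
  by rewrite sin_acos// (_ : 1 - _ = b ^+ 2) ?sqrtr_sqr//; lra.
have c0 := acos_ge0 a1; have cpi := acos_lepi a1.
have [b0|b0] := leP 0 b.
  exists (acos a); first by lra.
  by rewrite sE ger0_norm// acosK// in_itv.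
exists (2 * pi - acos a); first by lra.
have -> : 2 * pi - acos a = - acos a + pi *+ 2 by rewrite mulr2n; ring.
by rewrite cosD2pi sinD2pi cosN sinN sE acosK ?in_itv// ltr0_norm// opprK.
Qed.

Lemma angle_exists (a b : R) : 0 < a ^+ 2 + b ^+ 2 -> exists t, angle a b t.
Proof.
set s := a ^+ 2 + b ^+ 2 => s0.
have r0 : 0 < Num.sqrt s by rewrite sqrtr_gt0.
have [|t _ [aE bE]] := @unit_angle_exists (a / Num.sqrt s) (b / Num.sqrt s).
  by rewrite !expr_div_n sqr_sqrtr ?ltW// -mulrDl divff// gt_eqF.
exists t; exists (Num.sqrt s) => //.
by rewrite -aE -bE; split; field; rewrite gt_eqF.
Qed.

(** Two plane vectors with positive scalar product make an angle between - pi
    / 2 and pi / 2, whose tangent is the quotient of determinant and scalar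
    product. *)
Lemma angle_step (a b a' b' t : R) : angle a b t -> 0 < a * a' + b * b' ->
  angle a' b' (t + atan ((a * b' - b * a') / (a * a' + b * b'))).
Proof.
move=> [r r0 [aE bE]]; set D := _ + b * b'; set C := a * b' - _ => D0.
set d := atan _.
have cd : 0 < cos d by rewrite cos_gt0_pihalf// atan_gtNpi2 atan_ltpi2.
have sd : sin d = C / D * cos d.
  have : tan d = C / D by rewrite /d atanK.
  by rewrite /tan => <-; rewrite divfK// gt_eqF.
have rr : r * r = a * a + b * b.
  by rewrite aE bE -[LHS]mulr1 -(cos2Dsin2 t); ring.
exists (D / (r * cos d)); first by rewrite divr_gt0// mulr_gt0.
have r_neq0 : r != 0 by rewrite gt_eqF.
have D_neq0 : D != 0 by rewrite gt_eqF.
have cd_neq0 : cos d != 0 by rewrite gt_eqF.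
have cE : cos t = a / r by rewrite aE; field.
have sE : sin t = b / r by rewrite bE; field.
rewrite cosD sinD sd cE sE; split.
  transitivity ((D * a - C * b) / (r * r)); last by field; rewrite r_neq0 D_neq0 cd_neq0.
  rewrite -[LHS](mulfK (_ : r * r != 0)); last by rewrite mulf_neq0.
  by congr (_ / _); rewrite rr /C /D; ring.
transitivity ((D * b + C * a) / (r * r)); last by field; rewrite r_neq0 D_neq0 cd_neq0.
rewrite -[LHS](mulfK (_ : r * r != 0)); last by rewrite mulf_neq0.
by congr (_ / _); rewrite rr /C /D; ring.
Qed.

Lemma angle_eq_cos1 (a b s t : R) : angle a b s -> angle a b t -> cos (s - t) = 1.
Proof.
move=> [r r0 [-> ->]] [r' r'0 [cE sE]].
have rr : r ^+ 2 = r' ^+ 2.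
  rewrite -[LHS]mulr1 -[RHS]mulr1 -{1}(cos2Dsin2 s) -(cos2Dsin2 t).
  by rewrite !mulrDr -!exprMn cE sE.
have /eqP : r = r' by apply/eqP; rewrite -(@eqrXn2 _ 2)// ?ltW//; exact/eqP.
move=> /eqP rE; subst r'.
have cE' : cos s = cos t by apply: (mulfI (lt0r_neq0 r0)).
have sE' : sin s = sin t by apply: (mulfI (lt0r_neq0 r0)).
by rewrite cosB cE' sE' -!expr2 cos2Dsin2.
Qed.

(** Between two distinct values [g] would go through a point where the cosine
    is not 1. *)
Lemma cos1_connected (g : R -> R) : continuous g -> (forall s, cos (g s) = 1) ->
  forall s t, g s = g t.
Proof.
move=> cg g1.
have key (a b : R) (d : R) : 0 < d -> g a + d = g b -> False.
  move=> d0 gab.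
  have cd : cos d = 1.
    have dE : d = g b - g a by lra.
    have sin0 u : cos u = 1 -> sin u = 0.
      move=> cu; apply/eqP; rewrite -sqrf_eq0; apply/eqP.
      by have := cos2Dsin2 u; rewrite cu; lra.
    by rewrite dE cosB !g1 !sin0 //; ring.
  have [dpi|dpi] := leP d pi.
    have := @ltr_cos R 0 d; rewrite !in_itv /= lexx pi_ge0 (ltW d0) dpi => /(_ isT isT).
    by rewrite cos0 cd ltxx d0.
  have [c gc] : exists c, g c = g a + pi.
    have pi0 := @pi_gt0 R.
    wlog ab : a b gab / a <= b.
      move=> wl; have [ab|ab] := leP a b; first exact: (wl a b).
      have [|c _ gc] := @IVT _ g b a (g a + pi) (ltW ab) (continuous_subspaceT cg).
        by rewrite ge_min le_max; apply/andP; split; apply/orP; [right|left]; lra.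
      by exists c.
    have [|c _ gc] := @IVT _ g a b (g a + pi) ab (continuous_subspaceT cg).
      by rewrite ge_min le_max; apply/andP; split; apply/orP; [left|right]; lra.
    by exists c.
  by have := g1 c; rewrite gc cosDpi g1; lra.
move=> s t; have [st|st|//] := ltgtP (g s) (g t); exfalso.
  by apply: (key s t (g t - g s)); lra.
by apply: (key t s (g s - g t)); lra.
Qed.

End Angles.

Lemma continuous_sum_at (R : realType) (T : topologicalType) (x : T) n
    (f : 'I_n -> T -> R) : (forall k, {for x, continuous (f k)}) ->
  {for x, continuous (fun y => \sum_(k < n) f k y)}.
Proof.
by move=> cf; apply: cvg_big => [|k _]; [exact: add_continuous|exact: cf].
Qed.

Lemma continuous_pair_at (T U V : topologicalType) (x : T) (f : T -> U) (g : T -> V) :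
  {for x, continuous f} -> {for x, continuous g} ->
  {for x, continuous (fun y => (f y, g y))}.
Proof. by move=> cf cg; apply: (cvg_pair (G := nbhs (f x)) (H := nbhs (g x))). Qed.

Section Lifts.
Variable R : realType.
Implicit Types (x m : sphere R) (v : 'rV[R]_3).

Lemma continuous_at_into_sphere (T : topologicalType) (f : T -> sphere R) (t : T) :
  {for t, continuous (fun t => val (f t))} -> {for t, continuous f}.
Proof.
move=> ft A [_ [[B oB <-] /= Bx] BA].
by apply: filterS BA _; exact: (ft B (open_nbhs_nbhs (conj oB Bx))).
Qed.

(** Radial projection onto the sphere. *)
Definition nrm v : sphere R := insubd (spherical 0 0) ((Num.sqrt (dot v v))^-1 *: v).

Lemma val_nrm v : v <> 0 -> val (nrm v) = (Num.sqrt (dot v v))^-1 *: v.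
Proof.
move=> v0; rewrite /nrm val_insubd mem_set//=.
rewrite /sphere /= dotZl dotZr mulrA -expr2 exprVn sqr_sqrtr ?dot_ge0// mulVf//.
by apply/eqP => /dot_eq0.
Qed.

Lemma nrm_val x : nrm (val x) = x.
Proof.
apply/val_inj; rewrite val_nrm ?sphere_dot ?sqrtr1 ?invr1 ?scale1r// => x0.
have := sphere_dot x; rewrite x0 dotE !mxE; lra.
Qed.

Lemma continuous_nrm v : v <> 0 -> {for v, continuous nrm}.
Proof.
move=> v0; apply: continuous_at_into_sphere; rewrite /prop_for /continuous_at val_nrm//.
have dv : dot v v != 0 by apply/eqP => /dot_eq0.
have cdot : (fun w => dot w w) @ v --> dot v v.
  by apply: continuous_dot => w; exact: cvg_id.
have wE : \forall w \near nbhs v, (Num.sqrt (dot w w))^-1 *: w = val (nrm w).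
  apply: filterS (cvgr_neq0 _ cdot dv) => w dw; rewrite val_nrm// => w0.
  by move: dw; rewrite w0 dotE !mxE !mul0r !addr0 eqxx.
apply: cvg_trans (near_eq_cvg wE) _.
apply: cvgZ; last exact: cvg_id.
apply: cvgV; first by rewrite sqrtr_eq0 -ltNge lt_neqAle eq_sym dv dot_ge0.
exact: (@continuous_comp _ _ _ (fun w : 'rV[R]_3 => dot w w) Num.sqrt v cdot (@sqrt_continuous R _)).
Qed.

Variables (m : sphere R) (c : R).
Hypothesis c1 : -1 < c.

Let D : set (sphere R) := [set x | c <= dot (val m) (val x)].

Let seg (t : R) x := (1 - t) *: val m + t *: val x.

Let seg_neq0 t x : 0 <= t <= 1 -> D x -> seg t x <> 0.
Proof.
move=> t01 Dx s0; have := dot_ge0 (seg t x).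
have -> : dot (seg t x) (seg t x) =
    (1 - 2 * t) ^+ 2 + 2 * t * (1 - t) * (1 + dot (val m) (val x)).
  by rewrite /seg !(dotDl, dotDr, dotZl, dotZr) !sphere_dot (dotC (val x)); ring.
have := dot_ge0 (seg t x); have -> : dot (seg t x) (seg t x) = 0.
  by rewrite s0 dotE !mxE; ring.
have := sqr_ge0 (1 - 2 * t) => h _ _.
have : dot (seg t x) (val m) = 0 by rewrite s0 dotE !mxE; ring.
have : dot (seg t x) (val x) = 0 by rewrite s0 dotE !mxE; ring.
rewrite /seg !(dotDl, dotZl) !sphere_dot (dotC (val x)).
set q := dot _ _ => e1 e2.
have q1 : -1 < q by exact: lt_le_trans Dx.
have : (1 + q) = 0 by lra.
lra.
Qed.

Let pth t x := nrm (seg t x).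

Let continuous_pth t x : 0 <= t <= 1 -> D x ->
  {for (x, t), continuous (fun z : sphere R * R => pth z.2 z.1)}.
Proof.
move=> t01 Dx.
apply: (@continuous_comp _ _ _ (fun z : sphere R * R => seg z.2 z.1) nrm); last first.
  exact/continuous_nrm/seg_neq0.
apply: cvgD; apply: cvgZ.
- by apply: cvgB; [exact: cvg_cst|exact: cvg_snd].
- exact: cvg_cst.
- exact: cvg_snd.
- apply: (@continuous_comp _ _ _ fst (fun x : sphere R => val x)); first exact: cvg_fst.
  exact: sphere_val_continuous.
Qed.

Variables u1 u2 : sphere R -> R.
Hypotheses (cu1 : continuous u1) (cu2 : continuous u2).
Hypothesis u_neq0 : forall x, D x -> 0 < u1 x ^+ 2 + u2 x ^+ 2.

(** Along the path the functional [dot (val m)] is at least its value at the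
    end [x]. *)
Let pth_D t x : 0 <= t <= 1 -> D x -> D (pth t x).
Proof.
move=> t01 Dx; rewrite /D /= /pth val_nrm; last exact: seg_neq0.
set n := dot (seg t x) (seg t x).
set q := dot (val m) (val x).
have q1 : q <= 1 by exact: sphere_dot_le1.
have nE : n = (1 - t) ^+ 2 + t ^+ 2 + 2 * t * (1 - t) * q.
  by rewrite /n /seg !(dotDl, dotDr, dotZl, dotZr) !sphere_dot (dotC (val x)) -/q; ring.
have n0 : 0 < n.
  rewrite lt_neqAle dot_ge0 andbT eq_sym; apply/eqP => /dot_eq0.
  exact: seg_neq0.
rewrite dotZr /seg !(dotDr, dotZr) sphere_dot -/q mulr1.
set w := 1 - t + t * q.
have s0 : 0 < Num.sqrt n by rewrite sqrtr_gt0.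
apply: le_trans (_ : q <= _); first exact: Dx.
rewrite mulrC ler_pdivlMr//.
have /andP[t0 t1] := t01.
have tt : 0 <= t * (1 - t) * (1 - q) by rewrite !mulr_ge0//; lra.
have wq : q <= w by have : 0 <= (1 - t) * (1 - q) by [rewrite mulr_ge0//; lra]; rewrite /w; lra.
have [q0|q0] := leP 0 q.
  have s1 : Num.sqrt n <= 1 by rewrite -(sqrtr1 R) ler_sqrt// nE; lra.
  by apply: le_trans wq; rewrite -[leRHS]mulr1 ler_wpM2l.
have [w0|w0] := leP 0 w; first by apply: le_trans w0; rewrite mulr_le0_ge0 ?(ltW q0)// ltW.
rewrite -lerN2 -mulNr -(@ler_pXn2r _ 2)// ?nnegrE; [|by lra|by apply: mulr_ge0; lra].
rewrite !sqrrN exprMn sqrrN sqr_sqrtr ?(ltW n0)// nE /w.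
have q21 : 0 <= 1 - q ^+ 2.
  have -> : 1 - q ^+ 2 = (1 - q) * (1 + q) by ring.
  by have := sphere_dot_geN1 m x; rewrite -/q => qN; rewrite mulr_ge0//; lra.
have : 0 <= (1 - t) * (1 - q ^+ 2) * (- ((1 - t) + 2 * t * q)).
  by rewrite mulr_ge0 ?mulr_ge0//; move: w0; rewrite /w; lra.
lra.
Qed.

Let h (z : (sphere R * R) * R) :=
  u1 (pth z.1.2 z.1.1) * u1 (pth z.2 z.1.1) + u2 (pth z.1.2 z.1.1) * u2 (pth z.2 z.1.1).

Let continuous_h t x : 0 <= t <= 1 -> D x -> {for ((x, t), t), continuous h}.
Proof.
move=> t01 Dx.
have c1' u : continuous u -> {for ((x, t), t), continuous (fun z : (sphere R * R) * R => u (pth z.1.2 z.1.1) : R)}.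
  move=> cu; apply: (@continuous_comp _ _ _ (fun z : (sphere R * R) * R => pth z.1.2 z.1.1) u); last exact: cu.
  apply: (@continuous_comp _ _ _ fst (fun z : sphere R * R => pth z.2 z.1)); first exact: cvg_fst.
  exact: continuous_pth.
have c2' u : continuous u -> {for ((x, t), t), continuous (fun z : (sphere R * R) * R => u (pth z.2 z.1.1) : R)}.
  move=> cu; apply: (@continuous_comp _ _ _ (fun z : (sphere R * R) * R => pth z.2 z.1.1) u); last exact: cu.
  apply: (@continuous_comp _ _ _ (fun z : (sphere R * R) * R => (z.1.1, z.2)) (fun z : sphere R * R => pth z.2 z.1)).
    apply: continuous_pair_at; last exact: cvg_snd.
    by apply: (@continuous_comp _ _ _ fst fst); [exact: cvg_fst|exact: cvg_fst].
  exact: continuous_pth.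
by apply: cvgD; apply: cvgM; (exact: c1' || exact: c2').
Qed.

Let uniform_step : exists N : nat, forall x s t, D x -> 0 <= t <= 1 ->
  `|t - s| <= N.+1%:R^-1 -> 0 < h ((x, t), s).
Proof.
have cK : compact (D `*` `[0, 1]%classic : set (sphere R * R)).
  apply: compact_setX; last exact: segment_compact.
  exact/closed_sphere_compact/closed_cap.
pose P (n : nat) (z : sphere R * R) := forall s, `|z.2 - s| <= n.+1%:R^-1 -> 0 < h (z, s).
have [] := (compact_near_coveringP _).1 cK nat \oo P _; last first.
  move=> N _ /(_ N (leqnn _)) PN; exists N => x s t Dx t01; apply: (PN (x, t)).
  by split => //=; rewrite in_itv.
move=> [x t] [/= Dx]; rewrite in_itv /= => t01.
have hpos : 0 < h ((x, t), t).
  by rewrite /h /= -!expr2; exact/u_neq0/pth_D.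
have := @cvgr_gt _ _ _ _ h _ (continuous_h t01 Dx) _ hpos.
move=> [[/= A B] [Axt /nbhs_ballP[e /= e0 eB]] AB].
have e20 : 0 < e / 2 by rewrite divr_gt0.
have near_inv : \forall n \near \oo, n.+1%:R^-1 < e / 2 :> R by exact: near_infty_natSinv_lt (PosNum e20).
exists (A `&` (fun z => `|t - z.2| < e / 2), [set n | n.+1%:R^-1 < e / 2]) => /=.
  split => //; apply: filterI => //.
  exists (setT, ball t (e / 2)) => /=; first by split; [exact: filterT|exact: nbhsx_ballx].
  by move=> [y s] /= [_].
move=> [[y r] n] /= [[Ayr tr] nE] s /= rs; apply: (AB ((y, r), s)); split => //=.
apply: eB; rewrite /ball /=; rewrite (_ : t - s = (t - r) + (r - s)); last by ring.
by apply: le_lt_trans (ler_normD _ _) _; rewrite (splitr e); apply: ltrD => //; exact: le_lt_trans rs nE.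
Qed.

(** The segments from [m] contract [D] to a point; subdivided finely enough,
    they let the angle of [u] be followed by small increments. *)
Lemma angle_lift : exists theta : sphere R -> R,
  forall x, D x -> {for x, continuous theta} /\ angle (u1 x) (u2 x) (theta x).
Proof.
have [N hN] := uniform_step.
pose tk (k : nat) : R := k%:R / N.+1%:R.
have tk01 k : (k <= N.+1)%N -> 0 <= tk k <= 1.
  by move=> kN; rewrite /tk divr_ge0//= ler_pdivrMr ?ltr0n// mul1r ler_nat.
pose a k x := u1 (pth (tk k) x).
pose b k x := u2 (pth (tk k) x).
pose step k x := atan ((a k x * b k.+1 x - b k x * a k.+1 x) /
                       (a k x * a k.+1 x + b k x * b k.+1 x)).
have step_pos k x : (k < N.+1)%N -> D x ->
    0 < a k x * a k.+1 x + b k x * b k.+1 x.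
  move=> kN Dx; apply: (hN x (tk k.+1) (tk k)) => //; first exact/tk01/ltnW.
  by rewrite distrC /tk -mulrBl -natrB// subSnn mul1r ger0_norm ?invr_ge0.
have [D0|/set0P[x0 Dx0]] := eqVneq D set0.
  by exists (fun=> 0) => x; rewrite D0.
have p0 x : pth 0 x = m.
  by rewrite /pth /seg subr0 scale1r scale0r addr0 nrm_val.
have p1 x : pth 1 x = x.
  by rewrite /pth /seg subrr scale1r scale0r add0r nrm_val.
have Dm' : D m by rewrite -(p0 x0); apply: pth_D => //; rewrite lexx ler01.
have [t0 mt0] := angle_exists (u_neq0 Dm').
exists (fun x => t0 + \sum_(k < N.+1) step k x) => x Dx; split.
  suff cs : {for x, continuous (fun y => \sum_(k < N.+1) step k y)}.
    exact: (continuousD (@cst_continuous (sphere R) R t0 x) cs).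
  apply: (@continuous_sum_at R (sphere R) x N.+1 (fun k => step k)) => k.
  have cpt j : (j <= N.+1)%N -> {for x, continuous (fun x => pth (tk j) x)}.
    move=> jN; apply: (@continuous_comp _ _ _ (fun y : sphere R => (y, tk j)) (fun z : sphere R * R => pth z.2 z.1)).
      by apply: continuous_pair_at; [exact: (fun A => id)|exact: (@cst_continuous _ _ (tk j) x)].
    by apply: continuous_pth => //; exact: tk01.
  have ca j : (j <= N.+1)%N -> {for x, continuous (a j)}.
    by move=> jN; apply: (@continuous_comp _ _ _ (fun x => pth (tk j) x) u1); [exact: cpt|exact: cu1].
  have cb j : (j <= N.+1)%N -> {for x, continuous (b j)}.
    by move=> jN; apply: (@continuous_comp _ _ _ (fun x => pth (tk j) x) u2); [exact: cpt|exact: cu2].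
  have kN := ltn_ord k; have kN' := ltnW kN.
  apply: (@continuous_comp _ _ _ (fun x => (a k x * b k.+1 x - b k x * a k.+1 x) /
                       (a k x * a k.+1 x + b k x * b k.+1 x)) atan); last exact: continuous_atan.
  have cnum := continuousB (continuousM (ca k kN') (cb k.+1 kN)) (continuousM (cb k kN') (ca k.+1 kN)).
  have cden := continuousD (continuousM (ca k kN') (ca k.+1 kN)) (continuousM (cb k kN') (cb k.+1 kN)).
  apply: (continuousM cnum); apply: (continuousV _ cden).
  by rewrite gt_eqF// step_pos.
have lift k : (k <= N.+1)%N -> angle (a k x) (b k x) (t0 + \sum_(j < k) step j x).
  elim: k => [_|k IH kN]; first by rewrite big_ord0 addr0 /a /b /tk mul0r p0.
  rewrite big_ord_recr /= addrA; apply: angle_step; first exact/IH/ltnW.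
  exact: step_pos.
have := lift N.+1 (leqnn _).
by rewrite /a /b /tk divff ?pnatr_eq0// p1.
Qed.

End Lifts.

(** * Points covered at least twice *)

Section TwoPreimages.
Variable R : realType.
Implicit Types (x : sphere R).

Lemma spherical0E (a b : R) : val (spherical a b) 0 0 = sin a * cos b.
Proof. by rewrite /= mxE. Qed.

Lemma spherical1E (a b : R) : val (spherical a b) 0 1 = sin a * sin b.
Proof. by rewrite /= mxE. Qed.

Lemma spherical2E (a b : R) : val (spherical a b) 0 2%:R = cos a.
Proof. by rewrite /= mxE. Qed.

Lemma continuous_spherical (T : topologicalType) (a b : T -> R) :
  continuous a -> continuous b -> continuous (fun t => spherical (a t) (b t)).
Proof.
move=> ca cb; apply: continuous_into_sphere.
have csin f : continuous f -> continuous (fun t : T => sin (f t) : R).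
  by move=> cf t; apply: (@continuous_comp _ _ _ f sin t (cf t)); exact: continuous_sin.
have ccos f : continuous f -> continuous (fun t : T => cos (f t) : R).
  by move=> cf t; apply: (@continuous_comp _ _ _ f cos t (cf t)); exact: continuous_cos.
apply: continuous_row3 => t /=; under eq_fun do rewrite mxE /=.
- exact: (continuousM (csin _ ca t) (ccos _ cb t)).
- exact: (continuousM (csin _ ca t) (csin _ cb t)).
- exact: ccos.
Qed.

Lemma spherical_surj x : exists a b,
  [/\ 0 <= a <= pi, 0 <= b <= 2 * pi & x = spherical a b].
Proof.
have xx := sphere_dot x; rewrite dotE -!expr2 in xx.
set x0 := val x 0 0 in xx *; set x1 := val x 0 1 in xx *; set x2 := val x 0 2%:R in xx *.
have x21 : -1 <= x2 <= 1.
  rewrite -ler_norml -(@ler_pXn2r _ 2)// ?nnegrE// expr1n real_normK ?num_real//.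
  by have := sqr_ge0 x0; have := sqr_ge0 x1; lra.
have a0 := acos_ge0 x21; have api := acos_lepi x21.
have ca : cos (acos x2) = x2 by rewrite acosK// in_itv.
have sa : sin (acos x2) ^+ 2 = x0 ^+ 2 + x1 ^+ 2.
  by have := cos2Dsin2 (acos x2); rewrite ca; lra.
have [s0|s0] := eqVneq (sin (acos x2)) 0.
  have pi0 := @pi_gt0 R.
  exists (acos x2), 0; split; [by lra|by lra|].
  have x00 : x0 = 0.
    apply/eqP; rewrite -sqrf_eq0; apply/eqP; have := sqr_ge0 x0; have := sqr_ge0 x1.
    by move: sa; rewrite s0; lra.
  have x10 : x1 = 0.
    apply/eqP; rewrite -sqrf_eq0; apply/eqP; have := sqr_ge0 x0; have := sqr_ge0 x1.
    by move: sa; rewrite s0; lra.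
  by apply/val_inj/row3P; rewrite ?spherical0E ?spherical1E ?spherical2E ?s0 ?mul0r.
have [|b b2pi [cb sb]] := @unit_angle_exists R (x0 / sin (acos x2)) (x1 / sin (acos x2)).
  by rewrite !expr_div_n -mulrDl -sa divff// sqrf_eq0.
exists (acos x2), b; split; [by lra|by lra|].
by apply/val_inj/row3P; rewrite ?spherical0E ?spherical1E ?spherical2E -?cb -?sb ?ca//
  mulrC divfK.
Qed.

Section LiftSphere.
Variables u1 u2 : sphere R -> R.
Hypotheses (cu1 : continuous u1) (cu2 : continuous u2).

(** The lifts over the two closed hemispheres differ by a constant on the
    equator, which is connected. *)
Lemma angle_lift_sphere : (forall x, 0 < u1 x ^+ 2 + u2 x ^+ 2) ->
  exists2 theta : sphere R -> R, continuous theta &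
    forall x, angle (u1 x) (u2 x) (theta x).
Proof.
move=> u0.
pose z x := val x 0 2%:R.
have cz : continuous z.
  move=> x; apply: (@continuous_comp _ _ _ _ (fun v : 'rV[R]_3 => v 0 2%:R)).
    exact: sphere_val_continuous.
  exact: coord_continuous_row.
have N1 : -1 < 0 :> R by lra.
have [tn hn] := @angle_lift R (spherical 0 0) 0 N1 u1 u2 cu1 cu2 (fun x _ => u0 x).
have [ts hs] := @angle_lift R (spherical pi 0) 0 N1 u1 u2 cu1 cu2 (fun x _ => u0 x).
have zn x : dot (val (spherical 0 0 : sphere R)) (val x) = z x.
  by rewrite dotE spherical0E spherical1E spherical2E sin0 cos0 /z; ring.
have zs x : dot (val (spherical pi 0 : sphere R)) (val x) = - z x.
  by rewrite dotE spherical0E spherical1E spherical2E sinpi cospi /z; ring.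
have {zn}hn x : 0 <= z x -> {for x, continuous tn} /\ angle (u1 x) (u2 x) (tn x).
  by move=> zx; apply: hn; rewrite /= zn.
have {zs}hs x : z x <= 0 -> {for x, continuous ts} /\ angle (u1 x) (u2 x) (ts x).
  by move=> zx; apply: hs; rewrite /= zs oppr_ge0.
pose eq b : sphere R := spherical (pi / 2) b.
have zeq b : z (eq b) = 0 by rewrite /z spherical2E cos_pihalf.
have ceq : continuous eq.
  by apply: continuous_spherical; [exact: cst_continuous|move=> t; exact: cvg_id].
pose g b := tn (eq b) - ts (eq b).
have cg : continuous g.
  move=> b; apply: (continuousB (f := tn \o eq) (g := ts \o eq)).
    by apply: continuous_comp; [exact: ceq|apply: (hn _ _).1; rewrite zeq].
  by apply: continuous_comp; [exact: ceq|apply: (hs _ _).1; rewrite zeq].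
have g1 b : cos (g b) = 1.
  by apply: angle_eq_cos1 (hn _ _).2 (hs _ _).2; rewrite zeq.
pose d := g 0.
have cd : cos d = 1 by exact: g1.
have sd : sin d = 0.
  by apply/eqP; rewrite -sqrf_eq0; apply/eqP; have := cos2Dsin2 d; rewrite cd; lra.
have tE x : z x = 0 -> tn x = ts x + d.
  move=> zx.
  have xx := sphere_dot x; rewrite dotE -!expr2 -/(z x) zx in xx.
  have [|c _ [cc sc]] := @unit_angle_exists R (val x 0 0) (val x 0 1); first by lra.
  have -> : x = eq c.
    apply/val_inj/row3P; rewrite ?spherical0E ?spherical1E ?sin_pihalf ?mul1r//.
    by rewrite -/(z x) zx -/(z (eq c)) zeq.
  by rewrite /d (cos1_connected cg g1 0 c) /g; ring.
exists (fun x => if 0 <= z x then tn x else ts x + d); last first.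
  move=> x; case: ifPn => [zx|]; first exact: (hn _ zx).2.
  rewrite -ltNge => /ltW/hs[_ [r r0 [-> ->]]]; exists r => //.
  by rewrite cosD sinD cd sd !mulr1 !mulr0 subr0 addr0.
move=> x A.
have opos : open [set y | 0 < z y].
  by apply: (@open_comp _ _ z [set r | 0 < r]) => [? _|]; [exact: cz|exact: open_gt].
have oneg : open [set y | z y < 0].
  by apply: (@open_comp _ _ z [set r | r < 0]) => [? _|]; [exact: cz|exact: open_lt].
have cts : z x <= 0 -> {for x, continuous (fun y => ts y + d)}.
  by move=> zx; apply: (continuousD (hs x zx).1); exact: cst_continuous.
case: ifPn => [zx|]; last first.
  rewrite -ltNge => zx; have zx' := ltW zx => /(cts zx').
  move=> /(filterI (open_nbhs_nbhs (conj oneg zx))); apply: filterS => y [/= zy Ay].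
  by rewrite leNgt zy.
move=> tA; have tnA : nbhs x (tn @^-1` A) by exact: (hn x zx).1 A tA.
case: (ltgtP (z x) 0) zx => // zx _.
  move: tnA => /(filterI (open_nbhs_nbhs (conj opos zx))).
  by apply: filterS => y [/= zy Ay]; rewrite ltW.
have : nbhs x ((fun y => ts y + d) @^-1` A).
  by apply: cts; rewrite ?zx// -tE.
by move=> /(filterI tnA); apply: filterS => y [/= A1 A2]; case: ifP.
Qed.

End LiftSphere.

(** A ray from a point inside a triangle does not meet all three side lines:
    here [t] is its direction, the legs are along the axes, and [A], [B] and
    [S] are the positions of the sides relative to the point. *)
Lemma same_angle_meets_sides (A B S r1 r2 r3 t : R) :
  A < 0 /\ B < 0 /\ 0 < S \/ 0 < A /\ 0 < B /\ S < 0 ->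
  0 < r1 -> 0 < r2 -> 0 < r3 -> A = r1 * cos t -> B = r2 * sin t ->
  S = r3 * cos t + r3 * sin t -> False.
Proof.
move=> h r10 r20 r30 AE BE SE; move: h; rewrite AE BE SE -mulrDr.
rewrite !pmulr_rlt0// !pmulr_rgt0//; lra.
Qed.

Variables (p1 p2 p3 : sphere R) (tau : set (sphere R) -> R).
Hypotheses (p12 : p1 <> p2) (p13 : p1 <> p3) (p23 : p2 <> p3).
Hypotheses (qm : is_quasi_measure tau) (ext : extends_three_point p1 p2 p3 tau).
Variables (F G : sphere R -> R) (a b s y1 y2 : R).
Hypotheses (cF : continuous F) (cG : continuous G).
Hypotheses (Fa : tau [set x | F x = a] = 1) (Gb : tau [set x | G x = b] = 1).
Hypothesis FGs : tau [set x | F x + G x = s] = 1.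
Hypothesis y_in : a < y1 /\ b < y2 /\ y1 + y2 < s \/ y1 < a /\ y2 < b /\ s < y1 + y2.

Let u1 x := F x - y1.
Let u2 x := G x - y2.
Let cu1 : continuous u1.
Proof. by move=> x; exact: (continuousB (@cF x) (@cst_continuous (sphere R) R y1 x)). Qed.
Let cu2 : continuous u2.
Proof. by move=> x; exact: (continuousB (@cG x) (@cst_continuous (sphere R) R y2 x)). Qed.

Let sides x := [\/ F x = a, G x = b | F x + G x = s].

(** A fibre of full quasi-measure of an angle function around an interior
    point of the triangle would be a ray that meets the three sides. *)
Let no_angle_function (theta : sphere R -> R) : continuous theta ->
  (forall x, sides x -> angle (u1 x) (u2 x) (theta x)) -> False.
Proof.
move=> ct ang.
have t1 := tau_level p12 p13 p23 qm ext ct; set t := quasi_state_of _ _ in t1.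
have clt := @closed_level _ _ ct t.
have cFG : continuous (fun x => F x + G x) by move=> x; exact: (continuousD (@cF x) (@cG x)).
have [x [/= xt xa]] := tau_meet qm clt (@closed_level _ _ cF a) t1 Fa.
have [y [/= yt yb]] := tau_meet qm clt (@closed_level _ _ cG b) t1 Gb.
have [z [/= zt zs]] := tau_meet qm clt (@closed_level _ _ cFG s) t1 FGs.
have [|r1 r10 [e1 _]] := ang x; first exact: Or31.
have [|r2 r20 [_ e2]] := ang y; first exact: Or32.
have [|r3 r30 [e3 e4]] := ang z; first exact: Or33.
have S : s - (y1 + y2) = r3 * cos t + r3 * sin t.
  by rewrite -zt -e3 -e4 /u1 /u2 -zs; ring.
apply: (@same_angle_meets_sides (a - y1) (b - y2) (s - (y1 + y2)) r1 r2 r3 t) => //.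
- by case: y_in; [left|right]; lra.
- by rewrite -xt -e1 /u1 xa.
- by rewrite -yt -e2 /u2 yb.
Qed.

(** If the value is only taken at [x0], the angle of [(F, G) - y] lifts to the
    complement of a small cap around [x0]. A cutoff [chi] makes it a
    continuous function on the sphere without changing it on the three fibres,
    which stay away from [x0]. *)
Lemma another_preimage x0 : exists2 x, x <> x0 & F x = y1 /\ G x = y2.
Proof.
apply: contrapT => no.
have u_neq0 x : x <> x0 -> 0 < u1 x ^+ 2 + u2 x ^+ 2.
  move=> xx0; rewrite lt_neqAle addr_ge0 ?sqr_ge0// andbT eq_sym.
  rewrite paddr_eq0 ?sqr_ge0// !sqrf_eq0 !subr_eq0; apply/negP => /andP[/eqP ? /eqP ?].
  by apply: no; exists x.
have [u00|u00] := ltP 0 (u1 x0 ^+ 2 + u2 x0 ^+ 2).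
  have [|theta ct ang] := @angle_lift_sphere u1 u2 cu1 cu2.
    by move=> x; have [->//|/eqP xx0] := eqVneq x x0; exact: u_neq0.
  by apply: (no_angle_function ct) => x _; exact: ang.
pose r x := u1 x ^+ 2 + u2 x ^+ 2.
have cr : continuous r.
  by move=> x; apply: (continuousD (continuousM (@cu1 x) (@cu1 x)) (continuousM (@cu2 x) (@cu2 x))).
have [e e0 side_e] : exists2 e, 0 < e & forall x, sides x -> e <= r x.
  pose A := (a - y1) ^+ 2; pose B := (b - y2) ^+ 2; pose S := (s - (y1 + y2)) ^+ 2 / 2.
  have A0 : 0 < A by rewrite exprn_even_gt0//=; apply/eqP => ?; case: y_in; lra.
  have B0 : 0 < B by rewrite exprn_even_gt0//=; apply/eqP => ?; case: y_in; lra.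
  have S0 : 0 < S by rewrite divr_gt0// exprn_even_gt0//=; apply/eqP => ?; case: y_in; lra.
  exists (Num.min A (Num.min B S)); first by rewrite !lt_min A0 B0 S0.
  move=> x; have := sqr_ge0 (u1 x); have := sqr_ge0 (u2 x) => h2 h1 [xe|xe|xe].
  - by rewrite ge_min; apply/orP; left; rewrite /A -xe /r -/(u1 x); lra.
  - by rewrite !ge_min; apply/orP; right; apply/orP; left; rewrite /B -xe /r -/(u2 x); lra.
  - rewrite !ge_min; apply/orP; right; apply/orP; right.
    have -> : S = (u1 x + u2 x) ^+ 2 / 2 by rewrite /S -xe /u1 /u2; congr (_ ^+ 2 / 2); ring.
    rewrite /r; have := sqr_ge0 (u1 x - u2 x).
    have -> : (u1 x - u2 x) ^+ 2 = u1 x ^+ 2 + u2 x ^+ 2 - 2 * (u1 x * u2 x) by ring.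
    have -> : (u1 x + u2 x) ^+ 2 = u1 x ^+ 2 + u2 x ^+ 2 + 2 * (u1 x * u2 x) by ring.
    lra.
have oV : open [set x | r x < e / 2].
  by apply: (@open_comp _ _ r [set w | w < e / 2]) => [x _|]; [exact: cr|exact: open_lt].
have Vx0 : [set x | r x < e / 2] x0.
  by rewrite /= (le_lt_trans u00)// divr_gt0.
have [c c0 cV] := cap_basis (open_nbhs_nbhs (conj oV Vx0)).
have [m mE] : exists m : sphere R, val m = - val x0.
  have h : dot (- val x0) (- val x0) = 1 by rewrite dotNl dotNr opprK sphere_dot.
  by exists (mk_sphere h).
have [|x|theta th] := @angle_lift R m (c - 1) _ u1 u2 cu1 cu2; first by lra.
  rewrite /= mE dotNl => cx; apply: u_neq0 => xx0.
  by move: cx; rewrite xx0 sphere_dot; lra.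
have far x : e / 2 <= r x -> c - 1 <= dot (val m) (val x).
  move=> rx; rewrite mE dotNl lerNr opprB leNgt; apply/negP => /ltW /cV /=.
  by rewrite ltNge rx.
pose chi x := Num.max 0 (Num.min 1 (2 * r x / e - 1)).
have cchi : continuous chi.
  move=> x; have h := continuousB (continuousM (continuousM (@cst_continuous _ _ (2 : R) x) (cr x))
    (@cst_continuous _ _ e^-1 x)) (@cst_continuous _ _ (1 : R) x).
  have h1 := @continuous_min R _ (fun=> 1) _ x (@cst_continuous _ _ _ x) h.
  exact: (@continuous_max R _ (fun=> 0) _ x (@cst_continuous _ _ _ x) h1).
have chi0 x : r x <= e / 2 -> chi x = 0.
  move=> rx; rewrite /chi; apply/max_idPl; rewrite ge_min; apply/orP; right.
  by rewrite subr_le0 ler_pdivrMr//; lra.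
have chi1 x : e <= r x -> chi x = 1.
  move=> rx; rewrite /chi (min_idPl _); first by apply/max_idPr.
  by rewrite lerBrDr ler_pdivlMr//; lra.
apply: (@no_angle_function (fun x => chi x * theta x)).
  move=> x; have [rx|rx] := leP (e / 2) (r x).
    exact: (continuousM (cchi x) (th x (far _ rx)).1).
  move=> A /= hA.
  have := open_nbhs_nbhs (conj oV rx); apply: filterS => y /= ry.
  by rewrite chi0 ?(ltW ry)// mul0r; move: (nbhs_singleton hA); rewrite chi0 ?(ltW rx)// mul0r.
move=> x /side_e rx; rewrite chi1// mul1r; apply: (th x _).2; apply: far; lra.
Qed.

End TwoPreimages.

(** * Plane measure *)

Section PlaneMeasure.
Variable R : realType.

Notation mu := (@lebesgue_measure R).
Notation mu2 := (mu \x mu)%E.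

Lemma open_measurable_plane (U : set (R * R)) : open U -> measurable U.
Proof.
move=> oU.
pose sq (p q : rat) (n : nat) : set (R * R) :=
  ball (ratr p : R) n.+1%:R^-1 `*` ball (ratr q : R) n.+1%:R^-1.
pose S n p q : set (R * R) := if `[< sq p q n `<=` U >] then sq p q n else set0.
have -> : U = \bigcup_n \bigcup_p \bigcup_q S n p q.
  apply/seteqP; split; last first.
    by move=> z [n _ [p _ [q _]]]; rewrite /S; case: asboolP => // sU /sU.
  move=> [x y] Uxy.
  have : nbhs (x, y) U by exact: open_nbhs_nbhs.
  move=> /nbhs_ballP[e /= e0 eU].
  have e20 : 0 < e / 2 by rewrite divr_gt0.
  have [n nE] : exists n : nat, n.+1%:R^-1 < e / 2 :> R.
    by have [N _ /(_ N (leqnn N))] := near_infty_natSinv_lt (PosNum e20); exists N.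
  have n0 : 0 < n.+1%:R^-1 :> R by rewrite invr_gt0.
  have rat_near (w d : R) : 0 < d -> exists p : rat, ball w d (ratr p : R).
    move=> d0; have /rat_in_itvoo[p] : w - d < w + d by lra.
    rewrite in_itv /= => /andP[wp pw]; exists p; rewrite /ball /= ltr_norml; apply/andP; split; lra.
  have [p px] := rat_near x _ n0; have [q qy] := rat_near y _ n0.
  exists n => //; exists p => //; exists q => //; rewrite /S; case: asboolP.
    by move=> _; split => /=; apply: ball_sym.
  case=> -[u v] [/= pu qv]; apply: eU; split => /=; rewrite (splitr e).
    by apply: ball_triangle (le_ball (ltW nE) px) (le_ball (ltW nE) pu).
  by apply: ball_triangle (le_ball (ltW nE) qy) (le_ball (ltW nE) qv).
apply: bigcupT_measurable => n; apply: bigcupT_measurable_rat => p.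
apply: bigcupT_measurable_rat => q; rewrite /S; case: asboolP => // _.
by apply: measurableX; apply: open_measurable; exact: ball_open.
Qed.

Lemma closed_measurable_plane (U : set (R * R)) : closed U -> measurable U.
Proof. by move/closed_openC/open_measurable_plane/measurableC; rewrite setCK. Qed.

Lemma continuous_measurable_plane (f : R * R -> R) : continuous f ->
  measurable_fun setT f.
Proof.
move=> cf; apply: (measurability _ (RGenOpens.measurableE R)) => _ [_ [a [b ->] <-]].
apply: measurableI => //; apply: open_measurable_plane.
by apply: open_comp => [z _|]; [exact: cf|exact: interval_open].
Qed.

Lemma lebesgue_measure_shift (A : set R) (c : R) : measurable A ->
  mu [set x | A (x + c)] = mu A.
Proof.
move=> mA.
pose g (x : measurableTypeR R) : measurableTypeR R := x + c.
have mg : measurable_fun [set: measurableTypeR R] g by exact: measurable_funD.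
have := @lebesgue_measure_unique R
  (measure_function_pushforward__canonical__measure_function_Measure mu mg).
move=> /(_ _ A mA) -> //.
move=> _ [[a b] _ <-] /=; rewrite /pushforward.
rewrite (_ : _ @^-1` _ = `]a - c, b - c]%classic); last first.
  by apply/seteqP; split => x /=; rewrite !in_itv /= /g ltrBlDr lerBrDr.
rewrite !lebesgue_measure_itv /= !lte_fin ltrD2r.
by case: ifP => // _; rewrite -!EFinD; congr (_%:E); ring.
Qed.

Lemma lebesgue_measure_diameter (A : set R) (l : R) : measurable A -> 0 <= l ->
  (forall x y, A x -> A y -> `|x - y| <= l) -> (mu A <= l%:E)%E.
Proof.
move=> mA l0 Al; have [->|/set0P[x0 Ax0]] := eqVneq A set0; first by rewrite measure0 lee_fin.
have ubA : has_ubound A.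
  by exists (x0 + l) => x Ax; have := Al x x0 Ax Ax0; rewrite ler_norml; lra.
have lbA : has_lbound A.
  by exists (x0 - l) => x Ax; have := Al x x0 Ax Ax0; rewrite ler_norml; lra.
apply: (@le_trans _ _ (mu `[inf A, sup A]%classic)).
  apply: le_measure; rewrite ?inE//.
  by move=> x Ax; rewrite /= in_itv /= ge_inf ?ub_le_sup.
rewrite lebesgue_measure_itv /= lte_fin; case: ifP => _; last by rewrite lee_fin.
rewrite -EFinD lee_fin lerBlDr; apply: ge_sup; first by exists x0.
move=> x Ax; rewrite -lerBlDl; apply: lb_le_inf; first by exists x0.
by move=> y Ay; have := Al x y Ax Ay; rewrite ler_norml => /andP[_]; lra.
Qed.

Lemma plane_measure_ysection (E : set (R * R)) : measurable E ->
  mu2 E = (\int[mu]_y mu (ysection E y))%E.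
Proof.
move=> mE; apply: (@product_measure_unique _ _ _ _ R mu mu (mu \x^ mu)%E) => //.
by move=> A B mA mB; exact: product_measure2E.
Qed.

Lemma plane_measure_swap (E : set (R * R)) : measurable E ->
  mu2 [set z | E (z.2, z.1)] = mu2 E.
Proof. by move=> mE; rewrite [RHS]plane_measure_ysection. Qed.

Lemma plane_measure_shear (E : set (R * R)) (k : R) : measurable E ->
  mu2 [set z | E (z.1, z.2 + k * z.1)] = mu2 E.
Proof.
move=> mE; rewrite /product_measure1; apply: eq_integral => x _ /=.
rewrite -(@lebesgue_measure_shift (xsection E x) (k * x)); last exact: measurable_xsection.
by congr (mu _); apply/seteqP; split => y /=; rewrite /xsection /= !inE.
Qed.

Lemma measurable_preimage_plane (g h : R * R -> R) (E : set (R * R)) :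
  continuous g -> continuous h -> measurable E ->
  measurable [set z | E (g z, h z)].
Proof.
move=> cg ch mE.
have mgh : measurable_fun setT (fun z => (g z, h z)).
  by apply/measurable_fun_pairP; split; exact: continuous_measurable_plane.
by have := mgh measurableT E mE; rewrite setTI.
Qed.

(** A thickened parallelogram with one side along the direction [(1, k)]:
    after a shear that side is horizontal, and the horizontal slices of the
    figure are short enough for a bound that is uniform in the degenerate
    cases. *)
Lemma thick_parallelogram_shear (E : set (R * R)) (x0 y0 k a b d eta : R) :
  measurable E -> 0 <= eta ->
  (forall z, E z -> exists s t, [/\ `|s| <= 1, `|t| <= 1,
     `|z.1 - x0 - (a * s + b * t)| <= eta &
     `|z.2 - k * z.1 - y0 - d * t| <= 2 * eta]) ->
  (mu2 E <= (4 * (`|a| + eta) * (`|d| + 2 * eta) + 16 * `|b| * eta)%:E)%E.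
Proof.
move=> mE eta0 Est.
rewrite -(plane_measure_shear k mE).
set E' := [set z | _].
have mE' : measurable E'.
  apply: (@measurable_preimage_plane fst (fun z => z.2 + k * z.1)) => //.
    by move=> z; exact: cvg_fst.
  move=> z; apply: cvgD; first exact: cvg_snd.
  by apply: cvgM; [exact: cvg_cst|exact: cvg_fst].
rewrite plane_measure_ysection//.
have d0 := normr_ge0 d; have a0 := normr_ge0 a; have b0 := normr_ge0 b.
(* T bounds the difference of the parameters t of two points of equal height. *)
pose T := if `|d| <= 2 * eta then 2 else 4 * eta / `|d|.
have T0 : 0 <= T by rewrite /T; case: ifP => _ //; rewrite divr_ge0// mulr_ge0.
have Td : T * (`|d| + 2 * eta) <= 8 * eta.
  rewrite /T; have [dle|dlt] := leP `|d| (2 * eta); first by lra.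
  rewrite mulrDr divfK; last by rewrite gt_eqF//; lra.
  suff : 4 * eta / `|d| * (2 * eta) <= 4 * eta by lra.
  rewrite -mulrA ler_piMr//; first lra.
  by rewrite mulrC ler_pdivrMr; lra.
pose l := 2 * `|a| + `|b| * T + 2 * eta.
have l0 : 0 <= l by rewrite /l !addr_ge0// ?mulr_ge0.
pose H := `|d| + 2 * eta.
have H0 : 0 <= H by rewrite /H addr_ge0// mulr_ge0.
apply: (@le_trans _ _ (\int[mu]_y (l%:E * (\1_(`[y0 - H, y0 + H]%classic) y)%:E))%E).
  apply: ge0_le_integral => //.
  - exact: measurable_fun_ysection.
  - by apply: measurable_funeM; apply/measurable_EFinP; exact: measurable_indic.
  move=> y _ /=; rewrite indicE.
  have [_|] := boolP (y \in _).
    rewrite mule1; apply: lebesgue_measure_diameter => //; first exact: measurable_ysection.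
    move=> x x'; rewrite /E' => /ysectionP /= /Est[s [t [s1 t1 /= e1 e2]]].
    move=> /ysectionP /= /Est[s' [t' [s1' t1' /= e1' e2']]].
    have tt : `|t - t'| <= T.
      rewrite /T; have [_|dlt] := leP `|d| (2 * eta); first by rewrite (le_trans (ler_normB _ _))//; lra.
      rewrite ler_pdivlMr; last lra.
      rewrite -normrM (_ : (t - t') * d = (y + k * x' - k * x' - y0 - d * t')
        - (y + k * x - k * x - y0 - d * t)); last by ring.
      by rewrite (le_trans (ler_normB _ _))//; lra.
    have -> : x - x' = (x - x0 - (a * s + b * t)) - (x' - x0 - (a * s' + b * t'))
      + (a * (s - s') + b * (t - t')) by ring.
    have as' : `|a * (s - s')| <= 2 * `|a|.
      rewrite normrM mulrC ler_wpM2r// (le_trans (ler_normB _ _))//; lra.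
    have bt : `|b * (t - t')| <= `|b| * T by rewrite normrM ler_wpM2l.
    apply: (le_trans (ler_normD _ _)).
    have := ler_normB (x - x0 - (a * s + b * t)) (x' - x0 - (a * s' + b * t')).
    have := ler_normD (a * (s - s')) (b * (t - t')).
    rewrite /l; lra.
  move=> yH; rewrite mule0 (_ : ysection E' y = set0) ?measure0//.
  apply/seteqP; split => // x /ysectionP /= /Est[s [t [s1 t1 /= _ e2]]].
  move: yH; rewrite notin_setE /= in_itv /=; apply; rewrite /H.
  have dt : `|d * t| <= `|d| by rewrite normrM ler_piMr.
  move: e2 dt; rewrite !ler_norml => /andP[? ?] /andP[? ?].
  by apply/andP; split; lra.
rewrite ge0_integralZl//; last first.
  by apply/measurable_EFinP; exact: measurable_indic.
rewrite integral_indic//= setIT lebesgue_measure_itv /= lte_fin.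
have HE : (if (y0 - H < y0 + H)%R then ((y0 + H)%:E - (y0 - H)%:E)%E else 0%E) = (2 * H)%:E.
  by case: ltP => HH; rewrite -?EFinD; congr (_%:E); lra.
rewrite HE -EFinM lee_fin /l.
have : `|b| * (T * H) <= `|b| * (8 * eta) by rewrite ler_wpM2l.
rewrite /H; lra.
Qed.

(** The distortion of a parallelogram of sides [(a, c)] and [(b, d)] by an
    error [eta] in the plane. *)
Lemma thick_parallelogram (E : set (R * R)) (x0 y0 a b c d m eta : R) :
  measurable E -> 0 <= eta ->
  `|a| <= m -> `|b| <= m -> `|c| <= m -> `|d| <= m ->
  (forall z, E z -> exists s t, [/\ `|s| <= 1, `|t| <= 1,
     `|z.1 - x0 - (a * s + b * t)| <= eta & `|z.2 - y0 - (c * s + d * t)| <= eta]) ->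
  (mu2 E <= (4 * `|a * d - b * c| + 32 * m * eta + 8 * eta ^+ 2)%:E)%E.
Proof.
wlog ca : E x0 y0 a b c d / `|c| <= `|a|.
  move=> wl mE eta0 am bm cm dm Est.
  have [ca|ac] := leP `|c| `|a|; first exact: (wl E x0 y0 a b c d).
  have := wl [set z | E (z.2, z.1)] y0 x0 c d a b (ltW ac).
  rewrite plane_measure_swap// (_ : c * b - d * a = - (a * d - b * c)); last by ring.
  rewrite normrN; apply => //.
    by apply: (@measurable_preimage_plane snd fst) => // z; [exact: cvg_snd|exact: cvg_fst].
  by move=> z /Est[s [t [s1 t1 e1 e2]]]; exists s, t.
move=> mE eta0 am bm cm dm Est.
have [k k1 ck] : exists2 k, `|k| <= 1 & c = k * a.
  have [a0|a0] := eqVneq a 0.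
    by exists 0; rewrite ?normr0// mul0r; apply/eqP; rewrite -normr_le0 (le_trans ca)// a0 normr0.
  exists (c / a); last by rewrite divfK.
  by rewrite normrM normfV ler_pdivrMr ?normr_gt0// mul1r.
have a0 := normr_ge0 a; have b0 := normr_ge0 b.
apply: (le_trans (@thick_parallelogram_shear E x0 (y0 - k * x0) k a b (d - k * b) eta mE eta0 _)); last first.
  rewrite lee_fin (_ : a * d - b * c = a * (d - k * b)); last by rewrite ck; ring.
  rewrite normrM.
  have kb : `|d - k * b| <= 2 * m.
    rewrite (le_trans (ler_normB _ _))// normrM.
    have : `|k| * `|b| <= `|b| by rewrite ler_piMl.
    lra.
  have := normr_ge0 (d - k * b); set D := `|d - k * b| in kb * => D0.
  have : `|a| * eta <= m * eta by rewrite ler_wpM2r.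
  have : `|b| * eta <= m * eta by rewrite ler_wpM2r.
  have : D * eta <= 2 * m * eta by rewrite ler_wpM2r.
  lra.
move=> z /Est[s [t [s1 t1 e1 e2]]]; exists s, t; split => //.
have -> : z.2 - k * z.1 - (y0 - k * x0) - (d - k * b) * t =
  (z.2 - y0 - (c * s + d * t)) - k * (z.1 - x0 - (a * s + b * t)) by rewrite ck; ring.
rewrite (le_trans (ler_normB _ _))// normrM.
have : `|k| * `|z.1 - x0 - (a * s + b * t)| <= `|z.1 - x0 - (a * s + b * t)| by rewrite ler_piMl.
lra.
Qed.

End PlaneMeasure.

(** * The area inequality *)

Section AreaInequality.
Variable R : realType.

Lemma dist_le_side (a w h i : R) : a <= w -> w <= a + h -> h <= i -> `|a - w| <= i.
Proof. by move=> *; rewrite ler_norml; apply/andP; split; lra. Qed.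

Notation mu := (@lebesgue_measure R).
Notation mu2 := (mu \x mu)%E.

Lemma dist_in_side (a w w' h : R) : a <= w <= a + h -> a <= w' <= a + h ->
  `|w - w'| <= h.
Proof. by move=> /andP[? ?] /andP[? ?]; rewrite ler_norml; apply/andP; split; lra. Qed.

Variables (A B : R).
Hypotheses (A0 : 0 < A) (B0 : 0 < B).

Let rect : set (R * R) := `[0, A]%classic `*` `[0, B]%classic.

Let rectP z : rect z <-> (0 <= z.1 <= A) /\ (0 <= z.2 <= B).
Proof. by rewrite /rect /= !in_itv /=. Qed.

Let compact_rect : compact rect.
Proof. by apply: compact_setX; exact: segment_compact. Qed.

Lemma rect_uniform_continuity (p : R * R -> R) (e : R) : continuous p -> 0 < e ->
  exists N, forall n z z', (N <= n)%N -> rect z ->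
    `|z.1 - z'.1| <= n.+1%:R^-1 -> `|z.2 - z'.2| <= n.+1%:R^-1 ->
    `|p z - p z'| <= e.
Proof.
move=> cp e0.
pose P (n : nat) (z : R * R) := forall z' : R * R,
  `|z.1 - z'.1| <= n.+1%:R^-1 -> `|z.2 - z'.2| <= n.+1%:R^-1 -> `|p z - p z'| <= e.
have [] := (compact_near_coveringP _).1 compact_rect nat \oo P _; last first.
  by move=> N _ PN; exists N => n z z' Nn rz; exact: (PN n Nn).
move=> z _; have e20 : 0 < e / 2 by rewrite divr_gt0.
have /cvgrPdist_lt/(_ _ e20)/nbhs_ballP[d /= d0 dP] := cp z.
have d20 : 0 < d / 2 by rewrite divr_gt0.
have near_inv : \forall n \near \oo, n.+1%:R^-1 < d / 2 :> R by exact: near_infty_natSinv_lt (PosNum d20).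
exists (ball z (d / 2), [set n | n.+1%:R^-1 < d / 2]) => /=.
  by split; [exact: nbhsx_ballx|].
move=> [w n] /= [[zw1 zw2] +] z'.
have {}zw1 : `|z.1 - w.1| < d / 2 by exact: zw1.
have {}zw2 : `|z.2 - w.2| < d / 2 by exact: zw2.
move: (n.+1%:R^-1) => i /= id wz1 wz2.
have near_p (v : R * R) : `|z.1 - v.1| < d -> `|z.2 - v.2| < d -> `|p z - p v| < e / 2.
  by move=> v1 v2; apply: dP.
have pw : `|p z - p w| < e / 2 by apply: near_p; lra.
have pz' : `|p z - p z'| < e / 2.
  by apply: near_p; [have := ler_distD w.1 z.1 z'.1|have := ler_distD w.2 z.2 z'.2]; lra.
by have := ler_distD (p z) (p w) (p z'); rewrite (distrC (p w) (p z)); lra.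
Qed.

Lemma rect_bounded (p : R * R -> R) : continuous p ->
  exists2 M, 0 <= M & forall z, rect z -> `|p z| <= M.
Proof.
move=> cp; have cn : continuous (fun z => `|p z|).
  by move=> z; apply: cvg_norm; exact: cp.
have r0 : rect !=set0 by exists (0, 0); rewrite rectP /= lexx !ltW.
have [z _ zmax] := @compact_EVT_max _ _ (fun z => `|p z|) rect r0 compact_rect (continuous_subspaceT cn).
by exists `|p z| => // w rw; apply: zmax; rewrite inE.
Qed.

Variables (f g f1 f2 g1 g2 : R * R -> R).
Hypotheses (cf : continuous f) (cg : continuous g).
Hypotheses (cf1 : continuous f1) (cf2 : continuous f2).
Hypotheses (cg1 : continuous g1) (cg2 : continuous g2).
Hypothesis df1 : forall x y : R, is_derive x (1 : R) (fun s => f (s, y)) (f1 (x, y)).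
Hypothesis df2 : forall x y : R, is_derive y (1 : R) (fun s => f (x, s)) (f2 (x, y)).
Hypothesis dg1 : forall x y : R, is_derive x (1 : R) (fun s => g (s, y)) (g1 (x, y)).
Hypothesis dg2 : forall x y : R, is_derive y (1 : R) (fun s => g (x, s)) (g2 (x, y)).

Let J z := f1 z * g2 z - f2 z * g1 z.

Let cJ : continuous J.
Proof.
by move=> z; exact: (continuousB (continuousM (@cf1 z) (@cg2 z)) (continuousM (@cf2 z) (@cg1 z))).
Qed.

(** Mean value theorem along the two sides of a cell. *)
Let linear_approx (p p1 p2 : R * R -> R) (z0 z : R * R) (e : R) :
  continuous p ->
  (forall x y : R, is_derive x (1 : R) (fun s => p (s, y)) (p1 (x, y))) ->
  (forall x y : R, is_derive y (1 : R) (fun s => p (x, s)) (p2 (x, y))) ->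
  z0.1 <= z.1 -> z0.2 <= z.2 ->
  (forall w, z0.1 <= w.1 <= z.1 -> z0.2 <= w.2 <= z.2 ->
     `|p1 z0 - p1 w| <= e /\ `|p2 z0 - p2 w| <= e) ->
  `|p z - p z0 - (p1 z0 * (z.1 - z0.1) + p2 z0 * (z.2 - z0.2))| <=
    e * ((z.1 - z0.1) + (z.2 - z0.2)).
Proof.
case: z0 z => [x0 y0] [x y] /= cp dp1 dp2 x0x y0y hw.
have cx t : continuous (fun s => p (s, t)).
  move=> s; apply: (@continuous_comp _ _ _ (fun s => (s, t)) p); last exact: cp.
  by apply: continuous_pair_at; [exact: cvg_id|exact: cvg_cst].
have cy t : continuous (fun s => p (t, s)).
  move=> s; apply: (@continuous_comp _ _ _ (fun s => (t, s)) p); last exact: cp.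
  by apply: continuous_pair_at; [exact: cvg_cst|exact: cvg_id].
have [c] := @MVT_segment R (fun s => p (s, y)) (fun s => p1 (s, y)) x0 x x0x
  (fun s _ => dp1 s y) (continuous_subspaceT (cx y)).
rewrite in_itv /= => cI cE.
have [d] := @MVT_segment R (fun s => p (x0, s)) (fun s => p2 (x0, s)) y0 y y0y
  (fun s _ => dp2 x0 s) (continuous_subspaceT (cy x0)).
rewrite in_itv /= => dI dE.
have -> : p (x, y) - p (x0, y0) - (p1 (x0, y0) * (x - x0) + p2 (x0, y0) * (y - y0)) =
  - ((p1 (x0, y0) - p1 (c, y)) * (x - x0) + (p2 (x0, y0) - p2 (x0, d)) * (y - y0)).
  have -> : p (x, y) - p (x0, y0) = (p (x, y) - p (x0, y)) + (p (x0, y) - p (x0, y0)) by ring.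
  by rewrite cE dE; ring.
rewrite normrN [leRHS]mulrDr; apply: (le_trans (ler_normD _ _)); rewrite !normrM.
have [h1 _] : `|p1 (x0, y0) - p1 (c, y)| <= e /\ `|p2 (x0, y0) - p2 (c, y)| <= e.
  by apply: hw; rewrite /= ?cI// y0y lexx.
have [_ h2] : `|p1 (x0, y0) - p1 (x0, d)| <= e /\ `|p2 (x0, y0) - p2 (x0, d)| <= e.
  by apply: hw; rewrite /= ?dI// x0x lexx.
rewrite (@ger0_norm _ (x - x0)) ?subr_ge0// (@ger0_norm _ (y - y0)) ?subr_ge0//.
by apply: lerD; rewrite ler_wpM2r ?subr_ge0.
Qed.

Let cell (z0 : R * R) (h1 h2 : R) : set (R * R) :=
  `[z0.1, z0.1 + h1]%classic `*` `[z0.2, z0.2 + h2]%classic.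

Let Phi z := (f z, g z).

Let compact_image (K : set (R * R)) : compact K -> compact (Phi @` K).
Proof.
apply: continuous_compact; apply: continuous_subspaceT => z.
by apply: continuous_pair_at; [exact: cf|exact: cg].
Qed.

Let measurable_image (K : set (R * R)) : compact K -> measurable (Phi @` K).
Proof.
move=> cK; apply: closed_measurable_plane; apply: compact_closed (compact_image cK).
exact: norm_hausdorff.
Qed.

(** The image of a cell is close to a parallelogram, up to the oscillation [e]
    of the partial derivatives times the size of the cell. *)
Let cell_image_measure z0 h1 h2 M e : 0 <= h1 -> 0 <= h2 -> 0 <= e -> 0 <= M ->
  `|f1 z0| <= M -> `|f2 z0| <= M -> `|g1 z0| <= M -> `|g2 z0| <= M ->
  (forall w, cell z0 h1 h2 w -> [/\ `|f1 z0 - f1 w| <= e, `|f2 z0 - f2 w| <= e,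
     `|g1 z0 - g1 w| <= e & `|g2 z0 - g2 w| <= e]) ->
  (mu2 (Phi @` cell z0 h1 h2) <=
    (`|J z0| * (h1 * h2) + (32 * M * e + 8 * e ^+ 2) * (h1 + h2) ^+ 2)%:E)%E.
Proof.
move=> h10 h20 e0 M0 f1M f2M g1M g2M hw.
have mE : measurable (Phi @` cell z0 h1 h2).
  by apply: measurable_image; apply: compact_setX; exact: segment_compact.
have H0 : 0 <= h1 + h2 by exact: addr_ge0.
have halfM (q h : R) : `|q| <= M -> 0 <= h -> h <= h1 + h2 -> `|q * (h / 2)| <= M * (h1 + h2).
  move=> qM h0 hH; rewrite normrM ler_pM// ger0_norm; lra.
have := @thick_parallelogram R (Phi @` cell z0 h1 h2)
  (f z0 + f1 z0 * (h1 / 2) + f2 z0 * (h2 / 2)) (g z0 + g1 z0 * (h1 / 2) + g2 z0 * (h2 / 2))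
  (f1 z0 * (h1 / 2)) (f2 z0 * (h2 / 2)) (g1 z0 * (h1 / 2)) (g2 z0 * (h2 / 2))
  (M * (h1 + h2)) (e * (h1 + h2)) mE (mulr_ge0 e0 H0).
have -> : f1 z0 * (h1 / 2) * (g2 z0 * (h2 / 2)) - f2 z0 * (h2 / 2) * (g1 z0 * (h1 / 2)) =
  J z0 * (h1 * h2 / 4) by rewrite /J; field.
rewrite (normrM (J z0)) (@ger0_norm _ (h1 * h2 / 4)); last by rewrite divr_ge0// mulr_ge0.
have -> : 4 * (`|J z0| * (h1 * h2 / 4)) + 32 * (M * (h1 + h2)) * (e * (h1 + h2)) +
    8 * (e * (h1 + h2)) ^+ 2 =
  `|J z0| * (h1 * h2) + (32 * M * e + 8 * e ^+ 2) * (h1 + h2) ^+ 2 by field.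
apply; try (by apply: halfM => //; lra).
move=> _ [z [/= + + <-]]; rewrite !in_itv /= => /andP[z1 z1'] /andP[z2 z2'].
have par (q q0 h : R) : q0 <= q -> q <= q0 + h -> exists2 s, `|s| <= 1 & q - q0 = h / 2 * (1 + s).
  move=> q0q qh; have [h0|h0] := eqVneq h 0.
    by exists 0; rewrite ?normr0// h0 mul0r mul0r; move: qh; rewrite h0 addr0; lra.
  have hp : 0 < h by rewrite lt_neqAle eq_sym h0; lra.
  exists (2 * (q - q0) / h - 1); last by field.
  have : 0 <= 2 * (q - q0) / h <= 2.
    by apply/andP; split; [rewrite divr_ge0 ?mulr_ge0 ?subr_ge0// ltW|rewrite ler_pdivrMr//; lra].
  by rewrite ler_norml => /andP[? ?]; apply/andP; split; lra.
have [s s1 sE] := par _ _ _ z1 z1'; have [t t1 tE] := par _ _ _ z2 z2'.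
exists s, t; split => //=.
  have := @linear_approx f f1 f2 z0 z e cf df1 df2 z1 z2.
  have -> : f z - (f z0 + f1 z0 * (h1 / 2) + f2 z0 * (h2 / 2)) -
     (f1 z0 * (h1 / 2) * s + f2 z0 * (h2 / 2) * t) =
     f z - f z0 - (f1 z0 * (z.1 - z0.1) + f2 z0 * (z.2 - z0.2)) by rewrite sE tE; ring.
  move=> /(_ _)/le_trans; apply; last by rewrite ler_wpM2l//; lra.
  move=> w /andP[w1 w1'] /andP[w2 w2'].
  by have [|] := hw w => //; split; rewrite /= in_itv /= ?w1 ?w2 (le_trans w1', le_trans w2').
have := @linear_approx g g1 g2 z0 z e cg dg1 dg2 z1 z2.
have -> : g z - (g z0 + g1 z0 * (h1 / 2) + g2 z0 * (h2 / 2)) -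
     (g1 z0 * (h1 / 2) * s + g2 z0 * (h2 / 2) * t) =
     g z - g z0 - (g1 z0 * (z.1 - z0.1) + g2 z0 * (z.2 - z0.2)) by rewrite sE tE; ring.
move=> /(_ _)/le_trans; apply; last by rewrite ler_wpM2l//; lra.
move=> w /andP[w1 w1'] /andP[w2 w2'].
by have [|] := hw w => //; split; rewrite /= in_itv /= ?w1 ?w2 (le_trans w1', le_trans w2').
Qed.

Let corner n (c : 'I_n.+1 * 'I_n.+1) : R * R :=
  (c.1%:R * (A / n.+1%:R), c.2%:R * (B / n.+1%:R)).

Let gcell n c := cell (@corner n c) (A / n.+1%:R) (B / n.+1%:R).

(** Half-open cells are disjoint, so the integrals over them add up; the
    closed ones have compact images. *)
Let hcell n c : set (R * R) :=
  `[(@corner n c).1, (corner c).1 + A / n.+1%:R[%classic `*`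
  `[(@corner n c).2, (corner c).2 + B / n.+1%:R[%classic.

Let ord_grid (L : R) n (i : 'I_n.+1) : 0 < L ->
  0 <= i%:R * (L / n.+1%:R) /\ i%:R * (L / n.+1%:R) + L / n.+1%:R <= L.
Proof.
move=> L0; have n0 : 0 < n.+1%:R :> R by rewrite ltr0n.
split; first by rewrite mulr_ge0// divr_ge0// ltW.
have -> : i%:R * (L / n.+1%:R) + L / n.+1%:R = (i.+1%:R / n.+1%:R) * L.
  by rewrite -natr1; ring.
by rewrite ler_piMl ?(ltW L0)// ler_pdivrMr// mul1r ler_nat.
Qed.

Let gcell_rect n c : @gcell n c `<=` rect.
Proof.
move=> z [/= + +]; rewrite !in_itv /= => /andP[a1 a2] /andP[b1 b2].
have [i0 i1] := ord_grid c.1 A0; have [j0 j1] := ord_grid c.2 B0.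
apply/rectP; split; apply/andP; split.
- exact: le_trans a1.
- exact: le_trans i1.
- exact: le_trans b1.
- exact: le_trans j1.
Qed.

Let hcell_gcell n c : @hcell n c `<=` gcell c.
Proof.
move=> z [/= + +]; rewrite !in_itv /= => /andP[a1 /ltW a2] /andP[b1 /ltW b2].
by split; rewrite /= in_itv /= ?a1 ?a2 ?b1 ?b2.
Qed.

Let measurable_hcell n c : measurable (@hcell n c).
Proof. by apply: measurableX. Qed.

Let hcell_measure n c : mu2 (@hcell n c) = (A / n.+1%:R * (B / n.+1%:R))%:E.
Proof.
have a0 : 0 < A / n.+1%:R by rewrite divr_gt0// ltr0n.
have b0 : 0 < B / n.+1%:R by rewrite divr_gt0// ltr0n.
rewrite /hcell product_measure1E//= !lebesgue_measure_itv /= !lte_fin !ltrDl a0 b0.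
by rewrite -!EFinB -EFinM; congr (_%:E); ring.
Qed.

Let trivIset_hcell n : trivIset setT (@hcell n).
Proof.
have key (h t : R) (i j : nat) : 0 < h -> i%:R * h <= t < i%:R * h + h ->
    j%:R * h <= t < j%:R * h + h -> i = j.
  move=> h0; wlog ij : i j / (i <= j)%N.
    move=> wl ti tj; have [ij|/ltnW ij] := leqP i j; first exact: wl.
    by apply/esym/wl.
  move=> /andP[_ t1] /andP[t2 _]; apply/eqP; rewrite eqn_leq ij /= -ltnS.
  rewrite -(ltr_nat R) -(ltr_pM2r h0) -natr1 mulrDl mul1r; exact: le_lt_trans t1.
have n0 : 0 < n.+1%:R :> R by rewrite ltr0n.
move=> [i j] [i' j'] _ _ [z [[/= + +] [/= + +]]]; rewrite !in_itv /= => a b a' b'.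
have -> : i = i' by apply/val_inj/(key _ _ _ _ _ a a'); rewrite divr_gt0.
by have -> : j = j' by apply/val_inj/(key _ _ _ _ _ b b'); rewrite divr_gt0.
Qed.

Let absJ z := (`|J z|%:E : \bar R).

Let measurable_absJ (D : set (R * R)) : measurable_fun D absJ.
Proof.
apply: measurable_funTS; apply/measurable_EFinP; apply: continuous_measurable_plane.
by move=> z; apply: cvg_norm; exact: cJ.
Qed.

Let sum_hcell_integral n :
  (\sum_(c : 'I_n.+1 * 'I_n.+1) \int[mu2]_(z in hcell c) absJ z <=
   \int[mu2]_(z in rect) absJ z)%E.
Proof.
rewrite -(@ge0_integral_bigsetU _ _ R mu2 _ (@hcell n) absJ (index_enum _)) //.
- apply: ge0_subset_integral => //.
  + by apply: bigsetU_measurable => c _; exact: measurable_hcell.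
  + by apply: measurableX.
  + exact: measurable_absJ.
  + by move=> z _; rewrite lee_fin.
  + rewrite -bigcup_seq => z [c _ /hcell_gcell/gcell_rect]; exact.
- by move=> c; exact: measurable_hcell.
- exact: index_enum_uniq.
- by move=> c c' _ _; exact: trivIset_hcell.
- exact: measurable_absJ.
- by move=> z _; rewrite lee_fin.
Qed.

(** On a fine grid the Jacobian and the partial derivatives are almost
    constant on each cell, and the number of cells times the square of their
    size is bounded. *)
Let sum_cell_measure (e : R) : 0 < e -> exists N, forall n, (N <= n)%N ->
  (\sum_(c : 'I_n.+1 * 'I_n.+1) mu2 (Phi @` gcell c) <=
   \int[mu2]_(z in rect) absJ z + e%:E)%E.
Proof.
move=> e0.
have [M1 M10 f1M] := rect_bounded cf1; have [M2 M20 f2M] := rect_bounded cf2.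
have [M3 M30 g1M] := rect_bounded cg1; have [M4 M40 g2M] := rect_bounded cg2.
pose M := M1 + M2 + M3 + M4.
have M0 : 0 <= M by rewrite /M; lra.
have [M1M M2M M3M M4M] : [/\ M1 <= M, M2 <= M, M3 <= M & M4 <= M].
  by rewrite /M; split; lra.
(* K times d bounds the sum of the errors when d bounds the oscillations. *)
pose K := A * B + (32 * M + 8) * (A + B) ^+ 2.
have K0 : 0 < K.
  rewrite /K ltr_pwDl ?mulr_gt0// mulr_ge0 ?sqr_ge0//; lra.
pose d := Num.min 1 (e / K).
have d0 : 0 < d by rewrite lt_min ltr01 divr_gt0.
have d1 : d <= 1 by rewrite ge_min lexx.
have dK : d * K <= e by rewrite -ler_pdivlMr// ge_min lexx orbT.
have [N1 u1] := rect_uniform_continuity cf1 d0; have [N2 u2] := rect_uniform_continuity cf2 d0.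
have [N3 u3] := rect_uniform_continuity cg1 d0; have [N4 u4] := rect_uniform_continuity cg2 d0.
have [N5 u5] := rect_uniform_continuity cJ d0.
pose N6 := (N1 + N2 + N3 + N4 + N5)%N.
have l5 : (N5 <= N6)%N by exact: leq_addl.
have q4 : (N1 + N2 + N3 + N4 <= N6)%N by exact: leq_addr.
have l4 := leq_trans (leq_addl (N1 + N2 + N3) N4) q4.
have q3 := leq_trans (leq_addr N4 (N1 + N2 + N3)) q4.
have l3 := leq_trans (leq_addl (N1 + N2) N3) q3.
have q2 := leq_trans (leq_addr N3 (N1 + N2)) q3.
have l2 := leq_trans (leq_addl N1 N2) q2.
have l1 := leq_trans (leq_addr N2 N1) q2.
have [D DAB] : exists D : nat, A + B <= D.+1%:R.
  by exists (Num.truncn (A + B)); rewrite ltW// truncnS_gt.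
exists (D.+1 * N6.+1)%N => n nN.
have n0 : 0 < n.+1%:R :> R by rewrite ltr0n.
have small : A / n.+1%:R <= N6.+1%:R^-1 /\ B / n.+1%:R <= N6.+1%:R^-1.
  have H L : L <= A + B -> L / n.+1%:R <= N6.+1%:R^-1.
    move=> LAB; rewrite ler_pdivrMr// mulrC ler_pdivlMr ?ltr0n//.
    apply: (@le_trans _ _ (D.+1%:R * N6.+1%:R)).
      by rewrite ler_wpM2r// (le_trans LAB).
    by rewrite -natrM ler_nat ltnW.
  by split; apply: H; rewrite ?lerDl ?lerDr ltW.
pose h1 := A / n.+1%:R; pose h2 := B / n.+1%:R.
have h10 : 0 < h1 by rewrite divr_gt0.
have h20 : 0 < h2 by rewrite divr_gt0.
pose k := d * (h1 * h2) + (32 * M * d + 8 * d ^+ 2) * (h1 + h2) ^+ 2.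
have kE : (n.+1 * n.+1)%:R * k <= e.
  apply: le_trans dK.
  have -> : (n.+1 * n.+1)%:R * k = d * (A * B + (32 * M + 8 * d) * (A + B) ^+ 2).
    by rewrite natrM /k /h1 /h2; field; rewrite gt_eqF.
  rewrite ler_wpM2l ?(ltW d0)// /K lerD2l ler_wpM2r ?sqr_ge0//; lra.
have cellE (c : 'I_n.+1 * 'I_n.+1) :
    (mu2 (Phi @` gcell c) <= \int[mu2]_(z in hcell c) absJ z + k%:E)%E.
  have cc : gcell c (corner c).
    by split; rewrite /= in_itv /= lexx /= lerDl ltW.
  have rc : rect (corner c) by apply: gcell_rect cc.
  have close w : gcell c w -> `|(corner c).1 - w.1| <= N6.+1%:R^-1 /\
      `|(corner c).2 - w.2| <= N6.+1%:R^-1.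
    case: small; move: (N6.+1%:R^-1) => i; rewrite -/h1 -/h2 => hi1 hi2.
    move=> [/= + +]; rewrite !in_itv /= -/h1 -/h2 => /andP[w1 w1'] /andP[w2 w2'].
    by split; [exact: dist_le_side w1 w1' hi1|exact: dist_le_side w2 w2' hi2].
  have := @cell_image_measure (corner c) h1 h2 M d (ltW h10) (ltW h20) (ltW d0) M0.
  rewrite -/(gcell c) => /(_ _ _ _ _ _)/le_trans; apply.
  - exact: le_trans (f1M _ rc) M1M.
  - exact: le_trans (f2M _ rc) M2M.
  - exact: le_trans (g1M _ rc) M3M.
  - exact: le_trans (g2M _ rc) M4M.
  - move=> w /close[w1 w2]; split.
    + by exact: (u1 N6).
    + by exact: (u2 N6).
    + by exact: (u3 N6).
    + by exact: (u4 N6).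
  pose q := Num.max 0 (`|J (corner c)| - d).
  have q0 : 0 <= q by rewrite le_max lexx.
  have qJ : `|J (corner c)| <= q + d by rewrite -lerBlDr le_max lexx orbT.
  apply: (@le_trans _ _ ((q * (h1 * h2))%:E + k%:E)%E).
    rewrite -EFinD lee_fin /k.
    have : `|J (corner c)| * (h1 * h2) <= (q + d) * (h1 * h2).
      by rewrite ler_wpM2r// mulr_ge0// ltW.
    lra.
  apply: leeD => //.
  have -> : (q * (h1 * h2))%:E = (\int[mu2]_(z in hcell c) (cst q%:E) z)%E.
    transitivity (q%:E * mu2 (hcell c))%E; first by rewrite hcell_measure.
    by rewrite (integral_cst mu2 (@measurable_hcell n c)).
  apply: ge0_le_integral => //.
  - exact: measurable_hcell.
  - exact: measurable_absJ.
  move=> w /hcell_gcell/close[w1 w2]; rewrite lee_fin ge_max normr_ge0 /=.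
  have Jd : `|J (corner c) - J w| <= d by exact: (u5 N6).
  by have := ler_distD 0 (J (corner c)) (J w); have := lerB_dist (J (corner c)) (J w); lra.
apply: (le_trans (lee_sum _ (fun c _ => cellE c))).
rewrite big_split /= leeD//; first exact: sum_hcell_integral.
by rewrite sumEFin lee_fin sumr_const card_prod !card_ord -[k *+ _]mulr_natl.
Qed.

Let grid_locate (L t : R) n : 0 < L -> 0 <= t <= L ->
  exists i : 'I_n.+1, i%:R * (L / n.+1%:R) <= t <= i%:R * (L / n.+1%:R) + L / n.+1%:R.
Proof.
move=> L0; set h := L / n.+1%:R.
have -> : L = n.+1%:R * h by rewrite /h mulrC divfK// pnatr_eq0.
have h0 : 0 < h by rewrite divr_gt0// ltr0n.
suff H m : 0 <= t <= m.+1%:R * h -> exists2 i, (i <= m)%N & i%:R * h <= t <= i%:R * h + h.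
  by move=> /H[i im ti]; exists (Ordinal (im : (i < n.+1)%N)).
elim: m => [|m IH] /andP[t0 tm].
  by exists 0%N => //; rewrite mul0r t0 add0r -[h]mul1r.
have [tm'|tm'] := leP t (m.+1%:R * h).
  by have [|i im ti] := IH; [rewrite t0|exists i => //; exact: leqW].
exists m.+1 => //; rewrite (ltW tm') /=.
by move: tm; rewrite -[m.+2%:R]natr1 mulrDl mul1r.
Qed.

Let gcell_cover n z : rect z -> exists c : 'I_n.+1 * 'I_n.+1, gcell c z.
Proof.
move=> /rectP[z1 z2].
have [i iz] := grid_locate n A0 z1; have [j jz] := grid_locate n B0 z2.
by exists (i, j); split; rewrite /= in_itv.
Qed.

(** Two distinct preimages of [y] lie in different cells of every fine enough
    grid. So the points of [T] that the images of the cells cover twice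
    exhaust [T] as the grid is refined. *)
Lemma area_inequality (T : set (R * R)) : measurable T ->
  (forall y, T y -> exists z z', [/\ rect z, rect z', z <> z', Phi z = y & Phi z' = y]) ->
  (2%:E * mu2 T <= \int[mu2]_(z in rect) absJ z)%E.
Proof.
move=> mT Tzz; apply/lee_addgt0Pr => e e0.
have [N sumN] := sum_cell_measure e0.
pose E n c := Phi @` @gcell n c.
have mE n c : measurable (@E n c).
  by apply: measurable_image; apply: compact_setX; exact: segment_compact.
pose cnt n y : R := \sum_(c : 'I_n.+1 * 'I_n.+1) \1_(E n c) y.
have mcnt n : measurable_fun setT (cnt n).
  by apply: measurable_sum => c; apply: measurable_indic; exact: mE.
pose D n : set (R * R) := T `&` [set y | 2 <= cnt n y].
have mD n : measurable (D n).
  apply: measurableI => //.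
  have -> : [set y | 2 <= cnt n y] = setT `&` cnt n @^-1` `[2, +oo[%classic.
    by rewrite setTI; apply/seteqP; split => y /=; rewrite in_itv /= andbT.
  by apply: mcnt.
have measD n : (2%:E * mu2 (D n) <= \sum_(c : 'I_n.+1 * 'I_n.+1) mu2 (E n c))%E.
  have -> : (\sum_(c : 'I_n.+1 * 'I_n.+1) mu2 (E n c) =
      \int[mu2]_y (\sum_(c : 'I_n.+1 * 'I_n.+1) (\1_(E n c) y)%:E))%E.
    rewrite ge0_integral_sum//; last by move=> c; apply/measurable_EFinP; apply: measurable_indic; exact: mE.
    by apply: eq_bigr => c _; rewrite (@integral_indic _ _ R mu2 setT measurableT (E n c) (mE n c)) setIT.
  have -> : (2%:E * mu2 (D n) = \int[mu2]_(y in D n) (cst 2%:E y))%E.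
    by rewrite (integral_cst mu2 (mD n)).
  apply: (@le_trans _ _ (\int[mu2]_(y in D n) (\sum_(c : 'I_n.+1 * 'I_n.+1) (\1_(E n c) y)%:E))%E).
    apply: ge0_le_integral => //.
    - exact: mD.
    - by move=> y _; rewrite lee_fin.
    - apply: measurable_funTS; apply: emeasurable_sum => c.
      by apply/measurable_EFinP; apply: measurable_indic; exact: mE.
    - by move=> y [_ /= y2]; rewrite sumEFin lee_fin.
  apply: ge0_subset_integral => //.
  - exact: mD.
  - apply: emeasurable_sum => c.
    by apply/measurable_EFinP; apply: measurable_indic; exact: mE.
  - by move=> y _; rewrite sume_ge0// => c _; rewrite lee_fin.
pose Bm m : set (R * R) := \bigcap_(n in [set n | (m <= n)%N]) D n.
have mBm m : measurable (Bm m) by apply: bigcap_measurable => //; exists m => /=.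
have BmS : \bigcup_m Bm m = T.
  apply/seteqP; split; first by move=> y [m _ /(_ m (leqnn m))[]].
  move=> y Ty; have [z [z' [rz rz' zz' zy z'y]]] := Tzz y Ty.
  pose r := `|z.1 - z'.1| + `|z.2 - z'.2|.
  have r0 : 0 < r.
    rewrite lt_neqAle addr_ge0// andbT eq_sym paddr_eq0// !normr_eq0 !subr_eq0.
    apply/negP => /andP[/eqP e1 /eqP e2]; apply: zz'.
    by rewrite [z]surjective_pairing [z']surjective_pairing e1 e2.
  have [m mr] : exists m : nat, (A + B) / r < m.+1%:R.
    by exists (Num.truncn ((A + B) / r)); exact: truncnS_gt.
  exists m => // n /= mn; split => //.
  have n0 : 0 < n.+1%:R :> R by rewrite ltr0n.
  have hr : A / n.+1%:R + B / n.+1%:R < r.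
    rewrite -mulrDl ltr_pdivrMr// mulrC -ltr_pdivrMr//; apply: (lt_le_trans mr).
    by rewrite ler_nat.
  have [c cz] := gcell_cover n rz; have [c' c'z] := gcell_cover n rz'.
  have cc' : c != c'.
    apply/eqP => ce; subst c'; move: cz c'z => [/= + +] [/= + +].
    rewrite !in_itv /= => z1 z2 z1' z2'.
    have := lt_le_trans hr (lexx _); rewrite /r ltNge => /negP; apply.
    by apply: lerD; [exact: dist_in_side z1 z1'|exact: dist_in_side z2 z2'].
  rewrite /= /cnt (bigD1 c)//= (bigD1 c')/=; last by rewrite eq_sym.
  rewrite !indicE !mem_set; [|by exists z'|by exists z].
  by rewrite addrA lerDl sumr_ge0.
have ndB : nondecreasing_seq Bm.
  by move=> m k mk; apply/subsetPset => y By n /= kn; apply: (By n); exact: leq_trans kn.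
have cvB := @nondecreasing_cvg_mu _ _ R mu2 Bm mBm (bigcup_measurable (fun k _ => mBm k)) ndB.
rewrite BmS in cvB.
have bound m : (mu2 (Bm m) <= 2^-1%:E * (\int[mu2]_(z in rect) absJ z + e%:E))%E.
  rewrite lee_pdivlMl//.
  apply: (le_trans _ (sumN (maxn m N) (leq_maxr _ _))).
  apply: (le_trans _ (measD (maxn m N))).
  rewrite lee_pmul2l//; apply: le_measure; [by rewrite inE; exact: mBm|by rewrite inE; exact: mD|].
  by move=> y By; apply: (By (maxn m N)); exact: leq_maxl.
rewrite -lee_pdivlMl// -(cvg_lim _ cvB)//; apply: lime_le; first by apply/cvg_ex; exists (mu2 T).
by apply: nearW => m; exact: bound.
Qed.

End AreaInequality.

(** * Calculus in one variable *)

Section Calculus1.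
Variable R : realType.
Implicit Types (f g : R -> R) (x a b : R).

Lemma rderive_add f g x a b : is_derive x (1 : R) f a -> is_derive x (1 : R) g b ->
  is_derive x (1 : R) (fun t => f t + g t) (a + b).
Proof. by move=> df dg; exact: (is_deriveD df dg). Qed.

Lemma rderive_sub f g x a b : is_derive x (1 : R) f a -> is_derive x (1 : R) g b ->
  is_derive x (1 : R) (fun t => f t - g t) (a - b).
Proof. by move=> df dg; exact: (is_deriveB df dg). Qed.

Lemma rderive_mul f g x a b : is_derive x (1 : R) f a -> is_derive x (1 : R) g b ->
  is_derive x (1 : R) (fun t => f t * g t) (a * g x + f x * b).
Proof.
move=> df dg; apply: (is_derive_eq (is_deriveM df dg)).
by rewrite /GRing.scale /= addrC mulrC.
Qed.

Lemma rderive_cst x a : is_derive x (1 : R) (fun=> a) 0.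
Proof. exact: is_derive_cst. Qed.

Lemma rderive_id x : is_derive x (1 : R) (fun t : R => t) 1.
Proof. exact: is_derive_id. Qed.

Lemma rderive_scale f x a k : is_derive x (1 : R) f a ->
  is_derive x (1 : R) (fun t => k * f t) (k * a).
Proof. by move=> df; exact: (is_deriveZ k df). Qed.

Lemma rderive_comp f g x a b : is_derive (g x) (1 : R) f a ->
  is_derive x (1 : R) g b -> is_derive x (1 : R) (fun t => f (g t)) (a * b).
Proof. by move=> df dg; exact: (is_derive1_comp df dg). Qed.

End Calculus1.

(** * The lower bound for the total Jacobian *)

Section LowerBound.
Variable R : realType.

Notation mu := (@lebesgue_measure R).
Notation mu2 := (mu \x mu)%E.

Lemma is_derive_continuous (F : R -> R) x d : is_derive x (1 : R) F d ->
  {for x, continuous F}.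
Proof.
by move=> [dF _]; apply: differentiable_continuous; exact/derivable1_diffP.
Qed.

Lemma integral_of_derivative (F f : R -> R) (a b : R) : a <= b ->
  (forall x, is_derive x (1 : R) F (f x)) -> continuous f ->
  (\int[mu]_(x in `[a, b]) (f x)%:E = (F b - F a)%:E)%E.
Proof.
rewrite le_eqVlt => /orP[/eqP <- _ _|ab dF cf].
  by rewrite subrr set_itv1 integral_set1.
have cF x : {for x, continuous F} by exact: is_derive_continuous (dF x).
rewrite (@continuous_FTC2 R f F a b ab) //.
- exact: continuous_subspaceT.
- split.
  + by move=> x _; case: (dF x).
  + exact/cvg_at_right_filter/cF.
  + exact/cvg_at_left_filter/cF.
- by move=> x _; rewrite derive1E; case: (dF x).
Qed.

Definition right_triangle (a b c : R) : set (R * R) :=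
  [set y | [/\ a < y.1, b < y.2 & y.1 + y.2 < a + b + c]].

Lemma measurable_right_triangle (a b c : R) : measurable (right_triangle a b c).
Proof.
apply: open_measurable_plane.
have c1 : continuous (fst : R * R -> R) by move=> z; exact: cvg_fst.
have c2 : continuous (snd : R * R -> R) by move=> z; exact: cvg_snd.
have c12 : continuous (fun z : R * R => z.1 + z.2).
  by move=> z; exact: (continuousD (c1 z) (c2 z)).
have -> : right_triangle a b c = (fst @^-1` [set r | a < r]) `&` (snd @^-1` [set r | b < r]) `&`
    ((fun z : R * R => z.1 + z.2) @^-1` [set r | r < a + b + c]).
  by apply/seteqP; split => y /=; [move=> []|move=> [[]]].
apply: openI; [apply: openI|].
- by apply: open_comp; [move=> z _; exact: c1|exact: open_gt].
- by apply: open_comp; [move=> z _; exact: c2|exact: open_gt].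
- by apply: (@open_comp _ _ (fun z : R * R => z.1 + z.2)); [move=> z _; exact: c12|exact: open_lt].
Qed.

(** The vertical slices have length [a + c - x]. *)
Lemma right_triangle_measure (a b c : R) : 0 < c ->
  ((c ^+ 2)%:E <= 2%:E * mu2 (right_triangle a b c))%E.
Proof.
move=> c0; set T := right_triangle a b c.
rewrite -lee_pdivrMl//.
have -> : (2^-1%:E * (c ^+ 2)%:E = \int[mu]_(x in `[a, (a + c)%R]) ((a + c - x)%R)%:E)%E.
  have dP x : is_derive x (1 : R) (fun x => (a + c) * x - x * x / 2) (a + c - x).
    apply: (is_derive_eq (rderive_sub (rderive_scale (a + c) (rderive_id x))
      (rderive_mul (rderive_mul (rderive_id x) (rderive_id x)) (rderive_cst x 2^-1)))).
    by field.
  rewrite (@integral_of_derivative (fun x => (a + c) * x - x * x / 2) (fun x => a + c - x)).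
  - by rewrite -EFinM; congr (_%:E); field.
  - by lra.
  - by move=> x; apply: cvgB; [exact: cvg_cst|exact: cvg_id].
have mT : measurable T by exact: measurable_right_triangle.
rewrite -integral_itv_obnd_cbnd; last first.
  apply/measurable_EFinP; apply: measurable_funTS; apply: continuous_measurable_fun.
  by move=> x; apply: cvgB; [exact: cvg_cst|exact: cvg_id].
apply: (@le_trans _ _ (\int[mu]_(x in `]a, (a + c)%R]) mu (xsection T x))%E); last first.
  apply: ge0_subset_integral => //.
  exact: measurable_fun_xsection.
apply: ge0_le_integral => //.
- by move=> x /=; rewrite in_itv /= => /andP[_ ?]; rewrite lee_fin; lra.
- apply/measurable_EFinP; apply: measurable_funTS; apply: continuous_measurable_fun.
  by move=> x; apply: cvgB; [exact: cvg_cst|exact: cvg_id].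
- by apply: measurable_funTS; exact: measurable_fun_xsection.
move=> x /=; rewrite in_itv /= => /andP[ax xc].
have -> : xsection T x = `]b, b + (a + c - x)[%classic.
  apply/seteqP; split => y.
    by move=> /xsectionP[/= _ yb yc]; rewrite in_itv /= yb /=; lra.
  by rewrite /= in_itv /= => /andP[yb yc]; apply/xsectionP; split => //=; lra.
rewrite lebesgue_measure_itv /= lte_fin; case: ifP => [_|/negbT].
  by rewrite -EFinD lee_fin; lra.
by rewrite -leNgt lee_fin; lra.
Qed.

End LowerBound.

Section DefectArea.
Variables (R : realType) (p1 p2 p3 : sphere R) (tau : set (sphere R) -> R).
Hypotheses (p12 : p1 <> p2) (p13 : p1 <> p3) (p23 : p2 <> p3).
Hypotheses (qm : is_quasi_measure tau) (ext : extends_three_point p1 p2 p3 tau).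

Notation mu2 := (@lebesgue_measure R \x @lebesgue_measure R)%E.

Definition sph_rect : set (R * R) := `[0, pi]%classic `*` `[0, 2 * pi]%classic.

Definition sph (F : sphere R -> R) (z : R * R) : R := F (spherical z.1 z.2).

Lemma continuous_sph F : continuous F -> continuous (sph F).
Proof.
move=> cF z; apply: (@continuous_comp _ _ _ (fun z : R * R => spherical z.1 z.2) F); last exact: cF.
by apply: continuous_spherical => w; [exact: cvg_fst|exact: cvg_snd].
Qed.

(** A right triangle whose legs have the length of the defect is covered twice
    by [(F, G)]; for a negative defect the signs of [F] and [G] are changed. *)
Lemma defect_sqr_le (F G : sphere R -> R) (f1 f2 g1 g2 : R * R -> R) :
  continuous F -> continuous G ->
  continuous f1 -> continuous f2 -> continuous g1 -> continuous g2 ->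
  (forall x y : R, is_derive x (1 : R) (fun s => sph F (s, y)) (f1 (x, y))) ->
  (forall x y : R, is_derive y (1 : R) (fun s => sph F (x, s)) (f2 (x, y))) ->
  (forall x y : R, is_derive x (1 : R) (fun s => sph G (s, y)) (g1 (x, y))) ->
  (forall x y : R, is_derive y (1 : R) (fun s => sph G (x, s)) (g2 (x, y))) ->
  (((quasi_state_of tau (F \+ G) - quasi_state_of tau F - quasi_state_of tau G) ^+ 2)%:E <=
   \int[mu2]_(z in sph_rect)
      (`|f1 z * g2 z - f2 z * g1 z|%R)%:E)%E.
Proof.
move=> cF cG cf1 cf2 cg1 cg2 df1 df2 dg1 dg2.
have cFG : continuous (F \+ G) by move=> x; exact: (continuousD (cF x) (cG x)).
have Fa := tau_level p12 p13 p23 qm ext cF.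
have Gb := tau_level p12 p13 p23 qm ext cG.
have FGs := tau_level p12 p13 p23 qm ext cFG.
move: Fa Gb FGs; set a := quasi_state_of tau F; set b := quasi_state_of tau G.
set s := quasi_state_of tau (F \+ G); set c := s - a - b => Fa Gb FGs.
have pi0 := @pi_gt0 R; have pi20 : 0 < 2 * pi :> R by rewrite mulr_gt0.
have two (y1 y2 : R) : a < y1 /\ b < y2 /\ y1 + y2 < s \/ y1 < a /\ y2 < b /\ s < y1 + y2 ->
    exists z z', [/\ sph_rect z,
      sph_rect z', z <> z',
      sph F z = y1 /\ sph G z = y2 & sph F z' = y1 /\ sph G z' = y2].
  move=> y_in.
  have [x _ [Fx Gx]] := another_preimage p12 p13 p23 qm ext cF cG Fa Gb FGs y_in p1.
  have [x' x'x [Fx' Gx']] := another_preimage p12 p13 p23 qm ext cF cG Fa Gb FGs y_in x.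
  have [u [v [u0 v0 xE]]] := spherical_surj x.
  have [u' [v' [u'0 v'0 x'E]]] := spherical_surj x'.
  exists (u, v), (u', v'); rewrite /sph /sph_rect /= -xE -x'E !in_itv /=; split => //.
  by move=> [uu vv]; apply: x'x; rewrite x'E xE uu vv.
have [c0|c0|c0] := ltgtP c 0.
- have := @area_inequality R pi (2 * pi) pi0 pi20 (fun z => - sph F z) (fun z => - sph G z)
    (fun z => - f1 z) (fun z => - f2 z) (fun z => - g1 z) (fun z => - g2 z).
  have cN p : continuous p -> continuous (fun z : R * R => - p z : R).
    by move=> cp z; apply: cvgN; exact: cp.
  move=> /(_ (cN _ (continuous_sph cF)) (cN _ (continuous_sph cG)) (cN _ cf1) (cN _ cf2) (cN _ cg1) (cN _ cg2)).
  have dN p (x d : R) : is_derive x (1 : R) p d -> is_derive x (1 : R) (fun s => - p s) (- d).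
    by move=> dp; exact: (is_deriveN dp).
  move=> /(_ (fun x y => dN _ _ _ (df1 x y)) (fun x y => dN _ _ _ (df2 x y))
    (fun x y => dN _ _ _ (dg1 x y)) (fun x y => dN _ _ _ (dg2 x y))).
  move=> /(_ (right_triangle (- a) (- b) (- c)) (measurable_right_triangle _ _ _)) H.
  have mc0 : 0 < - c by rewrite oppr_gt0.
  have := right_triangle_measure (- a) (- b) mc0; rewrite sqrrN => /le_trans; apply.
  apply: (le_trans (H _)).
    move=> [y1 y2] [/= y1a y2b y12].
    have [|z [z' [rz rz' zz' [e1 e2] [e3 e4]]]] := two (- y1) (- y2).
      by right; move: y12; rewrite /c; lra.
    by exists z, z'; split => //; rewrite /= ?e1 ?e2 ?e3 ?e4 !opprK.
  by under eq_integral do rewrite !mulrNN.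
- have := @area_inequality R pi (2 * pi) pi0 pi20 (sph F) (sph G) f1 f2 g1 g2.
  move=> /(_ (continuous_sph cF) (continuous_sph cG) cf1 cf2 cg1 cg2 df1 df2 dg1 dg2).
  move=> /(_ (right_triangle a b c) (measurable_right_triangle _ _ _)) H.
  apply: (le_trans (right_triangle_measure a b c0)); apply: H.
  move=> [y1 y2] [/= y1a y2b y12].
  have [|z [z' [rz rz' zz' [e1 e2] [e3 e4]]]] := two y1 y2.
    by left; move: y12; rewrite /c; lra.
  by exists z, z'; split => //; rewrite /= ?e1 ?e2 ?e3 ?e4.
- by rewrite c0 expr0n; apply: integral_ge0 => z _; rewrite lee_fin.
Qed.

End DefectArea.

(** * Differentials in spherical coordinates *)

Section Curves.
Variable R : realType.
Implicit Types (c : R -> 'rV[R]_3) (f : 'rV[R]_3 -> R) (v : 'rV[R]_3).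

Lemma is_derive_row c (s : R) v :
  is_derive s (1 : R) (fun t => c t 0 0) (v 0 0) ->
  is_derive s (1 : R) (fun t => c t 0 1) (v 0 1) ->
  is_derive s (1 : R) (fun t => c t 0 2%:R) (v 0 2%:R) -> is_derive s (1 : R) c v.
Proof.
move=> d0 d1 d2.
have d (i : 'I_1) (j : 'I_3) : is_derive s (1 : R) (fun t => c t i j) (v i j).
  rewrite (ord1 i); case: j => -[|[|[|//]]] hj.
  - by have -> : Ordinal hj = 0 by exact/val_inj.
  - by have -> : Ordinal hj = 1 by exact/val_inj.
  - by have -> : Ordinal hj = 2%:R by exact/val_inj.
have dc : derivable c s (1 : R) by apply/derivable_mxP => i j; case: (d i j).
apply: DeriveDef => //; rewrite derive_mx//; apply/matrixP => i j; rewrite mxE.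
by case: (d i j).
Qed.

Lemma is_derive_along c f (s : R) v : is_derive s (1 : R) c v ->
  differentiable f (c s) -> is_derive s (1 : R) (fun t => f (c t)) ('D_v f (c s)).
Proof.
move=> [dc cv] df.
have ds : differentiable c s by exact/derivable1_diffP.
have dfc : differentiable (f \o c) s by exact: differentiable_comp.
apply: DeriveDef; first exact/derivable1_diffP.
rewrite (deriveE (f := fun t => f (c t)) _ dfc) diff_comp//= -[in LHS](deriveE _ ds) cv.
by rewrite -deriveE.
Qed.

Lemma derive_row_sum f x v : differentiable f x ->
  'D_v f x = v 0 0 * 'D_(delta_mx 0 0) f x + v 0 1 * 'D_(delta_mx 0 1) f x +
    v 0 2%:R * 'D_(delta_mx 0 2%:R) f x.
Proof.
move=> df; rewrite !deriveE//.
have vE : v = v 0 0 *: delta_mx 0 0 + v 0 1 *: delta_mx 0 1 + v 0 2%:R *: delta_mx 0 2%:R.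
  by apply: row3P; rewrite !mxE /=; ring.
by rewrite {1}vE !linearD !linearZ.
Qed.

End Curves.

Section Differentials.
Variable R : realType.
Implicit Types (F G : sphere R -> R) (x y : sphere R) (v : 'rV[R]_3).

Lemma smooth_continuous F : smooth F -> continuous F.
Proof.
move=> sF x; have [U [f [oU Ux sU FE]]] := sF x.
have cf : {for val x, continuous f}.
  by apply: differentiable_continuous; exact: (sU [::] _ Ux).
have cfx : {for x, continuous (fun y : sphere R => f (val y))}.
  by apply: (@continuous_comp _ _ _ (fun y : sphere R => val y) f); first exact: sphere_val_continuous.
move=> A FA; have : nbhs x ((fun y : sphere R => f (val y)) @^-1` A).
  by apply: cfx; rewrite -FE.
have : nbhs x [set y : sphere R | U (val y)].
  by apply: (@sphere_val_continuous R x); exact: open_nbhs_nbhs.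
move=> nU nA; apply: filterS (filterI nU nA) => y [/= Uy Ay]; by rewrite FE.
Qed.

Lemma derive_at0 (g : 'rV[R]_3 -> R) u v :
  'D_v g u = 'D_(1 : R) (fun h : R => g (h *: v + u)) 0.
Proof.
rewrite /derive; set g1 := fun h => h^-1 *: _; set g2 := fun h => h^-1 *: _.
suff -> : g1 = g2 by [].
by rewrite funeqE /g1 /g2 => h /=; rewrite addr0 scale0r add0r [_%:A]mulr1.
Qed.

Lemma radial_extensionE F v : v <> 0 -> radial_extension F v = F (nrm v).
Proof.
move=> v0; rewrite /radial_extension -val_nrm//.
by have /(congr1 (fun h => h (nrm v))) := @valLK _ _ (0 : R) (sphere R) F.
Qed.

Section LocalExtension.
Variables (F : sphere R -> R) (U : set 'rV[R]_3) (f : 'rV[R]_3 -> R).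
Hypotheses (oU : open U) (sU : smooth_on U f).
Hypothesis FE : forall y : sphere R, U (val y) -> F y = f (val y).

Let df u : U u -> differentiable f u.
Proof. exact: (sU [::]). Qed.

Lemma is_derive_curve (c : R -> sphere R) (s : R) v : U (val (c s)) ->
  is_derive s (1 : R) (fun t => val (c t)) v ->
  is_derive s (1 : R) (fun t => F (c t)) ('D_v f (val (c s))).
Proof.
move=> Us dc.
have h := is_derive_along dc (df Us).
apply: near_eq_is_derive h.
have cc : {for s, continuous (fun t => val (c t))}.
  by case: dc => d _; apply: differentiable_continuous; exact/derivable1_diffP.
have : nbhs s [set t | U (val (c t))] by apply: cc; exact: open_nbhs_nbhs.
by apply: filterS => t /= Ut; rewrite FE.
Qed.

(** The radial extension takes the same values at [x + t v] and at its radial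
    projection, a curve in the sphere of velocity [v] at [x]. *)
Lemma differentialE x v : U (val x) -> tangent x v ->
  differential F x v = 'D_v f (val x).
Proof.
move=> Ux tv.
have nz t : val x + t *: v <> 0.
  move=> e0; have : dot (val x) (val x + t *: v) = 0 by rewrite e0 dotE !mxE; ring.
  by rewrite dotDr dotZr sphere_dot [dot _ v]tv; lra.
pose c t := nrm (val x + t *: v).
have c0 : c 0 = x by rewrite /c scale0r addr0 nrm_val.
have cE t : val (c t) = (Num.sqrt (1 + t ^+ 2 * dot v v))^-1 *: (val x + t *: v).
  rewrite val_nrm//; congr ((Num.sqrt _)^-1 *: _).
  rewrite dotDl !dotDr !dotZl !dotZr (dotC v (val x)) sphere_dot [dot _ v]tv.
  by ring.
pose rho t := (Num.sqrt (1 + t ^+ 2 * dot v v))^-1.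
have rho0 : rho 0 = 1 by rewrite /rho expr0n mul0r addr0 sqrtr1 invr1.
have drho : is_derive (0 : R) (1 : R) rho 0.
  have d1 : is_derive (0 : R) (1 : R) (fun t => 1 + t ^+ 2 * dot v v) 0.
    apply: (is_derive_eq (rderive_add (rderive_cst _ 1)
      (rderive_mul (rderive_mul (rderive_id 0) (rderive_id 0)) (rderive_cst 0 (dot v v))))).
    by ring.
  have d2 : is_derive (0 : R) (1 : R) (fun t => Num.sqrt (1 + t ^+ 2 * dot v v)) 0.
    have := @is_derive1_sqrt R (1 + 0 ^+ 2 * dot v v) _.
    rewrite expr0n mul0r addr0 => /(_ ltr01) ds.
    rewrite -[X in is_derive _ _ _ X](mulr0 (2 * Num.sqrt 1)^-1).
    by apply: (rderive_comp (f := Num.sqrt) _ d1); rewrite expr0n mul0r addr0.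
  have := @is_deriveV R (fun t => Num.sqrt (1 + t ^+ 2 * dot v v)) 0 0 1 _ d2.
  by rewrite scaler0; apply; rewrite expr0n mul0r addr0 sqrtr1 oner_neq0.
have dc : is_derive (0 : R) (1 : R) (fun t => val (c t)) v.
  have comp i : is_derive (0 : R) (1 : R) (fun t => val (c t) 0 i) (v 0 i).
    have -> : (fun t => val (c t) 0 i) = (fun t => rho t * (val x 0 i + t * v 0 i)).
      by apply/funext => t; rewrite cE !mxE.
    apply: (is_derive_eq (rderive_mul drho (rderive_add (rderive_cst _ (val x 0 i))
      (rderive_mul (rderive_id 0) (rderive_cst 0 (v 0 i)))))).
    by rewrite rho0; ring.
  by apply: is_derive_row; exact: comp.
have := @is_derive_curve c 0 v; rewrite c0 => /(_ Ux dc) [_ <-].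
rewrite /differential derive_at0; congr ('D_(1 : R) _ 0); apply/funext => t.
by rewrite addrC radial_extensionE.
Qed.

End LocalExtension.

Lemma differential_local F x : smooth F -> exists f U, [/\ open U, U (val x),
  smooth_on U f & forall y, U (val y) ->
    (forall v, tangent y v -> differential F y v = 'D_v f (val y)) /\
    (forall (c : R -> sphere R) (s : R) v, c s = y -> tangent y v ->
      is_derive s (1 : R) (fun t => val (c t)) v ->
      is_derive s (1 : R) (fun t => F (c t)) (differential F y v))].
Proof.
move=> /(_ x)[U [f [oU Ux sU FE]]]; exists f, U; split => // y Uy; split.
  by move=> v tv; exact: (differentialE oU sU FE).
move=> c s v cs tv dc; rewrite (differentialE oU sU FE)// -cs.
by apply: (is_derive_curve oU sU FE) => //; rewrite cs.
Qed.

Lemma is_derive_differential F (c : R -> sphere R) (s : R) v : smooth F ->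
  tangent (c s) v -> is_derive s (1 : R) (fun t => val (c t)) v ->
  is_derive s (1 : R) (fun t => F (c t)) (differential F (c s) v).
Proof.
by move=> /(differential_local (c s))[f [U [_ Us _ /(_ _ Us)[_ h]]]] tv dc; exact: h.
Qed.

Lemma differential_linear F x (a b : R) u v : smooth F -> tangent x u -> tangent x v ->
  differential F x (a *: u + b *: v) = a * differential F x u + b * differential F x v.
Proof.
move=> /(differential_local x)[f [U [_ Ux sU /(_ _ Ux)[h _]]]] tu tv.
have df : differentiable f (val x) by exact: (sU [::] _ Ux).
rewrite !h//; last by rewrite /tangent dotDr !dotZr [dot _ u]tu [dot _ v]tv; ring.
by rewrite !deriveE// linearD !linearZ.
Qed.

Lemma continuous_differential F (c : R * R -> sphere R) (w : R * R -> 'rV[R]_3) :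
  smooth F -> continuous c -> continuous w -> (forall z, tangent (c z) (w z)) ->
  continuous (fun z => differential F (c z) (w z)).
Proof.
move=> sF cc cw tw z.
have [f [U [oU Uz sU h]]] := differential_local (c z) sF.
have cvc : continuous (fun z => val (c z)).
  by move=> t; apply: (@continuous_comp _ _ _ c (fun y : sphere R => val y)); [exact: cc|exact: sphere_val_continuous].
have nU : nbhs z [set t | U (val (c t))] by apply: cvc; exact: open_nbhs_nbhs.
pose g t := w t 0 0 * 'D_(delta_mx 0 0) f (val (c t)) +
  w t 0 1 * 'D_(delta_mx 0 1) f (val (c t)) +
  w t 0 2%:R * 'D_(delta_mx 0 2%:R) f (val (c t)).
have gE : \forall t \near z, g t = differential F (c t) (w t).
  apply: filterS nU => t /= Ut; have [hd _] := h _ Ut.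
  by rewrite hd// (derive_row_sum _ (sU [::] _ Ut)).
have cD i : {for z, continuous (fun t => 'D_(delta_mx 0 i) f (val (c t)))}.
  apply: (@continuous_comp _ _ _ (fun t => val (c t)) ('D_(delta_mx 0 i) f)); first exact: cvc.
  by apply: differentiable_continuous; exact: (sU [:: delta_mx 0 i] _ Uz).
have cwi i : {for z, continuous (fun t => w t 0 i)}.
  by apply: (@continuous_comp _ _ _ w (fun u : 'rV[R]_3 => u 0 i)); [exact: cw|exact: coord_continuous_row].
have cg : {for z, continuous g}.
  exact: (continuousD (continuousD (continuousM (cwi 0) (cD 0)) (continuousM (cwi 1) (cD 1)))
    (continuousM (cwi 2%:R) (cD 2%:R))).
have [Uz' _] := h _ Uz.
have gz : g z = differential F (c z) (w z) by rewrite Uz'// (derive_row_sum _ (sU [::] _ Uz)).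
rewrite /continuous_at -gz; exact: cvg_trans (near_eq_cvg gE) cg.
Qed.

End Differentials.

(** * The Poisson bracket in spherical coordinates *)

Section SphericalFrame.
Variable R : realType.
Implicit Types (F G : sphere R -> R) (z : R * R).

Definition frame1 z : 'rV[R]_3 :=
  \row_(i < 3) [:: cos z.1 * cos z.2; cos z.1 * sin z.2; - sin z.1]`_i.

Definition frame2 z : 'rV[R]_3 :=
  \row_(i < 3) [:: - (sin z.1 * sin z.2); sin z.1 * cos z.2; 0]`_i.

Definition sph_pt z : sphere R := spherical z.1 z.2.

Lemma tangent_frame1 z : tangent (sph_pt z) (frame1 z).
Proof.
rewrite /tangent dotE spherical0E spherical1E spherical2E !mxE /=.
transitivity (sin z.1 * cos z.1 * ((cos z.2 ^+ 2 + sin z.2 ^+ 2) - 1)); first by ring.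
by rewrite cos2Dsin2 subrr mulr0.
Qed.

Lemma tangent_frame2 z : tangent (sph_pt z) (frame2 z).
Proof. by rewrite /tangent dotE spherical0E spherical1E spherical2E !mxE /=; ring. Qed.

Lemma is_derive_spherical1 (a b : R) :
  is_derive a (1 : R) (fun t => val (spherical t b)) (frame1 (a, b)).
Proof.
have ds := is_derive_sin a; have dc := is_derive_cos a.
apply: is_derive_row; rewrite mxE /=; under eq_fun do rewrite mxE /=.
- by apply: (is_derive_eq (rderive_mul ds (rderive_cst a (cos b)))); ring.
- by apply: (is_derive_eq (rderive_mul ds (rderive_cst a (sin b)))); ring.
- exact: dc.
Qed.

Lemma is_derive_spherical2 (a b : R) :
  is_derive b (1 : R) (fun t => val (spherical a t)) (frame2 (a, b)).
Proof.
have ds := is_derive_sin b; have dc := is_derive_cos b.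
apply: is_derive_row; rewrite mxE /=; under eq_fun do rewrite mxE /=.
- by apply: (is_derive_eq (rderive_scale (sin a) dc)); ring.
- exact: (rderive_scale (sin a) ds).
- exact: rderive_cst.
Qed.

Lemma continuous_sph_pt : continuous sph_pt.
Proof. by apply: continuous_spherical => w; [exact: cvg_fst|exact: cvg_snd]. Qed.

Let csin1 : continuous (fun z : R * R => sin z.1 : R).
Proof. by move=> z; apply: (@continuous_comp _ _ _ fst sin); [exact: cvg_fst|exact: continuous_sin]. Qed.
Let ccos1 : continuous (fun z : R * R => cos z.1 : R).
Proof. by move=> z; apply: (@continuous_comp _ _ _ fst cos); [exact: cvg_fst|exact: continuous_cos]. Qed.
Let csin2 : continuous (fun z : R * R => sin z.2 : R).
Proof. by move=> z; apply: (@continuous_comp _ _ _ snd sin); [exact: cvg_snd|exact: continuous_sin]. Qed.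
Let ccos2 : continuous (fun z : R * R => cos z.2 : R).
Proof. by move=> z; apply: (@continuous_comp _ _ _ snd cos); [exact: cvg_snd|exact: continuous_cos]. Qed.

Lemma continuous_frame1 : continuous frame1.
Proof.
apply: continuous_row3 => z; under eq_fun do rewrite mxE /=.
- exact: (continuousM (@ccos1 z) (@ccos2 z)).
- exact: (continuousM (@ccos1 z) (@csin2 z)).
- exact: (continuousN (@csin1 z)).
Qed.

Lemma continuous_frame2 : continuous frame2.
Proof.
apply: continuous_row3 => z; under eq_fun do rewrite mxE /=.
- exact: (continuousN (continuousM (@csin1 z) (@csin2 z))).
- exact: (continuousM (@csin1 z) (@ccos2 z)).
- exact: cst_continuous.
Qed.

Definition partial1 F z := differential F (sph_pt z) (frame1 z).
Definition partial2 F z := differential F (sph_pt z) (frame2 z).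
Definition sph_jacobian F G z := partial1 F z * partial2 G z - partial2 F z * partial1 G z.

Lemma is_derive_partial1 F (a b : R) : smooth F ->
  is_derive a (1 : R) (fun s => sph F (s, b)) (partial1 F (a, b)).
Proof.
move=> sF; apply: (@is_derive_differential R F (fun t => spherical t b) a) => //.
  exact: (tangent_frame1 (a, b)).
exact: is_derive_spherical1.
Qed.

Lemma is_derive_partial2 F (a b : R) : smooth F ->
  is_derive b (1 : R) (fun s => sph F (a, s)) (partial2 F (a, b)).
Proof.
move=> sF; apply: (@is_derive_differential R F (fun t => spherical a t) b) => //.
  exact: (tangent_frame2 (a, b)).
exact: is_derive_spherical2.
Qed.

Lemma continuous_partial1 F : smooth F -> continuous (partial1 F).
Proof.
move=> sF; apply: continuous_differential sF continuous_sph_pt continuous_frame1 _.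
exact: tangent_frame1.
Qed.

Lemma continuous_partial2 F : smooth F -> continuous (partial2 F).
Proof.
move=> sF; apply: continuous_differential sF continuous_sph_pt continuous_frame2 _.
exact: tangent_frame2.
Qed.

(** The frame is orthogonal, of lengths 1 and [sin z.1]. *)
Lemma frame_decomposition z v : sin z.1 != 0 -> tangent (sph_pt z) v ->
  exists a b, v = a *: frame1 z + b *: frame2 z.
Proof.
move=> s0; rewrite /tangent dotE spherical0E spherical1E spherical2E => tv.
have h1 := cos2Dsin2 z.1; have h2 := cos2Dsin2 z.2.
exists (dot (frame1 z) v), ((cos z.2 * v 0 1 - sin z.2 * v 0 0) / sin z.1).
set s := sin z.1 in tv s0 h1 *; set c := cos z.1 in tv h1 *.
set S := sin z.2 in tv h2 *; set C := cos z.2 in tv h2 *.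
set t := _ + _ in tv; set k := c ^+ 2 + _ in h1; set l := C ^+ 2 + _ in h2.
rewrite dotE !mxE /= -/s -/c -/S -/C.
apply: row3P; rewrite !mxE /= -/s -/c -/S -/C.
- transitivity (v 0 0 + (- (s * C) * t + (k - 1) * (C ^+ 2 * v 0 0 + C * S * v 0 1) + (l - 1) * v 0 0)).
    by rewrite tv h1 h2; ring.
  by rewrite /t /k /l; field.
- transitivity (v 0 1 + (- (s * S) * t + (k - 1) * (C * S * v 0 0 + S ^+ 2 * v 0 1) + (l - 1) * v 0 1)).
    by rewrite tv h1 h2; ring.
  by rewrite /t /k /l; field.
- transitivity (v 0 2%:R + (- c * t + (k - 1) * v 0 2%:R)).
    by rewrite tv h1; ring.
  by rewrite /t /k; ring.
Qed.

Section AreaForm.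
Variable omega : sphere R -> 'rV[R]_3 -> 'rV[R]_3 -> R.
Hypothesis om : is_area_form omega.

Let tangent_comb x (a b : R) u v : tangent x u -> tangent x v -> tangent x (a *: u + b *: v).
Proof. by rewrite /tangent dotDr !dotZr => -> ->; ring. Qed.

Let omega_comb x (a b : R) u v w : tangent x u -> tangent x v -> tangent x w ->
  omega x (a *: u + b *: v) w = a * omega x u w + b * omega x v w.
Proof.
move=> tu tv tw; rewrite (area_form_linear om)//; last first.
  by rewrite /tangent dotZr [dot _ v]tv mulr0.
have t0 : tangent x 0 by rewrite /tangent dotE !mxE; ring.
have om0 : omega x 0 w = 0.
  have := area_form_linear om 1 t0 t0 tw; rewrite scaler0 addr0; lra.
have := area_form_linear om b tv t0 tw; rewrite addr0 om0 => ->; ring.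
Qed.

Let omega_comb2 x (a b c d : R) u v : tangent x u -> tangent x v ->
  omega x (a *: u + b *: v) (c *: u + d *: v) = (a * d - b * c) * omega x u v.
Proof.
move=> tu tv; have tcd := tangent_comb c d tu tv.
have oxx w : tangent x w -> omega x w w = 0.
  by move=> tw; have := area_form_antisym om tw tw; lra.
rewrite omega_comb// (area_form_antisym om tu tcd) (area_form_antisym om tv tcd).
rewrite !omega_comb// !oxx// (area_form_antisym om tv tu); ring.
Qed.

Let omega_frame_neq0 z : sin z.1 != 0 ->
  omega (sph_pt z) (frame1 z) (frame2 z) != 0.
Proof.
move=> s0; have [u [v [tu tv]]] := area_form_neq0 om (sph_pt z).
have [a [b ->]] := frame_decomposition s0 tu.
have [c [d ->]] := frame_decomposition s0 tv.
rewrite omega_comb2; [|exact: tangent_frame1|exact: tangent_frame2].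
by apply: contra_neq => ->; rewrite mulr0.
Qed.

(** This is [dF /\ dG = - {F, G} omega] evaluated on the coordinate frame; at
    the poles both sides vanish. *)
Lemma bracket_density F G z : smooth F -> smooth G ->
  `|poisson_bracket omega F G (sph_pt z)| *
    `|omega (sph_pt z) (frame1 z) (frame2 z)| = `|sph_jacobian F G z|.
Proof.
move=> sF sG; have t1 := tangent_frame1 z; have t2 := tangent_frame2 z.
have [s0|s0] := eqVneq (sin z.1) 0.
  have f20 : frame2 z = 0.
    by apply: row3P; rewrite !mxE /= ?s0 ?mul0r ?oppr0.
  have t0 : tangent (sph_pt z) 0 by rewrite -f20.
  have d0 H : smooth H -> partial2 H z = 0.
    move=> sH; have := differential_linear 0 0 sH t0 t0.
    by rewrite !scaler0 !addr0 !mul0r addr0 /partial2 f20.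
  rewrite /sph_jacobian !d0// f20.
  have := omega_comb 0 0 t0 t0 t1; rewrite !scaler0 addr0 !mul0r addr0 => o0.
  by rewrite (area_form_antisym om t1 t0) o0 !(mulr0, mul0r, oppr0, addr0, normr0).
have w0 := omega_frame_neq0 s0.
set w := omega _ _ _ in w0 *.
have [] : tangent (sph_pt z) (hamiltonian_field omega G (sph_pt z)) /\
    forall eta, tangent (sph_pt z) eta ->
    differential G (sph_pt z) eta = omega (sph_pt z) eta (hamiltonian_field omega G (sph_pt z)).
  rewrite /hamiltonian_field; set P := [set v | _].
  apply: (@xgetPex _ 0 P).
  exists ((- partial2 G z / w) *: frame1 z + (partial1 G z / w) *: frame2 z).
  split; first exact: tangent_comb.
  move=> eta teta; have [a [b ->]] := frame_decomposition s0 teta.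
  rewrite differential_linear// omega_comb2// -/(partial1 G z) -/(partial2 G z) -/w.
  by field.
rewrite /poisson_bracket; set v := hamiltonian_field _ _ _ => tv hv.
have [a [b vE]] := frame_decomposition s0 tv.
have b1 : partial1 G z = b * w.
  rewrite /partial1 hv// vE -[X in omega _ X _](_ : 1 *: frame1 z + 0 *: frame2 z = _).
    by rewrite omega_comb2// -/w; ring.
  by rewrite scale1r scale0r addr0.
have a2 : partial2 G z = - a * w.
  rewrite /partial2 hv// vE -[X in omega _ X _](_ : 0 *: frame1 z + 1 *: frame2 z = _).
    by rewrite omega_comb2// -/w; ring.
  by rewrite scale1r scale0r add0r.
rewrite -normrM vE differential_linear// -/(partial1 F z) -/(partial2 F z).
by rewrite /sph_jacobian b1 a2 -normrN; congr (`|_|); ring.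
Qed.

Lemma bracket_L1E F G : smooth F -> smooth G ->
  bracket_L1 omega F G =
  fine (\int[@lebesgue_measure R \x @lebesgue_measure R]_(z in @sph_rect R)
    `|sph_jacobian F G z|%:E)%E.
Proof.
move=> sF sG; rewrite /bracket_L1 /area_integral /Rintegral; congr fine.
apply: eq_integral => z _; congr (_%:E); rewrite -bracket_density//.
congr (_ * `|omega _ _ _|).
  by rewrite derive1E; case: (is_derive_spherical1 z.1 z.2).
by rewrite derive1E; case: (is_derive_spherical2 z.1 z.2).
Qed.

End AreaForm.
End SphericalFrame.

(** * Flat functions and smooth steps *)

Section Flat.
Variable R : realType.
Implicit Types (x y : R) (k n : nat).

(** The function [x^-k * exp (- 1 / x)] for positive [x]. Its derivative is
    again a combination of such functions, so the family is closed under
    differentiation. *)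
Definition flat k x : R := if 0 < x then x^-1 ^+ k * expR (- x^-1) else 0.

Lemma flat_le0 k x : x <= 0 -> flat k x = 0.
Proof. by rewrite /flat leNgt; case: ifP. Qed.

Lemma flat_gt0 k x : 0 < x -> 0 < flat k x.
Proof. by move=> x0; rewrite /flat x0 mulr_gt0 ?expR_gt0// exprn_gt0// invr_gt0. Qed.

Lemma flat_ge0 k x : 0 <= flat k x.
Proof. by have [/flat_gt0/ltW|/flat_le0->] := ltP 0 x. Qed.

Lemma power_le_expR n x : 0 <= x -> (x / n.+1%:R) ^+ n.+1 <= expR x.
Proof.
move=> x0; have -> : expR x = expR (x / n.+1%:R) ^+ n.+1.
  by rewrite -expRM_natl mulrC divfK// pnatr_eq0.
have d0 : 0 <= x / n.+1%:R by rewrite divr_ge0.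
rewrite ler_pXn2r// ?nnegrE ?expR_ge0//.
by apply: le_trans (expR_ge1Dx _); rewrite lerDr.
Qed.

(** A bound by a multiple of [x ^+ 2] is enough for a zero derivative at 0. *)
Lemma flat_quadratic k : exists2 C, 0 <= C & forall x, `|flat k x| <= C * x ^+ 2.
Proof.
exists (k.+2%:R ^+ k.+2); first by rewrite exprn_ge0.
move=> x; rewrite ger0_norm ?flat_ge0//.
have [x0|x0] := ltP 0 x; last by rewrite flat_le0// mulr_ge0 ?sqr_ge0 ?exprn_ge0.
rewrite /flat x0 expRN; set t := x^-1.
have t0 : 0 < t by rewrite invr_gt0.
have tx : t ^+ 2 * x ^+ 2 = 1 by rewrite -exprMn mulVf ?expr1n// gt_eqF.
have main : t ^+ k.+2 <= k.+2%:R ^+ k.+2 * expR t.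
  rewrite -ler_pdivrMl ?exprn_gt0 ?ltr0n// mulrC -expr_div_n.
  by apply: power_le_expR; exact: ltW.
rewrite ler_pdivrMr ?expR_gt0//.
apply: (@le_trans _ _ (t ^+ k.+2 * x ^+ 2)); first by rewrite -addn2 exprD -mulrA tx mulr1.
by rewrite [leRHS]mulrAC ler_wpM2r ?sqr_ge0.
Qed.

Lemma is_derive_quadratic (f : R -> R) (C : R) :
  (forall x, `|f x| <= C * x ^+ 2) -> is_derive (0 : R) (1 : R) f 0.
Proof.
move=> fC; have f0 : f 0 = 0.
  by apply/eqP; rewrite -normr_le0; have := fC 0; rewrite expr0n mulr0.
have C0 : 0 <= C by have := fC 1; rewrite expr1n mulr1; exact: le_trans.
have lim0 : h^-1 *: ((f \o shift 0) (h *: 1) - f 0) @[h --> 0^'] --> (0 : R).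
  apply/cvgr0Pnorm_lt => e e0; near=> h.
  rewrite /= f0 subr0 addr0 /GRing.scale /= mulr1 normrM.
  have h0 : h != 0 by near: h; exact: nbhs_dnbhs_neq.
  apply: (@le_lt_trans _ _ (C * `|h|)).
    apply: (@le_trans _ _ (`|h^-1| * (C * h ^+ 2))); first by rewrite ler_wpM2l.
    by rewrite normfV -real_normK ?num_real// expr2 mulrCA mulKf ?normr_eq0.
  have hC : `|h| < e / (C + 1).
    near: h; apply: dnbhs0_lt; by rewrite divr_gt0//; lra.
  apply: (@le_lt_trans _ _ ((C + 1) * `|h|)); first by rewrite ler_wpM2r//; lra.
  by rewrite mulrC -ltr_pdivlMr//; lra.
apply: DeriveDef; first by apply/cvg_ex; exists 0.
exact: (cvg_lim _ lim0).
Unshelve. all: by end_near. Qed.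

Lemma is_derive_flat k x :
  is_derive x (1 : R) (flat k) (flat k.+2 x - k%:R * flat k.+1 x).
Proof.
have [x0|x0|->] := ltgtP x 0.
- rewrite !flat_le0 ?(ltW x0)// mulr0 subr0.
  apply: (near_eq_is_derive _ (rderive_cst x 0)).
  have : \forall y \near x, y < 0 by exact: lt_nbhsl.
  by apply: filterS => y y0; rewrite flat_le0// ltW.
- have nx : \forall y \near x, 0 < y by exact: lt_nbhsr.
  apply: (@near_eq_is_derive _ _ _ (fun y => y^-1 ^+ k * expR (- y^-1))).
    by apply: filterS nx => y y0; rewrite /flat y0.
  have xn0 : x != 0 by rewrite gt_eqF.
  have dV : is_derive x (1 : R) (fun y : R => y^-1) (- x^-1 ^+ 2).
    apply: (is_derive_eq (@is_deriveV R id x 1 1 xn0 (rderive_id x))).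
    by rewrite /GRing.scale /= mulr1 exprVn.
  have dX : is_derive x (1 : R) (fun y : R => y^-1 ^+ k) (- (k%:R * x^-1 ^+ k.+1)).
    have := is_deriveX k dV; rewrite exprfctE => dX; apply: (is_derive_eq dX).
    rewrite /GRing.scale /=; case: (k) => [|j]; first by rewrite !mul0r oppr0.
    by rewrite /= mulrN -mulrA -exprD addn2.
  have dE : is_derive x (1 : R) (fun y : R => expR (- y^-1)) (expR (- x^-1) * x^-1 ^+ 2).
    have dN : is_derive x (1 : R) (fun y : R => - y^-1) (x^-1 ^+ 2).
      by apply: (is_derive_eq (is_deriveN dV)); rewrite opprK.
    exact: (@rderive_comp R (@expR R) (fun y : R => - y^-1) x _ _ (is_derive_expR _) dN).
  apply: (is_derive_eq (rderive_mul dX dE)).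
  by rewrite /flat x0 -[k.+2]addn2 -[k.+1]addn1 !exprD; ring.
- rewrite !flat_le0// mulr0 subr0.
  by have [C _ fC] := flat_quadratic k; exact: is_derive_quadratic fC.
Qed.

Lemma continuous_flat k : continuous (flat k).
Proof. by move=> x; exact: is_derive_continuous (is_derive_flat k x). Qed.

Definition step_den x : R := flat 0 x + flat 0 (1 - x).

Lemma step_den_gt0 x : 0 < step_den x.
Proof.
rewrite /step_den; have [x0|x0] := ltP 0 x.
  by rewrite ltr_pwDl ?flat_gt0// flat_ge0.
by rewrite ltr_wpDl ?flat_ge0// flat_gt0//; lra.
Qed.

(** Smooth, nondecreasing, 0 for nonpositive arguments and 1 from 1 on. *)
Definition step x : R := flat 0 x / step_den x.

Definition dstep x : R :=
  (flat 2 x * flat 0 (1 - x) + flat 0 x * flat 2 (1 - x)) / step_den x ^+ 2.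

Lemma is_derive_step x : is_derive x (1 : R) step (dstep x).
Proof.
have d0 : step_den x != 0 by rewrite gt_eqF// step_den_gt0.
have df : is_derive x (1 : R) (flat 0) (flat 2 x).
  by apply: (is_derive_eq (is_derive_flat 0 x)); rewrite mul0r subr0.
have dg : is_derive x (1 : R) (fun y => flat 0 (1 - y)) (- flat 2 (1 - x)).
  have df' : is_derive (1 - x) (1 : R) (flat 0) (flat 2 (1 - x)).
    by apply: (is_derive_eq (is_derive_flat 0 (1 - x))); rewrite mul0r subr0.
  have dN := rderive_sub (rderive_cst x 1) (rderive_id x).
  apply: (is_derive_eq (@rderive_comp R (flat 0) (fun y : R => 1 - y) x _ _ df' dN)).
  by ring.
have dD : is_derive x (1 : R) step_den (flat 2 x - flat 2 (1 - x)) by exact: rderive_add.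
apply: (is_derive_eq (rderive_mul df (is_deriveV d0 dD))).
by rewrite /dstep /GRing.scale /= /step_den in d0 *; field.
Qed.

Lemma dstep_ge0 x : 0 <= dstep x.
Proof. by rewrite /dstep divr_ge0 ?sqr_ge0// addr_ge0// mulr_ge0 ?flat_ge0. Qed.

Lemma step_ge0 x : 0 <= step x.
Proof. by rewrite /step divr_ge0 ?flat_ge0// ltW// step_den_gt0. Qed.

Lemma step_le1 x : step x <= 1.
Proof. by rewrite /step ler_pdivrMr ?step_den_gt0// mul1r /step_den lerDl flat_ge0. Qed.

Lemma step_le0 x : x <= 0 -> step x = 0.
Proof. by move=> x0; rewrite /step flat_le0// mul0r. Qed.

Lemma step_ge1 x : 1 <= x -> step x = 1.
Proof.
move=> x1; rewrite /step /step_den [flat 0 (1 - x)]flat_le0; last by lra.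
by rewrite addr0 divff// gt_eqF// flat_gt0//; lra.
Qed.

Lemma dstep_le0 x : x <= 0 -> dstep x = 0.
Proof. by move=> x0; rewrite /dstep !(flat_le0 _ x0) !mul0r addr0 mul0r. Qed.

Lemma dstep_ge1 x : 1 <= x -> dstep x = 0.
Proof.
move=> x1; have x1' : 1 - x <= 0 by lra.
by rewrite /dstep !(flat_le0 _ x1') !mulr0 addr0 mul0r.
Qed.

Lemma continuous_step : continuous step.
Proof. by move=> x; exact: is_derive_continuous (is_derive_step x). Qed.

Lemma continuous_dstep : continuous dstep.
Proof.
move=> x; have c1 k : {for x, continuous (fun y => flat k (1 - y))}.
  apply: (@continuous_comp _ _ _ (fun y : R => 1 - y) (flat k)); last exact: continuous_flat.
  by apply: cvgB; [exact: cvg_cst|exact: cvg_id].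
have cD : {for x, continuous step_den} by exact: (continuousD (@continuous_flat 0 x) (c1 0%N)).
have d0 : step_den x ^+ 2 != 0 by rewrite expf_neq0// gt_eqF// step_den_gt0.
have cN := continuousD (continuousM (@continuous_flat 2 x) (c1 0%N)) (continuousM (@continuous_flat 0 x) (c1 2%N)).
have cS : {for x, continuous (fun y => step_den y ^+ 2)} by exact: (continuousM cD cD).
exact: (continuousM cN (@continuousV R R (fun y => step_den y ^+ 2) x d0 cS)).
Qed.

End Flat.

(** * Elementary smooth functions *)

Section Elementary.
Variable R : realType.

(** The class is closed under directional derivatives, which is what makes all
    its members smooth. *)
Inductive elementary : ('rV[R]_3 -> R) -> Prop :=
| elementary_cst (a : R) : elementary (fun=> a)
| elementary_dot w : elementary (fun x => dot w x)
| elementary_add f g : elementary f -> elementary g -> elementary (fun x => f x + g x)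
| elementary_mul f g : elementary f -> elementary g -> elementary (fun x => f x * g x)
| elementary_flat k f : elementary f -> elementary (fun x => flat k (f x))
| elementary_inv f : elementary f -> (forall x, f x != 0) -> elementary (fun x => (f x)^-1).

Lemma is_derive_comp_scalar (h : R -> R) (f : 'rV[R]_3 -> R) x v d :
  differentiable f x -> is_derive (f x) (1 : R) h d ->
  differentiable (fun y => h (f y)) x /\ 'D_v (fun y => h (f y)) x = d * 'D_v f x.
Proof.
move=> df [dh hd]; have dh' : differentiable h (f x) by exact/derivable1_diffP.
have dhf : differentiable (h \o f) x by exact: differentiable_comp.
split => //; rewrite (deriveE (f := fun y => h (f y)) _ dhf) diff_comp//= deriveE//.
by rewrite -{1}['d f x v]mulr1 linearZ /= -(deriveE _ dh') hd /GRing.scale /= mulrC.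
Qed.

Lemma elementary_derive f : elementary f ->
  (forall x, differentiable f x) /\ (forall v, elementary ('D_v f)).
Proof.
elim=> {f} [a|w|f g _ [df ef] _ [dg eg]|f g ef0 [df ef] eg0 [dg eg]|k f ef0 [df ef]|f ef0 [df ef] f0].
- split=> [x|v]; first exact: differentiable_cst.
  rewrite (_ : 'D_v _ = fun=> 0); first exact: elementary_cst.
  by apply/funext => x; rewrite derive_cst.
- have dd x : differentiable (fun x => dot w x) x.
    rewrite (_ : (fun x => dot w x) = (fun x : 'rV[R]_3 => w 0 0 * x 0 0) +
      (fun x : 'rV[R]_3 => w 0 1 * x 0 1) + (fun x : 'rV[R]_3 => w 0 2%:R * x 0 2%:R)).
      by apply: differentiableD; [apply: differentiableD|];
        apply: differentiableM; (exact: differentiable_cst || exact: differentiable_coord).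
    by apply/funext => y; rewrite dotE.
  split=> // v; rewrite (_ : 'D_v _ = fun=> dot w v); first exact: elementary_cst.
  apply/funext => x; rewrite derive_at0.
  have -> : (fun h => dot w (h *: v + x)) = (fun h => h * dot w v + dot w x).
    by apply/funext => h; rewrite dotDr dotZr.
  have [_ ->] := rderive_add (rderive_mul (rderive_id (0 : R)) (rderive_cst 0 (dot w v))) (rderive_cst 0 (dot w x)).
  by ring.
- split=> [x|v]; first exact: differentiableD.
  rewrite (_ : 'D_v _ = fun x => 'D_v f x + 'D_v g x).
    by apply: elementary_add; [exact: ef|exact: eg].
  apply/funext => x; rewrite (_ : (fun x => f x + g x) = f + g)// deriveD//;
    exact: diff_derivable.
- split=> [x|v]; first exact: differentiableM.
  rewrite (_ : 'D_v _ = fun x => f x * 'D_v g x + g x * 'D_v f x).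
    by apply: elementary_add; apply: elementary_mul.
  apply/funext => x; rewrite (_ : (fun x => f x * g x) = f * g)// deriveM//;
    exact: diff_derivable.
- have h x v := is_derive_comp_scalar v (df x) (is_derive_flat k (f x)).
  split=> [x|v]; first by have [] := h x 0.
  rewrite (_ : 'D_v _ = fun x => (flat k.+2 (f x) + - k%:R * flat k.+1 (f x)) * 'D_v f x).
    apply: elementary_mul => //; apply: elementary_add; first exact: elementary_flat.
    by apply: elementary_mul; [exact: elementary_cst|exact: elementary_flat].
  by apply/funext => x; have [_ ->] := h x v; rewrite mulNr.
- have dV y : y != 0 -> is_derive y (1 : R) (fun y : R => y^-1) (- (y^-1 * y^-1)).
    move=> y0; apply: (is_derive_eq (@is_deriveV R id y 1 1 y0 (rderive_id y))).
    by rewrite /GRing.scale /= mulr1 -expr2 exprVn.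
  have h x v := is_derive_comp_scalar v (df x) (dV _ (f0 x)).
  split=> [x|v]; first by have [] := h x 0.
  rewrite (_ : 'D_v _ = fun x => (- 1 * ((f x)^-1 * (f x)^-1)) * 'D_v f x).
    apply: elementary_mul => //; apply: elementary_mul; first exact: elementary_cst.
    by apply: elementary_mul; exact: elementary_inv.
  by apply/funext => x; have [_ ->] := h x v; rewrite mulN1r.
Qed.

Lemma elementary_smooth f : elementary f -> smooth (fun x : sphere R => f (val x)).
Proof.
move=> ef x; exists setT, f; split => //; first exact: openT.
move=> vs u _; suff : elementary (iter_derive vs f) by move=> /elementary_derive[+ _]; exact.
by elim: vs => [//|v vs IH]; exact: (elementary_derive IH).2.
Qed.

Lemma elementary_step f : elementary f -> elementary (fun x => step (f x)).
Proof.
move=> ef; apply: elementary_mul; first exact: elementary_flat.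
apply: elementary_inv; last by move=> x; rewrite gt_eqF// step_den_gt0.
apply: elementary_add; first exact: elementary_flat.
apply: elementary_flat; rewrite (_ : (fun x => 1 - f x) = (fun x => 1 + -1 * f x)).
  apply: elementary_add; first exact: elementary_cst.
  by apply: elementary_mul => //; exact: elementary_cst.
by apply/funext => x; rewrite mulN1r.
Qed.

Lemma elementary_affine w (a b : R) : elementary (fun x => a * dot w x + b).
Proof.
apply: elementary_add; last exact: elementary_cst.
by apply: elementary_mul; [exact: elementary_cst|exact: elementary_dot].
Qed.

End Elementary.

(** * Total variation and iterated integrals *)

Section Variation.
Variable R : realType.

Notation mu := (@lebesgue_measure R).
Notation mu2 := (mu \x mu)%E.

Lemma measurable_continuous_norm (f : R -> R) (D : set R) : continuous f ->
  measurable D -> measurable_fun D (fun x => (`|f x|%R)%:E).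
Proof.
move=> cf mD; apply/measurable_EFinP; apply: measurable_funTS.
by apply: continuous_measurable_fun => x; apply: cvg_norm; exact: cf.
Qed.

Lemma integral_norm_increasing (F f : R -> R) (a b : R) : a <= b ->
  (forall x, is_derive x (1 : R) F (f x)) -> continuous f ->
  (forall x, a <= x <= b -> 0 <= f x) ->
  (\int[mu]_(x in `[a, b]) (`|f x|%R)%:E = (F b - F a)%:E)%E.
Proof.
move=> ab dF cf f0; rewrite -(integral_of_derivative ab dF cf); apply: eq_integral => x.
by rewrite inE /= in_itv /= => /f0 fx; rewrite ger0_norm.
Qed.

Lemma integral_norm_decreasing (F f : R -> R) (a b : R) : a <= b ->
  (forall x, is_derive x (1 : R) F (f x)) -> continuous f ->
  (forall x, a <= x <= b -> f x <= 0) ->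
  (\int[mu]_(x in `[a, b]) (`|f x|%R)%:E = (F a - F b)%:E)%E.
Proof.
move=> ab dF cf f0.
have dN x : is_derive x (1 : R) (fun y => - F y) (- f x) by exact: is_deriveN.
have cN : continuous (fun x => - f x) by move=> x; apply: cvgN; exact: cf.
rewrite [F a - _]addrC -[X in _ + X]opprK -(integral_of_derivative ab dN cN).
apply: eq_integral => x.
by rewrite inE /= in_itv /= => /f0 fx; rewrite ler0_norm.
Qed.

Lemma integral_itv_split (f : R -> \bar R) (a b c : R) : a <= b -> b <= c ->
  measurable_fun setT f -> (forall x, (0 <= f x)%E) ->
  (\int[mu]_(x in `[a, c]) f x =
   \int[mu]_(x in `[a, b]) f x + \int[mu]_(x in `[b, c]) f x)%E.
Proof.
move=> ab bc mf f0.
rewrite -(@integral_itv_obnd_cbnd _ b); last exact: measurable_funTS.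
rewrite -ge0_integral_setU//; last 2 first.
- exact: measurable_funTS.
- apply/disj_setPS => y [/=]; rewrite 2!in_itv/= => /andP[_ yx] /andP[].
  by rewrite ltNge yx.
by rewrite -itv_bndbnd_setU// bnd_simp.
Qed.

(** The derivative changes sign at two antipodal points only, so along the
    circle [f] rises once and falls once. *)
Lemma circle_variation (f f' : R -> R) (A B : R) :
  (forall x, is_derive x (1 : R) f (f' x)) -> continuous f' ->
  f 0 = f (2 * pi) -> (forall x, 0 <= f x <= 1) ->
  (forall x, 0 <= A * cos x + B * sin x -> 0 <= f' x) ->
  (forall x, A * cos x + B * sin x <= 0 -> f' x <= 0) ->
  (\int[mu]_(x in `[0%R, (2 * pi)%R]) (`|f' x|%R)%:E <= 2%:E)%E.
Proof.
move=> df cf' fper f01 fpos fneg; have pi0 := @pi_gt0 R.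
pose g x : R := A * cos x + B * sin x.
have cg : continuous g.
  move=> x; have h := continuousM (@cst_continuous _ _ (A : R) x) (@continuous_cos R x).
  exact: (continuousD h (continuousM (@cst_continuous _ _ (B : R) x) (@continuous_sin R x))).
have [c] : exists2 c, c \in `[0, pi]%R & g c = 0.
  apply: IVT; [exact: ltW|exact: continuous_subspaceT|].
  rewrite /g cos0 sin0 cospi sinpi mulr1 !mulr0 !addr0 mulrN mulr1.
  by rewrite ge_min le_max; have [A0|A0] := leP 0 A; apply/andP; split; apply/orP; (left; lra) || (right; lra).
rewrite in_itv /= => /andP[c0 cpi] gc.
pose k := - A * sin c + B * cos c.
have gE x : g x = k * sin (x - c).
  transitivity (k * sin (x - c) + cos (x - c) * g c); last by rewrite gc mulr0 addr0.
  rewrite -{1}(subrK c x); move: (x - c) => u.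
  by rewrite /k /g cosD sinD; ring.
have mf' : measurable_fun setT (fun x => (`|f' x|%R)%:E) by exact: measurable_continuous_norm.
rewrite (@integral_itv_split _ 0 c)//; [|lra]; rewrite (@integral_itv_split _ c (c + pi))//; [|lra|lra].
have s1 x : 0 <= x <= c -> sin (x - c) <= 0.
  move=> xc; rewrite -[x - c]opprK sinN oppr_le0; apply: sin_ge0_pi.
  by lra.
have s2 x : c <= x <= c + pi -> 0 <= sin (x - c).
  by move=> xc; apply: sin_ge0_pi; lra.
have s3 x : c + pi <= x <= 2 * pi -> sin (x - c) <= 0.
  move=> xc; rewrite (_ : x - c = (x - c - pi) + pi); last by lra.
  by rewrite sinDpi oppr_le0; apply: sin_ge0_pi; lra.
have := f01 0; have := f01 c; have := f01 (c + pi); rewrite fper => h1 h2 h3.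
have [k0|/ltW k0] := leP 0 k.
- have n1 x : 0 <= x <= c -> f' x <= 0.
    by move=> /s1 h; apply: fneg; rewrite -/(g x) gE mulr_ge0_le0.
  have n2 x : c <= x <= c + pi -> 0 <= f' x.
    by move=> /s2 h; apply: fpos; rewrite -/(g x) gE mulr_ge0.
  have n3 x : c + pi <= x <= 2 * pi -> f' x <= 0.
    by move=> /s3 h; apply: fneg; rewrite -/(g x) gE mulr_ge0_le0.
  rewrite (integral_norm_decreasing c0 df cf' n1) fper.
  rewrite (@integral_norm_increasing f f' c (c + pi))//; last by lra.
  by rewrite (@integral_norm_decreasing f f' (c + pi) (2 * pi))// -?EFinD ?lee_fin; lra.
- have n1 x : 0 <= x <= c -> 0 <= f' x.
    by move=> /s1 h; apply: fpos; rewrite -/(g x) gE mulr_le0.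
  have n2 x : c <= x <= c + pi -> f' x <= 0.
    by move=> /s2 h; apply: fneg; rewrite -/(g x) gE mulr_le0_ge0.
  have n3 x : c + pi <= x <= 2 * pi -> 0 <= f' x.
    by move=> /s3 h; apply: fpos; rewrite -/(g x) gE mulr_le0.
  rewrite (integral_norm_increasing c0 df cf' n1) fper.
  rewrite (@integral_norm_decreasing f f' c (c + pi))//; last by lra.
  by rewrite (@integral_norm_increasing f f' (c + pi) (2 * pi))// -?EFinD ?lee_fin; lra.
Qed.

(** On a closed curve the increments are half of the total variation. *)
Lemma circle_positive_variation (f f' : R -> R) (A B : R) :
  (forall x, is_derive x (1 : R) f (f' x)) -> continuous f' ->
  f 0 = f (2 * pi) -> (forall x, 0 <= f x <= 1) ->
  (forall x, 0 <= A * cos x + B * sin x -> 0 <= f' x) ->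
  (forall x, A * cos x + B * sin x <= 0 -> f' x <= 0) ->
  (\int[mu]_(x in `[0%R, (2 * pi)%R]) (Num.max (f' x) 0)%:E <= 1)%E.
Proof.
move=> df cf' fper f01 fpos fneg; have pi0 := @pi_gt0 R.
have V := circle_variation df cf' fper f01 fpos fneg.
have N := integral_of_derivative (ltW (mulr_gt0 (ltr0Sn R 1) pi0)) df cf'.
rewrite -fper subrr in N.
have cmp : compact (`[0%R, (2 * pi)%R]%classic : set R) by exact: segment_compact.
have If' : mu.-integrable `[0%R, (2 * pi)%R]%classic (EFin \o f').
  by apply: continuous_compact_integrable => //; exact: continuous_subspaceT.
have In : mu.-integrable `[0%R, (2 * pi)%R]%classic (EFin \o (fun x => `|f' x|)).
  apply: continuous_compact_integrable => //; apply: continuous_subspaceT => x.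
  by apply: cvg_norm; exact: cf'.
have S : (\int[mu]_(x in `[0%R, (2 * pi)%R]) ((`|f' x|%R)%:E + (f' x)%:E) <= 2%:E)%E.
  by rewrite integralD// N adde0.
have <- : (\int[mu]_(x in `[0%R, (2 * pi)%R]) ((2^-1)%:E * ((`|f' x|%R)%:E + (f' x)%:E)) =
    \int[mu]_(x in `[0%R, (2 * pi)%R]) (Num.max (f' x) 0)%:E)%E.
  apply: eq_integral => x _; rewrite -EFinD -EFinM; congr EFin.
  have [h|h] := leP 0 (f' x); first by rewrite ger0_norm//; lra.
  by rewrite ltr0_norm//; lra.
rewrite ge0_integralZl//.
- have h2 : (0 <= (2^-1)%:E :> \bar R)%E by rewrite lee_fin.
  by apply: (le_trans (lee_wpmul2l h2 S)); rewrite -EFinM mulVf.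
- apply/measurable_EFinP; apply: measurable_funTS; apply: continuous_measurable_fun => x.
  by apply: cvgD; [apply: cvg_norm; exact: cf'|exact: cf'].
- by move=> x _; rewrite -EFinD lee_fin; have [h|h] := leP 0 (f' x);
    [rewrite ger0_norm|rewrite ltr0_norm]; lra.
Qed.


Lemma rect_integral_le_cols (f : R * R -> R) (B : R -> R) (a b c d K : R) :
  continuous f -> (forall z, 0 <= f z) -> continuous B ->
  (forall y, c <= y <= d -> (\int[mu]_(x in `[a, b]) (f (x, y))%:E <= (B y)%:E)%E) ->
  (\int[mu]_(y in `[c, d]) (B y)%:E <= K%:E)%E ->
  (\int[mu2]_(z in `[a, b] `*` `[c, d]) (f z)%:E <= K%:E)%E.
Proof.
move=> cf f0 cB fB BK.
have mab : measurable (`[a, b]%classic : set R) by [].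
have mcd : measurable (`[c, d]%classic : set R) by [].
have mD : measurable (`[a, b]%classic `*` `[c, d]%classic : set (R * R)) by exact: measurableX.
set D := _ `*` _ in mD *.
have mf : measurable_fun setT ((fun z => (f z)%:E) \_ D).
  apply/(measurable_restrictT _ mD)/measurable_funTS/measurable_EFinP.
  exact: continuous_measurable_plane.
have fD0 z : (0 <= ((fun z => (f z)%:E) \_ D) z)%E.
  by rewrite patchE; case: ifP => // _; rewrite lee_fin.
rewrite integral_mkcond.
rewrite fubini_tonelli2//.
apply: le_trans BK; rewrite [leRHS]integral_mkcond.
apply: ge0_le_integral => //.
- by move=> y _; apply: integral_ge0 => x _; exact: fD0.
- exact: measurable_fun_fubini_tonelli_G.
- have : measurable_fun setT ((fun y => (B y)%:E) \_ `[c, d]%classic).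
    apply/(measurable_restrictT _ mcd)/measurable_funTS/measurable_EFinP.
    exact: continuous_measurable_fun.
  by [].
- move=> y _; rewrite /fubini_G [leRHS]patchE; case: ifPn => [|ycd].
    rewrite inE /= in_itv /= => ycd; apply: le_trans (fB y ycd).
    rewrite [leRHS]integral_mkcond le_eqVlt; apply/orP; left; apply/eqP.
    apply: eq_integral => x _; rewrite !patchE; congr (if _ then _ else _).
    by apply/idP/idP; rewrite !inE /D /= !in_itv /=; [case|move=> ->].
  rewrite integral0_eq// => x _; rewrite patchE ifF//.
  by apply/negP; move=> /set_mem[_ h]; move/negP: ycd; apply; exact: mem_set.
Qed.

Lemma rect_integral_le_rows (f : R * R -> R) (B : R -> R) (a b c d K : R) :
  continuous f -> (forall z, 0 <= f z) -> continuous B ->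
  (forall x, a <= x <= b -> (\int[mu]_(y in `[c, d]) (f (x, y))%:E <= (B x)%:E)%E) ->
  (\int[mu]_(x in `[a, b]) (B x)%:E <= K%:E)%E ->
  (\int[mu2]_(z in `[a, b] `*` `[c, d]) (f z)%:E <= K%:E)%E.
Proof.
move=> cf f0 cB fB BK.
have mab : measurable (`[a, b]%classic : set R) by [].
have mcd : measurable (`[c, d]%classic : set R) by [].
have mD : measurable (`[a, b]%classic `*` `[c, d]%classic : set (R * R)) by exact: measurableX.
set D := _ `*` _ in mD *.
have mf : measurable_fun setT ((fun z => (f z)%:E) \_ D).
  apply/(measurable_restrictT _ mD)/measurable_funTS/measurable_EFinP.
  exact: continuous_measurable_plane.
have fD0 z : (0 <= ((fun z => (f z)%:E) \_ D) z)%E.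
  by rewrite patchE; case: ifP => // _; rewrite lee_fin.
rewrite integral_mkcond fubini_tonelli1//.
apply: le_trans BK; rewrite [leRHS]integral_mkcond.
apply: ge0_le_integral => //.
- by move=> x _; apply: integral_ge0 => y _; exact: fD0.
- exact: measurable_fun_fubini_tonelli_F.
- have : measurable_fun setT ((fun x => (B x)%:E) \_ `[a, b]%classic).
    apply/(measurable_restrictT _ mab)/measurable_funTS/measurable_EFinP.
    exact: continuous_measurable_fun.
  by [].
- move=> x _; rewrite /fubini_F [leRHS]patchE; case: ifPn => [|xab].
    rewrite inE /= in_itv /= => xab; apply: le_trans (fB x xab).
    rewrite [leRHS]integral_mkcond le_eqVlt; apply/orP; left; apply/eqP.
    apply: eq_integral => y _; rewrite !patchE; congr (if _ then _ else _).
    by apply/idP/idP; rewrite !inE /D /= !in_itv /=; [case|move=> ->].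
  rewrite integral0_eq// => y _; rewrite patchE ifF//.
  by apply/negP; move=> /set_mem[h _]; move/negP: xab; apply; exact: mem_set.
Qed.

End Variation.

(** * Reduction of the attainment to a cap construction *)

Section SphericalDot.
Variable R : realType.
Implicit Types (w : 'rV[R]_3) (a b : R).

Lemma dot_sphericalE w a b : dot w (val (spherical a b)) =
  sin a * (w 0 0 * cos b + w 0 1 * sin b) + w 0 2%:R * cos a.
Proof. by rewrite dotE spherical0E spherical1E spherical2E; ring. Qed.

Lemma is_derive_dot1 w a b :
  is_derive a (1 : R) (fun s => dot w (val (spherical s b)))
    (cos a * (w 0 0 * cos b + w 0 1 * sin b) - w 0 2%:R * sin a).
Proof.
have ds := is_derive_sin a; have dc := is_derive_cos a.
under eq_fun do rewrite dot_sphericalE.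
apply: (is_derive_eq (rderive_add (rderive_mul ds (rderive_cst a _)) (rderive_scale _ dc))).
by rewrite mulr0 addr0 mulrN.
Qed.

Lemma is_derive_dot2 w a b :
  is_derive b (1 : R) (fun s => dot w (val (spherical a s)))
    (sin a * (w 0 1 * cos b - w 0 0 * sin b)).
Proof.
have ds := is_derive_sin b; have dc := is_derive_cos b.
under eq_fun do rewrite dot_sphericalE.
apply: (is_derive_eq (rderive_add (rderive_scale (sin a)
  (rderive_add (rderive_scale (w 0 0) dc) (rderive_scale (w 0 1) ds))) (rderive_cst b _))).
by ring.
Qed.

Lemma is_derive_unique (f : R -> R) (x d e : R) :
  is_derive x (1 : R) f d -> is_derive x (1 : R) f e -> d = e.
Proof. by move=> [_ <-] [_ <-]. Qed.

(** Since [dF + dG = ds] and [dG = s dt + t ds], the form [dF /\ dG] is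
    [ds /\ dG = s ds /\ dt]. *)
Lemma jacobian_product (s t F G : sphere R -> R) z :
  smooth s -> smooth t -> smooth F -> smooth G ->
  (forall x, F x = s x * (1 - t x)) -> (forall x, G x = s x * t x) ->
  sph_jacobian F G z = sph s z * sph_jacobian s t z.
Proof.
case: z => a b ss st sF sG FE GE.
have F1 : partial1 F (a, b) = partial1 s (a, b) * (1 - sph t (a, b)) - sph s (a, b) * partial1 t (a, b).
  apply: is_derive_unique (is_derive_partial1 a b sF) _.
  rewrite (_ : (fun y => sph F (y, b)) = fun y => sph s (y, b) * (1 - sph t (y, b)));
    last by apply/funext => y; exact: FE.
  apply: (is_derive_eq (rderive_mul (is_derive_partial1 a b ss)
    (rderive_sub (rderive_cst a 1) (is_derive_partial1 a b st)))).
  by ring.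
have F2 : partial2 F (a, b) = partial2 s (a, b) * (1 - sph t (a, b)) - sph s (a, b) * partial2 t (a, b).
  apply: is_derive_unique (is_derive_partial2 a b sF) _.
  rewrite (_ : (fun y => sph F (a, y)) = fun y => sph s (a, y) * (1 - sph t (a, y)));
    last by apply/funext => y; exact: FE.
  apply: (is_derive_eq (rderive_mul (is_derive_partial2 a b ss)
    (rderive_sub (rderive_cst b 1) (is_derive_partial2 a b st)))).
  by ring.
have G1 : partial1 G (a, b) = partial1 s (a, b) * sph t (a, b) + sph s (a, b) * partial1 t (a, b).
  apply: is_derive_unique (is_derive_partial1 a b sG) _.
  rewrite (_ : (fun y => sph G (y, b)) = fun y => sph s (y, b) * sph t (y, b));
    last by apply/funext => y; exact: GE.
  exact: (rderive_mul (is_derive_partial1 a b ss) (is_derive_partial1 a b st)).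
have G2 : partial2 G (a, b) = partial2 s (a, b) * sph t (a, b) + sph s (a, b) * partial2 t (a, b).
  apply: is_derive_unique (is_derive_partial2 a b sG) _.
  rewrite (_ : (fun y => sph G (a, y)) = fun y => sph s (a, y) * sph t (a, y));
    last by apply/funext => y; exact: GE.
  exact: (rderive_mul (is_derive_partial2 a b ss) (is_derive_partial2 a b st)).
by rewrite /sph_jacobian F1 F2 G1 G2; ring.
Qed.

End SphericalDot.

Section Reduction.
Variables (R : realType) (p1 p2 p3 : sphere R) (tau : set (sphere R) -> R).
Hypotheses (p12 : p1 <> p2) (p13 : p1 <> p3) (p23 : p2 <> p3).
Hypotheses (qm : is_quasi_measure tau) (ext : extends_three_point p1 p2 p3 tau).
Variable omega : sphere R -> 'rV[R]_3 -> 'rV[R]_3 -> R.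
Hypothesis om : is_area_form omega.

Notation mu2 := (@lebesgue_measure R \x @lebesgue_measure R)%E.
Notation rect := (@sph_rect R).

Lemma defect_sqr_le_jacobian F G : smooth F -> smooth G ->
  (((quasi_state_of tau (F \+ G) - quasi_state_of tau F - quasi_state_of tau G) ^+ 2)%:E <=
   \int[mu2]_(z in rect) (`|sph_jacobian F G z|%R)%:E)%E.
Proof.
move=> sF sG.
apply: (defect_sqr_le p12 p13 p23 qm ext (smooth_continuous sF) (smooth_continuous sG)
  (continuous_partial1 sF) (continuous_partial2 sF)
  (continuous_partial1 sG) (continuous_partial2 sG)) => a b.
- exact: is_derive_partial1.
- exact: is_derive_partial2.
- exact: is_derive_partial1.
- exact: is_derive_partial2.
Qed.

Lemma defect_sqr_le_bracket F G : smooth F -> smooth G -> bracket_L1 omega F G <> 0 ->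
  0 < bracket_L1 omega F G /\ quasi_defect (quasi_state_of tau) F G ^+ 2 <= bracket_L1 omega F G.
Proof.
move=> sF sG; rewrite (bracket_L1E om sF sG) => L0.
have := defect_sqr_le_jacobian sF sG; move: L0.
rewrite /quasi_defect real_normK ?num_real//.
set I := (\int[_]_(_ in _) _)%E.
have : (0 <= I)%E by apply: integral_ge0 => z _; rewrite lee_fin.
case: I => [r||]//=; rewrite !lee_fin => r0 rn0 h; split => //.
by rewrite lt_neqAle r0 andbT eq_sym; apply/eqP.
Qed.

(** A cap and its complement are both connected. *)
Lemma tau_cap u (c : R) : two_marked p1 p2 p3 [set x : sphere R | c <= dot u (val x)] ->
  tau [set x : sphere R | c <= dot u (val x)] = 1.
Proof.
move=> h; apply: (tau_solid1 p12 p13 p23 ext) => //; first exact: closed_cap.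
split; first exact: connected_closed_cap.
rewrite (_ : ~` _ = [set x : sphere R | - c < dot (- u) (val x)]).
  exact: connected_open_cap.
by apply/seteqP; split => x /=; rewrite dotNl ltrN2 ltNge => /negP.
Qed.

(** The functions are [F = f (1 - g)] and [G = f g]; on [C1], [C2] and [C3]
    they give to [F], [G] and [F + G] the values 0, 0 and 1. The lower bound 1
    of the integral comes from the defect. *)
Lemma defect_attained f g (C1 C2 C3 : set (sphere R)) :
  elementary f -> elementary g ->
  closed C1 -> closed C2 -> closed C3 -> tau C1 = 1 -> tau C2 = 1 -> tau C3 = 1 ->
  (forall x, C1 x -> f (val x) = 0 \/ g (val x) = 1) ->
  (forall x, C2 x -> f (val x) = 0 \/ g (val x) = 0) ->
  (forall x, C3 x -> f (val x) = 1) ->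
  (\int[mu2]_(z in rect) (`|f (val (sph_pt z)) *
     sph_jacobian (fun x => f (val x)) (fun x => g (val x)) z|%R)%:E <= 1)%E ->
  exists F G, [/\ smooth F, smooth G, bracket_L1 omega F G = 1 &
    quasi_defect (quasi_state_of tau) F G = 1].
Proof.
move=> ef eg c1 c2 c3 t1 t2 t3 C1fg C2fg C3fg J1.
pose F (x : sphere R) := f (val x) * (1 + -1 * g (val x)).
pose G (x : sphere R) := f (val x) * g (val x).
have sF : smooth F.
  apply: (@elementary_smooth R (fun x => f x * (1 + -1 * g x))).
  apply: elementary_mul => //; apply: elementary_add; first exact: elementary_cst.
  by apply: elementary_mul => //; exact: elementary_cst.
have sG : smooth G by apply: (@elementary_smooth R (fun x => f x * g x)); exact: elementary_mul.
have cF := smooth_continuous sF; have cG := smooth_continuous sG.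
have cFG : continuous (F \+ G) by move=> x; exact: (continuousD (cF x) (cG x)).
have zF : quasi_state_of tau F = 0.
  apply: (quasi_state_of_eq p12 p13 p23 qm ext cF c1 t1) => x /C1fg; rewrite /F.
  by case=> ->; rewrite ?mul0r// mulN1r subrr mulr0.
have zG : quasi_state_of tau G = 0.
  apply: (quasi_state_of_eq p12 p13 p23 qm ext cG c2 t2) => x /C2fg; rewrite /G.
  by case=> ->; rewrite ?mul0r// mulr0.
have zFG : quasi_state_of tau (F \+ G) = 1.
  apply: (quasi_state_of_eq p12 p13 p23 qm ext cFG c3 t3) => x /C3fg /=.
  by rewrite /F /G => ->; ring.
have defect1 : quasi_defect (quasi_state_of tau) F G = 1.
  by rewrite /quasi_defect zF zG zFG !subr0 normr1.
exists F, G; split => //.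
have := defect_sqr_le_jacobian sF sG; rewrite zF zG zFG !subr0 expr1n.
rewrite (bracket_L1E om sF sG).
have -> : (\int[mu2]_(z in rect) (`|sph_jacobian F G z|%R)%:E)%E =
  (\int[mu2]_(z in rect) (`|f (val (sph_pt z)) *
     sph_jacobian (fun x => f (val x)) (fun x => g (val x)) z|%R)%:E)%E.
  apply: eq_integral => z _; congr (`|_|%:E).
  apply: jacobian_product => //; try exact: elementary_smooth.
  by move=> x; rewrite /F mulN1r.
set I := (\int[_]_(_ in _) _)%E in J1 *.
by move=> J1'; rewrite (_ : I = 1%E)//; apply/eqP; rewrite eq_le J1.
Qed.

End Reduction.

(** * Three points of which one is strictly extreme in height *)

Section StepPartials.
Variable R : realType.
Implicit Types (w : 'rV[R]_3) (a b : R) (z : R * R).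

Definition affine_step w a b (x : 'rV[R]_3) : R := step (a * dot w x + b).

Lemma elementary_affine_step w a b : elementary (affine_step w a b).
Proof. by apply: elementary_step; exact: elementary_affine. Qed.

Lemma smooth_affine_step w a b : smooth (fun x : sphere R => affine_step w a b (val x)).
Proof. by apply: elementary_smooth; exact: elementary_affine_step. Qed.

Lemma partial1_affine_step w a b z :
  partial1 (fun x => affine_step w a b (val x)) z =
  dstep (a * dot w (val (sph_pt z)) + b) *
    (a * (cos z.1 * (w 0 0 * cos z.2 + w 0 1 * sin z.2) - w 0 2%:R * sin z.1)).
Proof.
case: z => x y; apply: is_derive_unique (is_derive_partial1 x y (smooth_affine_step w a b)) _.
have dl := rderive_add (rderive_scale a (is_derive_dot1 w x y)) (rderive_cst x b).
rewrite addr0 in dl.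
exact: (@rderive_comp R (@step R) (fun s => a * dot w (val (spherical s y)) + b) x _ _
  (is_derive_step _) dl).
Qed.

Lemma partial2_affine_step w a b z :
  partial2 (fun x => affine_step w a b (val x)) z =
  dstep (a * dot w (val (sph_pt z)) + b) *
    (a * (sin z.1 * (w 0 1 * cos z.2 - w 0 0 * sin z.2))).
Proof.
case: z => x y; apply: is_derive_unique (is_derive_partial2 x y (smooth_affine_step w a b)) _.
have dl := rderive_add (rderive_scale a (is_derive_dot2 w x y)) (rderive_cst y b).
rewrite addr0 in dl.
exact: (@rderive_comp R (@step R) (fun s => a * dot w (val (spherical x s)) + b) y _ _
  (is_derive_step _) dl).
Qed.

Lemma continuous_sph_jacobian F G : smooth F -> smooth G ->
  continuous (@sph_jacobian R F G).
Proof.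
move=> sF sG z.
have h1 := continuousM (continuous_partial1 sF (x := z)) (continuous_partial2 sG (x := z)).
exact: (continuousB h1 (continuousM (continuous_partial2 sF (x := z)) (continuous_partial1 sG (x := z)))).
Qed.

Lemma continuous_partial2_section F x : smooth F -> continuous (fun y : R => partial2 F (x, y)).
Proof.
move=> sF y; apply: (@continuous_comp _ _ _ (fun y : R => (x, y)) (partial2 F)).
  exact: (continuous_pair_at (@cst_continuous _ _ x y) (@cvg_id _ _)).
exact: continuous_partial2.
Qed.

End StepPartials.

Section ExtremeNumbers.
Variable R : realType.
Implicit Types (s w d k al z X Y : R).

Lemma extreme_cap s w d k al z (z1 : R) :
  (s * w - k * al * z1 <= s * d - k * al * z) = (k * (al * (z - z1)) <= s * (d - w)).
Proof. by apply/idP/idP; lra. Qed.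

Lemma height_cap al z (z1 : R) : (1 + al * z1 <= al * z) = (1 <= al * (z - z1)).
Proof. by apply/idP/idP; lra. Qed.

Lemma extreme_saturation k X Y : 0 < k -> 2^-1 < X -> k * X <= Y -> 1 <= k^-1 * Y + 2^-1.
Proof.
move=> k0 Xh kXY; have : k^-1 * (k * X) <= k^-1 * Y by rewrite ler_pM2l ?invr_gt0.
by rewrite mulKf ?gt_eqF//; lra.
Qed.

Lemma extreme_saturationN k X Y : 0 < k -> 2^-1 < X -> k * X <= - Y -> k^-1 * Y + 2^-1 <= 0.
Proof. by move=> k0 Xh /(extreme_saturation k0 Xh); rewrite mulrN; lra. Qed.

Lemma two_sub_one_ge1 X : 1 <= X -> 1 <= 2 * X - 1.
Proof. by lra. Qed.

Lemma two_sub_one_le0 X : X <= 2^-1 -> 2 * X - 1 <= 0.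
Proof. by lra. Qed.

End ExtremeNumbers.

Section ExtremeHeight.
Variables (R : realType) (p1 p2 p3 : sphere R) (tau : set (sphere R) -> R).
Hypotheses (p12 : p1 <> p2) (p13 : p1 <> p3) (p23 : p2 <> p3).
Hypotheses (qm : is_quasi_measure tau) (ext : extends_three_point p1 p2 p3 tau).
Variable omega : sphere R -> 'rV[R]_3 -> 'rV[R]_3 -> R.
Hypothesis om : is_area_form omega.
Variables q1 q2 q3 : sphere R.
Hypothesis caps : forall u (c : R),
  two_marked q1 q2 q3 [set x : sphere R | c <= dot u (val x)] ->
  tau [set x : sphere R | c <= dot u (val x)] = 1.

Notation mu := (@lebesgue_measure R).
Notation mu2 := (mu \x mu)%E.
Notation rect := (@sph_rect R).
Notation ht x := (val x 0 2%:R).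

(** Three distinct points of a sphere are not aligned, so the Gram determinant
    of [q2 - q1] and [q3 - q1] is positive; up to sign it is the value of [w]
    on both vectors. *)
Lemma separating_plane : q1 <> q2 -> q1 <> q3 -> q2 <> q3 ->
  exists2 w, 0 < dot w (val q3) - dot w (val q1) &
    dot w (val q2) - dot w (val q1) = - (dot w (val q3) - dot w (val q1)).
Proof.
move=> q12 q13 q23.
pose a := dot (val q1) (val q2); pose b := dot (val q1) (val q3); pose c := dot (val q2) (val q3).
have a1 : a < 1.
  by rewrite lt_neqAle sphere_dot_le1 andbT; apply/eqP => /sphere_dot_eq1.
have b1 : b < 1.
  by rewrite lt_neqAle sphere_dot_le1 andbT; apply/eqP => /sphere_dot_eq1.
have cn1 : c <> 1 by move=> /sphere_dot_eq1.
pose A := 2 - 2 * a; pose B := 2 - 2 * b; pose m := c - a - b + 1.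
pose u := val q2 - val q1; pose v := val q3 - val q1.
have uE y : dot u y = dot (val q2) y - dot (val q1) y by rewrite /u dotDl dotNl.
have vE y : dot v y = dot (val q3) y - dot (val q1) y by rewrite /v dotDl dotNl.
have ug : dot u (val q3) - dot u (val q1) = m.
  by rewrite !uE !sphere_dot !(dotC (val q2) (val q1)) /m /a /b /c; ring.
have uu : dot u (val q2) - dot u (val q1) = A.
  by rewrite !uE !sphere_dot !(dotC (val q2) (val q1)) /A /a; ring.
have vg : dot v (val q3) - dot v (val q1) = B.
  by rewrite !vE !sphere_dot !(dotC (val q3) (val q1)) /B /b; ring.
have vu : dot v (val q2) - dot v (val q1) = m.
  by rewrite !vE !sphere_dot !(dotC (val q3)) /m /a /b /c; ring.
have wE (s t : R) y : dot (s *: v + t *: u) y = s * dot v y + t * dot u y.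
  by rewrite dotDl !dotZl.
have A0 : 0 < A by rewrite /A; lra.
have B0 : 0 < B by rewrite /B; lra.
pose n := A *: v + - m *: u.
have nE y : dot n y = A * dot v y + - m * dot u y by exact: wE.
have vr y : dot y v = dot y (val q3) - dot y (val q1) by rewrite dotDr dotNr.
have ur y : dot y u = dot y (val q2) - dot y (val q1) by rewrite dotDr dotNr.
have nn : dot n n = A * (A * B - m ^+ 2).
  by rewrite nE (dotC v) (dotC u) !nE !(vr, ur) ug uu vg vu; ring.
have g0 : 0 < A * B - m ^+ 2.
  have : 0 <= A * B - m ^+ 2 by rewrite -(pmulr_rge0 _ A0) -nn dot_ge0.
  rewrite le_eqVlt => /orP[/eqP ge|//]; exfalso; apply: cn1.
  have n0 : n = 0 by apply: dot_eq0; rewrite nn -ge mulr0.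
  have : dot n (val q1) = 0 by rewrite n0 -(scale0r 0) dotZl mul0r.
  rewrite /n wE uE vE !sphere_dot (dotC _ (val q1)) (dotC (val q2)) -/a -/b => e.
  have mB : m = B by apply: (mulfI (lt0r_neq0 A0)); move: e; rewrite /A /B; lra.
  have AB : A = B by apply: (mulfI (lt0r_neq0 B0)); move: ge; rewrite mB; lra.
  by move: mB AB; rewrite /m /A /B; lra.
have e3 : (A + m) * dot v (val q3) + - (B + m) * dot u (val q3) -
    ((A + m) * dot v (val q1) + - (B + m) * dot u (val q1)) = A * B - m ^+ 2.
  transitivity ((A + m) * (dot v (val q3) - dot v (val q1))
    - (B + m) * (dot u (val q3) - dot u (val q1))); first by ring.
  by rewrite ug vg; ring.
have e2 : (A + m) * dot v (val q2) + - (B + m) * dot u (val q2) -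
    ((A + m) * dot v (val q1) + - (B + m) * dot u (val q1)) = - (A * B - m ^+ 2).
  transitivity ((A + m) * (dot v (val q2) - dot v (val q1))
    - (B + m) * (dot u (val q2) - dot u (val q1))); first by ring.
  by rewrite uu vu; ring.
by exists ((A + m) *: v + - (B + m) *: u); rewrite !wE e3// e2.
Qed.

Definition vertical_density (a b x : R) : R :=
  2 * (step (a * cos x + b) * (dstep (a * cos x + b) * (a * - sin x))).

Lemma continuous_vertical_density (a b : R) : continuous (vertical_density a b).
Proof.
have cl : continuous (fun y : R => a * cos y + b).
  move=> x; apply: (continuousD _ (@cst_continuous _ _ (b : R) x)).
  exact: (continuousM (@cst_continuous _ _ (a : R) x) (@continuous_cos R x)).
move=> x; have cs : {for x, continuous (fun y => step (a * cos y + b))}.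
  by apply: (@continuous_comp _ _ _ (fun y : R => a * cos y + b) (@step R)); [exact: cl|exact: continuous_step].
have cd : {for x, continuous (fun y => dstep (a * cos y + b))}.
  by apply: (@continuous_comp _ _ _ (fun y : R => a * cos y + b) (@dstep R)); [exact: cl|exact: continuous_dstep].
have ca : {for x, continuous (fun y : R => a * - sin y)}.
  exact: (continuousM (@cst_continuous _ _ (a : R) x) (continuousN (@continuous_sin R x))).
exact: (continuousM (@cst_continuous _ _ (2 : R) x) (continuousM cs (continuousM cd ca))).
Qed.

(** The density is the derivative of the square of a monotone function of the
    polar angle. *)
Lemma vertical_step_variation (a b : R) :
  (\int[mu]_(x in `[0%R, pi]) (`|vertical_density a b x|%R)%:E <= 1)%E.
Proof.
pose S x := step (a * cos x + b) * step (a * cos x + b).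
pose S' := vertical_density a b.
have pi0 := @pi_gt0 R.
have dl x : is_derive x (1 : R) (fun y => a * cos y + b) (a * - sin x).
  by have := rderive_add (rderive_scale a (is_derive_cos x)) (rderive_cst x b); rewrite addr0.
have dS x : is_derive x (1 : R) S (S' x).
  have h := @rderive_comp R (@step R) _ x _ _ (is_derive_step (a * cos x + b)) (dl x).
  by apply: (is_derive_eq (rderive_mul h h)); rewrite /S' /vertical_density; ring.
have cS' : continuous S' := @continuous_vertical_density a b.
have S01 x : 0 <= S x <= 1.
  by rewrite /S mulr_ge0 ?step_ge0//= mulr_ile1 ?step_ge0 ?step_le1.
have := S01 0; have := S01 pi => h1 h2.
have pos x : 0 <= x <= pi ->
    0 <= 2 * (step (a * cos x + b) * (dstep (a * cos x + b) * sin x)).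
  move=> /sin_ge0_pi sx; apply: mulr_ge0 => //; apply: mulr_ge0; first exact: step_ge0.
  by apply: mulr_ge0 => //; exact: dstep_ge0.
have S'E x : S' x = - a * (2 * (step (a * cos x + b) * (dstep (a * cos x + b) * sin x))).
  by rewrite /S' /vertical_density; ring.
have [a0|/ltW a0] := leP 0 a.
- rewrite (@integral_norm_decreasing R S S' 0 pi (ltW pi0) dS cS') ?lee_fin; first by lra.
  by move=> x /pos h; rewrite S'E mulNr oppr_le0 mulr_ge0.
- rewrite (@integral_norm_increasing R S S' 0 pi (ltW pi0) dS cS') ?lee_fin; first by lra.
  by move=> x /pos h; rewrite S'E mulNr oppr_ge0 mulr_le0_ge0.
Qed.

(** With [X] the height above [q1], at least 1 at [q2] and [q3], and [Y] a
    linear function that vanishes at [q1] and is opposite at [q2] and [q3],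
    the caps are [1 <= X] and [k * X <= Y], [k * X <= - Y]; where the step of
    [X] does not vanish, the latter force the step of [Y] to be 1 or 0. The
    step of [X] depends on the polar angle only, so the Jacobian has one term. *)
Lemma defect_attained_extreme (sg : R) : q2 <> q3 ->
  0 < sg * (ht q2 - ht q1) -> 0 < sg * (ht q3 - ht q1) ->
  exists F G, [/\ smooth F, smooth G, bracket_L1 omega F G = 1 &
    quasi_defect (quasi_state_of tau) F G = 1].
Proof.
move=> q23 z2 z3.
have q12 : q1 <> q2 by move=> e; move: z2; rewrite e subrr mulr0 ltxx.
have q13 : q1 <> q3 by move=> e; move: z3; rewrite e subrr mulr0 ltxx.
have [w w3 w2] := separating_plane q12 q13 q23.
pose e3 : 'rV[R]_3 := \row_(i < 3) [:: 0; 0; 1]`_i.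
have e3E y : dot e3 y = y 0 2%:R by rewrite dotE !mxE /= !mul0r !add0r mul1r.
pose d := Num.min (sg * (ht q2 - ht q1)) (sg * (ht q3 - ht q1)).
have d0 : 0 < d by rewrite lt_min z2 z3.
pose al := sg / d.
pose X (x : sphere R) := al * (ht x - ht q1).
have X2 : 1 <= X q2 by rewrite /X /al mulrAC ler_pdivlMr// mul1r ge_min lexx.
have X3 : 1 <= X q3 by rewrite /X /al mulrAC ler_pdivlMr// mul1r ge_min lexx orbT.
have X1 : X q1 = 0 by rewrite /X subrr mulr0.
pose g := dot w (val q3) - dot w (val q1).
pose k := g / (X q2 + X q3).
have XX0 : 0 < X q2 + X q3 by rewrite addr_gt0// (lt_le_trans ltr01).
have k0 : 0 < k by rewrite divr_gt0.
pose Y (x : sphere R) := dot w (val x) - dot w (val q1).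
have kX2 : k * X q2 <= g.
  by rewrite /k mulrAC ler_pdivrMr// ler_wpM2l// ?(ltW w3)// lerDl (le_trans ler01).
have kX3 : k * X q3 <= g.
  by rewrite /k mulrAC ler_pdivrMr// ler_wpM2l// ?(ltW w3)// lerDr (le_trans ler01).
pose f := affine_step e3 (2 * al) (- (2 * al * ht q1) - 1).
pose h := affine_step w k^-1 (2^-1 - k^-1 * dot w (val q1)).
have fE x : f (val x) = step (2 * X x - 1).
  by rewrite /f /affine_step e3E /X; congr step; ring.
have hE x : h (val x) = step (k^-1 * Y x + 2^-1).
  by rewrite /h /affine_step /Y; congr step; ring.
have capE (s : R) : [set x : sphere R | s * dot w (val q1) - k * al * ht q1 <= dot (s *: w - (k * al) *: e3) (val x)] =
    [set x | k * X x <= s * Y x].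
  by apply/seteqP; split => x /=; rewrite dotDl dotNl !dotZl e3E /X /Y extreme_cap.
have small (x : sphere R) : X x <= 2^-1 -> f (val x) = 0.
  by move=> /two_sub_one_le0 xx; rewrite fE step_le0.
have kV0 : 0 < k^-1 by rewrite invr_gt0.
apply: (@defect_attained R p1 p2 p3 tau p12 p13 p23 qm ext omega om f h
  [set x | k * X x <= 1 * Y x] [set x | k * X x <= -1 * Y x]
  [set x : sphere R | 1 + al * ht q1 <= dot (al *: e3) (val x)]).
- exact: elementary_affine_step.
- exact: elementary_affine_step.
- by rewrite -capE; exact: closed_cap.
- by rewrite -capE; exact: closed_cap.
- exact: closed_cap.
- rewrite -capE; apply: caps; rewrite capE; right; left; rewrite /= X1 mulr0 /Y.
  by rewrite subrr mulr0 mul1r.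
- rewrite -capE; apply: caps; rewrite capE; left; rewrite /= X1 mulr0 /Y.
  by rewrite subrr mulr0 w2 mulN1r opprK.
- by apply: caps; right; right; rewrite /= !dotZl !e3E !height_cap.
- move=> x /=; rewrite mul1r => xx; have [|Xh] := leP (X x) 2^-1; first by move=> /small; left.
  by right; rewrite hE step_ge1//; exact: extreme_saturation xx.
- move=> x /=; rewrite mulN1r => xx; have [|Xh] := leP (X x) 2^-1; first by move=> /small; left.
  by right; rewrite hE step_le0//; exact: extreme_saturationN xx.
- by move=> x /=; rewrite dotZl e3E height_cap => /two_sub_one_ge1 xx; rewrite fE step_ge1.
have sf := smooth_affine_step e3 (2 * al) (- (2 * al * ht q1) - 1).
have sh := smooth_affine_step w k^-1 (2^-1 - k^-1 * dot w (val q1)).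
rewrite -/f in sf; rewrite -/h in sh.
pose a := 2 * al; pose b := - (2 * al * ht q1) - 1.
have JE x y : f (val (sph_pt (x, y))) *
     sph_jacobian (fun x => f (val x)) (fun x => h (val x)) (x, y) =
   2^-1 * vertical_density a b x * partial2 (fun x => h (val x)) (x, y).
  rewrite /sph_jacobian partial1_affine_step (partial2_affine_step e3).
  rewrite (e3E (val _)) spherical2E /f /affine_step e3E spherical2E !mxE /= -/a -/b /vertical_density.
  by field.
apply: (@rect_integral_le_rows R (fun z => `|f (val (sph_pt z)) *
     sph_jacobian (fun x => f (val x)) (fun x => h (val x)) z|)
  (fun x => `|vertical_density a b x|)).
- move=> z; apply: cvg_norm.
  exact: (continuousM (@continuous_sph R _ (smooth_continuous sf) z) (@continuous_sph_jacobian R _ _ sf sh z)).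
- by move=> z; exact: normr_ge0.
- by move=> x; apply: cvg_norm; exact: continuous_vertical_density.
- move=> x x0pi; under eq_integral do rewrite JE normrM EFinM.
  have ct := @continuous_partial2_section R _ x sh.
  rewrite ge0_integralZl//; last by apply: measurable_continuous_norm.
  have V : (\int[mu]_(y in `[0%R, (2 * pi)%R]) (`|partial2 (fun x => h (val x)) (x, y)|%R)%:E <= 2%:E)%E.
    apply: (@circle_variation R (fun y => h (val (spherical x y))) _ (w 0 1) (- w 0 0)) => //.
    + by move=> y; exact: is_derive_partial2.
    + by rewrite /h /affine_step !dot_sphericalE cos0 sin0 mulr_natl cos2pi sin2pi.
    + by move=> y; rewrite step_ge0 step_le1.
    + move=> y h0; rewrite partial2_affine_step; apply: mulr_ge0; first exact: dstep_ge0.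
      by rewrite pmulr_rge0// mulr_ge0 ?sin_ge0_pi//; move: h0; rewrite mulNr.
    + move=> y h0; rewrite partial2_affine_step; apply: mulr_ge0_le0; first exact: dstep_ge0.
      by rewrite pmulr_rle0// mulr_ge0_le0 ?sin_ge0_pi//; move: h0; rewrite mulNr.
  have h2 : (0 <= (`|2^-1 * vertical_density a b x|%R)%:E)%E by rewrite lee_fin.
  apply: (le_trans (lee_wpmul2l h2 V)); rewrite -EFinM lee_fin normrM gtr0_norm//.
  by rewrite mulrAC mulVf// mul1r.
- exact: vertical_step_variation.
Qed.

End ExtremeHeight.

(** * Angular steps *)

Section Cone.
Variable R : realType.
Variables (x0 k : R).
Hypothesis x00 : 0 < x0.
Implicit Types u v : R.

(** A positive smooth function that is the identity from [x0] on; dividing by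
    it instead of [u] makes the slope [v / u] smooth everywhere. *)
Definition regularized u : R := x0 + step (x0^-1 * u) * (u - x0).
Definition dregularized u : R := dstep (x0^-1 * u) * x0^-1 * (u - x0) + step (x0^-1 * u).

Lemma regularized_le0 u : u <= 0 -> regularized u = x0 /\ dregularized u = 0.
Proof.
move=> u0; rewrite /regularized /dregularized step_le0 ?dstep_le0 ?mul0r ?addr0//;
  by rewrite pmulr_rle0// invr_gt0.
Qed.

Lemma regularized_ge u : x0 <= u -> regularized u = u /\ dregularized u = 1.
Proof.
move=> xu; have h : 1 <= x0^-1 * u by rewrite mulrC ler_pdivlMr ?mul1r.
by rewrite /regularized /dregularized step_ge1// dstep_ge1// !mul0r mul1r add0r; split; lra.
Qed.

Lemma regularized_le u : u <= x0 -> regularized u <= x0.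
Proof.
by move=> ux; rewrite /regularized gerDl mulr_ge0_le0 ?step_ge0//; lra.
Qed.

Lemma regularized_gt0 u : 0 < regularized u.
Proof.
have [u0|u0] := leP u 0; first by have [-> _] := regularized_le0 u0.
rewrite /regularized; set s := step _.
have s0 : 0 <= s by exact: step_ge0.
have s1 : s <= 1 by exact: step_le1.
rewrite (_ : _ + _ = (1 - s) * x0 + s * u); last by ring.
have [->|sn0] := eqVneq s 0; first by rewrite subr0 mul1r mul0r addr0.
have sp : 0 < s by rewrite lt_neqAle eq_sym sn0.
by apply: ltr_wpDl; [rewrite mulr_ge0 ?(ltW x00)//; lra|exact: mulr_gt0].
Qed.

Lemma is_derive_regularized u : is_derive u (1 : R) regularized (dregularized u).
Proof.
have h := @rderive_comp R (@step R) (fun u => x0^-1 * u) u _ _ (is_derive_step _)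
  (rderive_scale x0^-1 (rderive_id u)).
have h2 := rderive_sub (rderive_id u) (rderive_cst u x0).
apply: (is_derive_eq (rderive_add (rderive_cst u x0) (rderive_mul h h2))).
by rewrite /dregularized; ring.
Qed.

(** For [u] at least [x0] the value only depends on the direction of [(u, v)]. *)
Definition cone_step u v : R := step (k * v * (regularized u)^-1 + 2^-1).

Definition cone_slope u v ud vd : R :=
  dstep (k * v * (regularized u)^-1 + 2^-1) *
  (k * (vd * regularized u - v * (dregularized u * ud)) / regularized u ^+ 2).

Lemma is_derive_cone_step (x y : R -> R) (s xd yd : R) :
  is_derive s (1 : R) x xd -> is_derive s (1 : R) y yd ->
  is_derive s (1 : R) (fun s => cone_step (x s) (y s)) (cone_slope (x s) (y s) xd yd).
Proof.
move=> dx dy; have r0 := lt0r_neq0 (regularized_gt0 (x s)).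
have dr := @rderive_comp R regularized x s _ _ (is_derive_regularized (x s)) dx.
have dV : is_derive s (1 : R) (fun s => (regularized (x s))^-1)
    (- (dregularized (x s) * xd) / regularized (x s) ^+ 2).
  apply: (is_derive_eq (@is_deriveV R _ s _ 1 r0 dr)).
  by rewrite /GRing.scale /=; field.
have da := rderive_add (rderive_mul (rderive_scale k dy) dV) (rderive_cst s 2^-1).
apply: (is_derive_eq (@rderive_comp R (@step R)
  (fun s => k * y s * (regularized (x s))^-1 + 2^-1) s _ _ (is_derive_step _) da)).
by rewrite /cone_slope; congr (_ * _); field.
Qed.

End Cone.

Section Meridian.
Variable R : realType.
Notation mu := (@lebesgue_measure R).

(** The square of [s] is monotone on each half of the meridian. *)
Lemma meridian_variation (s s' d : R -> R) (k : R) :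
  (forall x, is_derive x (1 : R) s (s' x)) -> continuous s' ->
  (forall x, 0 <= s x <= 1) -> (forall x, 0 <= d x) ->
  (forall x, s' x = d x * (k * cos x)) ->
  (\int[mu]_(x in `[0%R, pi]) (`|s x * s' x|%R)%:E <= 1)%E.
Proof.
move=> ds cs' s01 d0 s'E; have pi0 := @pi_gt0 R.
pose S x := 2^-1 * (s x * s x).
have dS x : is_derive x (1 : R) S (s x * s' x).
  by apply: (is_derive_eq (rderive_scale 2^-1 (rderive_mul (ds x) (ds x)))); field.
have cs : continuous s by move=> x; exact: is_derive_continuous (ds x).
have cS' : continuous (fun x => s x * s' x) by move=> x; exact: (continuousM (cs x) (cs' x)).
have S01 x : 0 <= S x <= 2^-1.
  have /andP[h1 h2] := s01 x; rewrite /S mulr_ge0 ?mulr_ge0//=.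
  by rewrite -[leRHS]mulr1 ler_wpM2l// mulr_ile1.
have := S01 0; have := S01 (pi / 2); have := S01 pi => b1 b2 b3.
have c1 x : 0 <= x <= pi / 2 -> 0 <= cos x.
  by move=> h; apply: cos_ge0_pihalf; lra.
have c2 x : pi / 2 <= x <= pi -> cos x <= 0.
  move=> h; rewrite -[x](subrK pi) cosDpi oppr_le0.
  by apply: cos_ge0_pihalf; lra.
have E x : s x * s' x = s x * d x * k * cos x by rewrite s'E; ring.
have sd x : 0 <= s x * d x by have /andP[h1 _] := s01 x; exact: mulr_ge0.
rewrite (@integral_itv_split R _ 0 (pi / 2) pi); [|lra|lra| |by move=> x; rewrite lee_fin]; last first.
  exact: measurable_continuous_norm.
have [k0|/ltW k0] := leP 0 k.
- rewrite (@integral_norm_increasing R S _ 0 (pi / 2))//; [|lra|]; last first.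
    by move=> x /c1 h; rewrite E mulr_ge0// mulr_ge0.
  rewrite (@integral_norm_decreasing R S _ (pi / 2) pi)//; [|lra|]; last first.
    by move=> x /c2 h; rewrite E mulr_ge0_le0// mulr_ge0.
  by rewrite -EFinD lee_fin; lra.
- rewrite (@integral_norm_decreasing R S _ 0 (pi / 2))//; [|lra|]; last first.
    by move=> x /c1 h; rewrite E mulr_le0_ge0// mulr_ge0_le0.
  rewrite (@integral_norm_increasing R S _ (pi / 2) pi)//; [|lra|]; last first.
    by move=> x /c2 h; rewrite E mulr_le0// mulr_ge0_le0.
  by rewrite -EFinD lee_fin; lra.
Qed.

End Meridian.

(** * Three points of the same height *)

Lemma norm_mul_max (R : realType) (P Q r s : R) : 0 <= P ->
  `|r * (Q * P - s * 0)| <= Num.max P 0 * `|r * Q|.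
Proof.
move=> P0; rewrite mulr0 subr0 mulrA normrM (ger0_norm P0) mulrC ler_wpM2r//.
by rewrite le_max lexx.
Qed.

Section LevelIntegral.
Variables (R : realType) (x0 k e a0 a1 : R).
Hypotheses (x00 : 0 < x0) (k0 : 0 < k) (e0 : 0 < e).
(** A point of the equator with [`|u| <= x0] has [`|v|] at least
    [x0 / (2 * k)], so that the angular step is saturated there. *)
Hypothesis saturated : x0 ^+ 2 + (x0 / (2 * k)) ^+ 2 <= a0 ^+ 2 + a1 ^+ 2.

Notation mu := (@lebesgue_measure R).
Notation mu2 := (mu \x mu)%E.
Notation rect := (@sph_rect R).

Definition horizontal (b0 b1 : R) : 'rV[R]_3 := \row_(i < 3) [:: b0; b1; 0]`_i.

Lemma dot_horizontal b0 b1 y : dot (horizontal b0 b1) y = b0 * y 0 0 + b1 * y 0 1.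
Proof. by rewrite dotE !mxE /= mul0r addr0. Qed.

Let u := horizontal a0 a1.
Let v := horizontal (- a1) a0.
Let al (y : R) := a0 * cos y + a1 * sin y.
Let be (y : R) := a0 * sin y - a1 * cos y.

Let uE x y : dot u (val (spherical x y)) = sin x * al y.
Proof. by rewrite dot_horizontal spherical0E spherical1E /al; ring. Qed.
Let vE x y : dot v (val (spherical x y)) = sin x * be y.
Proof. by rewrite dot_horizontal spherical0E spherical1E /be; ring. Qed.

Let al_be y : al y ^+ 2 + be y ^+ 2 = a0 ^+ 2 + a1 ^+ 2.
Proof.
transitivity ((a0 ^+ 2 + a1 ^+ 2) * (cos y ^+ 2 + sin y ^+ 2)).
  by rewrite /al /be; ring.
by rewrite cos2Dsin2 mulr1.
Qed.

Definition radial_step := affine_step u e^-1 (- (x0 / e)).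
Definition angular_step (y : 'rV[R]_3) := cone_step x0 k (dot u y) (dot v y).

Lemma elementary_angular_step : elementary angular_step.
Proof.
apply: elementary_step; apply: elementary_add; last exact: elementary_cst.
apply: elementary_mul.
  by apply: elementary_mul; [exact: elementary_cst|exact: elementary_dot].
apply: elementary_inv; last by move=> y; rewrite gt_eqF// regularized_gt0.
apply: elementary_add; first exact: elementary_cst.
apply: elementary_mul; last first.
  by apply: elementary_add; [exact: elementary_dot|exact: elementary_cst].
by apply: elementary_step; apply: elementary_mul; [exact: elementary_cst|exact: elementary_dot].
Qed.

Let f (x : sphere R) := radial_step (val x).
Let g (x : sphere R) := angular_step (val x).

Let sf : smooth f. Proof. exact: smooth_affine_step. Qed.
Let sg : smooth g. Proof. exact: elementary_smooth elementary_angular_step. Qed.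

Let g1 x y : partial1 g (x, y) =
  cone_slope x0 k (sin x * al y) (sin x * be y) (cos x * al y) (cos x * be y).
Proof.
apply: is_derive_unique (is_derive_partial1 x y sg) _.
have du : is_derive x (1 : R) (fun s => sin s * al y) (cos x * al y).
  by apply: (is_derive_eq (rderive_mul (is_derive_sin x) (rderive_cst x _))); ring.
have dv : is_derive x (1 : R) (fun s => sin s * be y) (cos x * be y).
  by apply: (is_derive_eq (rderive_mul (is_derive_sin x) (rderive_cst x _))); ring.
rewrite (_ : (fun s => sph g (s, y)) = fun s => cone_step x0 k (sin s * al y) (sin s * be y)).
  exact: (is_derive_cone_step k x00 du dv).
by apply/funext => s; rewrite /sph /g /angular_step /= uE vE.
Qed.

Let g2 x y : partial2 g (x, y) =
  cone_slope x0 k (sin x * al y) (sin x * be y) (sin x * - be y) (sin x * al y).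
Proof.
apply: is_derive_unique (is_derive_partial2 x y sg) _.
have ds := is_derive_sin y; have dc := is_derive_cos y.
have du : is_derive y (1 : R) (fun s => sin x * al s) (sin x * - be y).
  have h := rderive_add (rderive_scale a0 dc) (rderive_scale a1 ds).
  by apply: (is_derive_eq (rderive_scale (sin x) h)); rewrite /be; ring.
have dv : is_derive y (1 : R) (fun s => sin x * be s) (sin x * al y).
  have h := rderive_sub (rderive_scale a0 ds) (rderive_scale a1 dc).
  by apply: (is_derive_eq (rderive_scale (sin x) h)); rewrite /al; ring.
rewrite (_ : (fun s => sph g (x, s)) = fun s => cone_step x0 k (sin x * al s) (sin x * be s)).
  exact: (is_derive_cone_step k x00 du dv).
by apply/funext => s; rewrite /sph /g /angular_step /= uE vE.
Qed.

Let f1 x y : partial1 f (x, y) =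
  dstep (e^-1 * (sin x * al y) - x0 / e) * (e^-1 * al y * cos x).
Proof.
by rewrite partial1_affine_step /= uE !mxE /= /al; congr (_ * _); ring.
Qed.

Let equator_far y : x0 <= `|al y| \/ partial2 g (pi / 2, y) = 0.
Proof.
have [|ax] := leP x0 `|al y|; [by left|right].
rewrite g2 sin_pihalf !mul1r /cone_slope.
set r := regularized x0 (al y).
have r0 : 0 < r by exact: regularized_gt0.
have rx : r <= x0 by apply: regularized_le => //; apply: le_trans (ler_norm _) (ltW ax).
have h1 : al y ^+ 2 <= x0 ^+ 2.
  by rewrite -[al y ^+ 2]real_normK ?num_real// ler_sqr ?nnegrE// ltW.
have bk : x0 / (2 * k) <= `|be y|.
  rewrite -ler_sqr ?nnegrE//; last by rewrite divr_ge0 ?(ltW x00)// mulr_ge0// ltW.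
  rewrite real_normK ?num_real// -(lerD2l (al y ^+ 2)) al_be.
  by apply: le_trans saturated; rewrite lerD2r.
have bk2 : 2^-1 <= k * `|be y| * r^-1.
  rewrite ler_pdivlMr//; apply: le_trans (_ : k * (x0 / (2 * k)) <= _); last by rewrite ler_pM2l.
  rewrite (_ : k * _ = 2^-1 * x0) ?ler_pM2l//; by field; rewrite gt_eqF.
have [b0|b0] := leP 0 (be y).
  by rewrite dstep_ge1 ?mul0r//; rewrite ger0_norm// in bk2; lra.
rewrite dstep_le0 ?mul0r//; rewrite ltr0_norm// in bk2.
by move: bk2; rewrite mulrN mulNr; lra.
Qed.

(** The step is that of the tangent of the longitude, with no [x] in it. *)
Let g2_far x y : x0 <= sin x * al y -> 0 < al y ->
  partial2 g (x, y) = dstep (k * be y / al y + 2^-1) * (k * (a0 ^+ 2 + a1 ^+ 2) / al y ^+ 2).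
Proof.
move=> far a_gt0; rewrite g2 /cone_slope; have [-> ->] := regularized_ge x00 far.
have s0 : sin x != 0.
  by apply/eqP => s0; move: far; rewrite s0 mul0r leNgt x00.
have an0 := lt0r_neq0 a_gt0.
rewrite -(al_be y); congr (dstep _ * _); last by field; rewrite an0 s0.
by field; rewrite an0 s0.
Qed.

Let equator_pos y : 0 <= al y -> 0 <= partial2 g (pi / 2, y).
Proof.
move=> a_ge0; have [ax|->//] := equator_far y.
rewrite ger0_norm// in ax; have a_gt0 : 0 < al y := lt_le_trans x00 ax.
rewrite g2_far ?sin_pihalf ?mul1r//; apply: mulr_ge0; first exact: dstep_ge0.
by rewrite divr_ge0 ?sqr_ge0// mulr_ge0 ?(ltW k0)// addr_ge0 ?sqr_ge0.
Qed.

Let equator_neg y : al y <= 0 -> partial2 g (pi / 2, y) <= 0.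
Proof.
move=> a_le0; have [_|->//] := equator_far y.
rewrite g2 sin_pihalf !mul1r /cone_slope; have [-> ->] := regularized_le0 x00 a_le0.
rewrite mul0r mulr0 subr0; apply: mulr_ge0_le0; first exact: dstep_ge0.
apply: mulr_le0_ge0; last by rewrite invr_ge0 sqr_ge0.
apply: mulr_ge0_le0; first exact: ltW.
by apply: mulr_le0_ge0 => //; exact: ltW.
Qed.

(** The radial step vanishes unless [x0] is smaller than the linear function
    [u], and there the angular step only depends on the longitude: the
    Jacobian has one term, and its second factor can be computed on the
    equator. *)
Let jacobian_bound x y : 0 <= x <= pi ->
  `|f (sph_pt (x, y)) * sph_jacobian f g (x, y)| <=
  Num.max (partial2 g (pi / 2, y)) 0 * `|f (sph_pt (x, y)) * partial1 f (x, y)|.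
Proof.
move=> xpi; have sx0 := sin_ge0_pi xpi.
have fE : f (sph_pt (x, y)) = step (e^-1 * (sin x * al y) - x0 / e).
  by rewrite /f /radial_step /affine_step uE.
have [near|far] := leP (sin x * al y) x0.
  rewrite fE step_le0 ?mul0r ?normr0 ?mulr0//.
  by rewrite mulrC -mulrBl pmulr_lle0 ?invr_gt0// subr_le0.
have a_gt0 : 0 < al y.
  rewrite ltNge; apply/negP => /(mulr_ge0_le0 sx0) /(lt_le_trans far).
  by rewrite ltNge (ltW x00).
have eq : x0 <= sin (pi / 2) * al y.
  by rewrite sin_pihalf; apply: le_trans (ltW far) _; rewrite ler_wpM2r ?(ltW a_gt0)// sin_le1.
have G1 : partial1 g (x, y) = 0.
  rewrite g1 /cone_slope; have [-> ->] := regularized_ge x00 (ltW far).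
  suff -> : cos x * be y * (sin x * al y) - sin x * be y * (1 * (cos x * al y)) = 0.
    by rewrite mulr0 mul0r mulr0.
  by ring.
have G2 : partial2 g (x, y) = partial2 g (pi / 2, y).
  by rewrite (g2_far (ltW far) a_gt0) (g2_far eq a_gt0).
have JE := congr2 (fun p q => partial1 f (x, y) * p - partial2 f (x, y) * q) G2 G1.
have := equator_pos (ltW a_gt0); rewrite -[sph_jacobian f g (x, y)]/(_ * _ - _) JE /=.
exact: norm_mul_max.
Qed.

Lemma level_integral_le1 :
  (\int[mu2]_(z in rect) (`|f (sph_pt z) * sph_jacobian f g z|%R)%:E <= 1)%E.
Proof.
have pi0 := @pi_gt0 R.
have cB := @continuous_partial2_section R g (pi / 2) sg.
have cM : continuous (fun y => Num.max (partial2 g (pi / 2, y)) 0).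
  by move=> y; apply: (@continuous_max R _ _ (fun=> 0) y (cB y)); exact: cst_continuous.
apply: (@rect_integral_le_cols R (fun z => `|f (sph_pt z) * sph_jacobian f g z|)
  (fun y => Num.max (partial2 g (pi / 2, y)) 0)).
- move=> z; apply: cvg_norm.
  exact: (continuousM (@continuous_sph R _ (smooth_continuous sf) z) (@continuous_sph_jacobian R _ _ sf sg z)).
- by move=> z; exact: normr_ge0.
- exact: cM.
- move=> y _; set M := Num.max _ _.
  have M0 : 0 <= M by rewrite le_max lexx orbT.
  pose s x := f (spherical x y).
  have cf1 : continuous (fun x => partial1 f (x, y)).
    move=> x; apply: (@continuous_comp _ _ _ (fun x : R => (x, y)) (partial1 f)).
      exact: (continuous_pair_at (@cvg_id _ _) (@cst_continuous _ _ y x)).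
    exact: continuous_partial1.
  have dsx x : is_derive x (1 : R) s (partial1 f (x, y)) by exact: is_derive_partial1.
  have cs : continuous (fun x => s x * partial1 f (x, y)).
    by move=> x; exact: (continuousM (is_derive_continuous (dsx x)) (cf1 x)).
  have V : (\int[mu]_(x in `[0%R, pi]) (`|s x * partial1 f (x, y)|%R)%:E <= 1)%E.
    apply: (@meridian_variation R s (fun x => partial1 f (x, y)) (fun x => dstep (e^-1 * (sin x * al y) - x0 / e)) (e^-1 * al y)).
    + exact: cf1.
    + by move=> x; rewrite /s /f /radial_step /affine_step step_ge0 step_le1.
    + by move=> x; exact: dstep_ge0.
    + exact: (f1 ^~ y).
  apply: (@le_trans _ _ (\int[mu]_(x in `[0%R, pi]) (M%:E * (`|s x * partial1 f (x, y)|%R)%:E))%E).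
    apply: ge0_le_integral => //.
    + apply: (@measurable_continuous_norm R (fun x => f (sph_pt (x, y)) * sph_jacobian f g (x, y))) => [x|//].
      have cp := continuous_pair_at (@cvg_id _ (nbhs x)) (@cst_continuous _ _ y x).
      apply: (@continuous_comp _ _ _ (fun x : R => (x, y))
        (fun z => f (sph_pt z) * sph_jacobian f g z) x cp).
      exact: (continuousM (@continuous_sph R _ (smooth_continuous sf) (x, y))
        (@continuous_sph_jacobian R _ _ sf sg (x, y))).
    + apply/measurable_EFinP; apply: measurable_funTS; apply: continuous_measurable_fun => x.
      apply: (continuousM (@cst_continuous _ _ (M : R) x)).
      by apply: cvg_norm; exact: cs.
    + by move=> x; rewrite /= in_itv /= -EFinM lee_fin; exact: jacobian_bound.
  rewrite ge0_integralZl//; last by apply: measurable_continuous_norm.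
  have hM : (0 <= M%:E)%E by rewrite lee_fin.
  by apply: (le_trans (lee_wpmul2l hM V)); rewrite mule1.
- have dg y : is_derive y (1 : R) (fun y => g (spherical (pi / 2) y)) (partial2 g (pi / 2, y)).
    exact: is_derive_partial2.
  apply: (@circle_positive_variation R (fun y => g (spherical (pi / 2) y))
    (fun y => partial2 g (pi / 2, y)) a0 a1).
  + exact: cB.
  + by rewrite /g /angular_step !uE !vE /al /be cos0 sin0 mulr_natl cos2pi sin2pi.
  + by move=> y; rewrite /g /angular_step /cone_step step_ge0 step_le1.
  + exact: equator_pos.
  + exact: equator_neg.
Qed.

End LevelIntegral.

Section LevelNumbers.
Variable R : realType.

Lemma level_numbers (x1 y1 x2 y2 x3 y3 r : R) :
  x1 ^+ 2 + y1 ^+ 2 = r -> x2 ^+ 2 + y2 ^+ 2 = r -> x3 ^+ 2 + y3 ^+ 2 = r -> r <= 1 ->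
  x1 * x2 + y1 * y2 <= x2 * x3 + y2 * y3 -> x1 * x3 + y1 * y3 < r ->
  0 < x2 * y3 - y2 * x3 ->
  let X := (x2 + x3) * x3 + (y2 + y3) * y3 in
  let Y := x2 * y3 - y2 * x3 in
  [/\ 0 < X, (x2 + x3) * x2 + (y2 + y3) * y2 = X, (x2 + x3) * x1 + (y2 + y3) * y1 < X &
    X ^+ 2 + Y ^+ 2 <= (x2 + x3) ^+ 2 + (y2 + y3) ^+ 2].
Proof.
move=> e1 e2 e3 r1 d12 d13 Y0 X Y.
pose D := x2 * x3 + y2 * y3.
have XE : X = r + D by rewrite -e3 /X /D; ring.
have X2E : (x2 + x3) * x2 + (y2 + y3) * y2 = X by rewrite XE -e2 /D; ring.
have YD : Y ^+ 2 + D ^+ 2 = r ^+ 2.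
  transitivity ((x2 ^+ 2 + y2 ^+ 2) * (x3 ^+ 2 + y3 ^+ 2)); last by rewrite e2 e3 expr2.
  by rewrite /Y /D; ring.
have r0 : 0 <= r by rewrite -e1 addr_ge0 ?sqr_ge0.
split => //.
- rewrite XE; have Y2 : 0 < Y ^+ 2 by rewrite exprn_gt0.
  have Dr : `|D| < r.
    rewrite -(@ltr_pXn2r _ 2)// ?nnegrE// real_normK ?num_real//.
    by rewrite -YD ltrDr.
  by move: Dr; rewrite ltr_norml => /andP[h _]; lra.
- rewrite XE (_ : _ + _ = (x1 * x2 + y1 * y2) + (x1 * x3 + y1 * y3)); last by ring.
  by rewrite addrC; apply: ltr_leD.
- have -> : X ^+ 2 + Y ^+ 2 = ((x2 + x3) ^+ 2 + (y2 + y3) ^+ 2) * r.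
    by rewrite -e3 /X /Y; ring.
  by rewrite -[leRHS]mulr1 ler_wpM2l// addr_ge0 ?sqr_ge0.
Qed.

(** The slope of the caps has to be large enough for them to contain q1, hence
    the gap e between x0 and X has to be small. *)
Lemma level_parameters (X Y x1 y1 N : R) :
  0 < X -> 0 < Y -> x1 < X -> X ^+ 2 + Y ^+ 2 <= N ->
  exists x0 e m c, [/\ 0 < x0, 0 < e, x0 + e = X & 0 < m] /\
    [/\ m <= c, c * e <= Y - m * x0, c * (x1 - x0) <= - `|y1| - m * x0 &
      x0 ^+ 2 + (m * x0) ^+ 2 <= N].
Proof.
move=> X0 Y0 x1X XYN.
pose d := X - Num.max 0 x1; pose q := 4 * `|y1| + 2 * Y.
have d0 : 0 < d by rewrite subr_gt0 gt_max X0.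
have dX : d <= X by rewrite /d gerBl le_max lexx.
have dx : d <= X - x1 by rewrite /d lerD2l lerN2 le_max lexx orbT.
have y0 := normr_ge0 y1.
have q0 : 0 < q by rewrite /q; lra.
pose e := Y * d / q.
have e0 : 0 < e by rewrite divr_gt0// mulr_gt0.
have ed : e <= d / 2.
  by rewrite /e ler_pdivrMr// /q; have := mulr_ge0 (ltW d0) y0; lra.
have Xn0 := lt0r_neq0 X0; have en0 := lt0r_neq0 e0.
have mX : Y / (2 * X) * X = Y / 2 by field.
have ce : Y / (2 * e) * e = Y / 2 by field.
have m0 : 0 < Y / (2 * X) by rewrite divr_gt0// mulr_gt0.
have c0 : 0 < Y / (2 * e) by rewrite divr_gt0// mulr_gt0.
have x0X : X - e <= X by lra.
have x00 : 0 < X - e by lra.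
have mx : Y / (2 * X) * (X - e) <= Y / 2 by rewrite -mX ler_pM2l.
exists (X - e), e, (Y / (2 * X)), (Y / (2 * e)); split; first by split => //; lra.
split.
- by rewrite ler_pM2l// lef_pV2 ?posrE; lra.
- by rewrite ce; lra.
- have : Y / (2 * e) * (d / 2) <= Y / (2 * e) * (X - e - x1) by rewrite ler_pM2l//; lra.
  have -> : Y / (2 * e) * (d / 2) = `|y1| + Y / 2.
    rewrite /e /q; field.
    by rewrite (lt0r_neq0 Y0) (lt0r_neq0 d0) (lt0r_neq0 q0).
  by rewrite mulrBr (mulrBr (Y / (2 * e)) x1); lra.
- apply: le_trans XYN; apply: lerD.
    by rewrite ler_sqr ?nnegrE// ltW.
  have mx0 := mulr_ge0 (ltW m0) (ltW x00).
  by rewrite ler_sqr ?nnegrE ?(ltW Y0)//; apply: le_trans mx _; lra.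
Qed.

Lemma cap_saturation (m c x0 k U V : R) : m <= c -> 0 < x0 -> x0 < U -> 0 < k ->
  k * m = 2^-1 -> c * (U - x0) <= V - m * x0 -> 1 <= k * V * U^-1 + 2^-1.
Proof.
move=> mc x00 xU k0 km UV; have U0 : 0 < U by exact: lt_trans xU.
have mU : m * U <= V.
  have : m * (U - x0) <= c * (U - x0) by rewrite ler_wpM2r// subr_ge0 ltW.
  by rewrite mulrBr; lra.
have : 2^-1 <= k * V * U^-1 by rewrite ler_pdivlMr// -km -mulrA ler_pM2l.
by lra.
Qed.

Lemma cap_saturationN (m c x0 k U V : R) : m <= c -> 0 < x0 -> x0 < U -> 0 < k ->
  k * m = 2^-1 -> c * (U - x0) <= - V - m * x0 -> k * V * U^-1 + 2^-1 <= 0.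
Proof.
move=> mc x00 xU k0 km /(cap_saturation mc x00 xU k0 km).
by rewrite mulrN mulNr; lra.
Qed.

Lemma level_cap (c m x0 U V : R) :
  (m * x0 - c * x0 <= V - c * U) = (c * (U - x0) <= V - m * x0).
Proof. by apply/idP/idP; lra. Qed.

End LevelNumbers.

Section Level.
Variables (R : realType) (p1 p2 p3 : sphere R) (tau : set (sphere R) -> R).
Hypotheses (p12 : p1 <> p2) (p13 : p1 <> p3) (p23 : p2 <> p3).
Hypotheses (qm : is_quasi_measure tau) (ext : extends_three_point p1 p2 p3 tau).
Variable omega : sphere R -> 'rV[R]_3 -> 'rV[R]_3 -> R.
Hypothesis om : is_area_form omega.
Variables q1 q2 q3 : sphere R.
Hypothesis caps : forall u (c : R),
  two_marked q1 q2 q3 [set x : sphere R | c <= dot u (val x)] ->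
  tau [set x : sphere R | c <= dot u (val x)] = 1.

(** The functions [u] and [v] are coordinates in which [q2] and [q3] are
    symmetric, with [u = X] on both and [u < X] on [q1]. The caps are [X <= u]
    and [c * (u - x0) <= v - m * x0], [c * (u - x0) <= - v - m * x0]; on the
    last two either [u <= x0], where the radial step vanishes, or [`|v|] is at
    least [m * u] and the angular step is saturated. *)
Lemma defect_attained_level : q1 <> q3 ->
  val q1 0 2%:R = val q3 0 2%:R -> val q2 0 2%:R = val q3 0 2%:R ->
  dot (val q1) (val q2) <= dot (val q2) (val q3) ->
  0 < val q2 0 0 * val q3 0 1 - val q2 0 1 * val q3 0 0 ->
  exists F G, [/\ smooth F, smooth G, bracket_L1 omega F G = 1 &
    quasi_defect (quasi_state_of tau) F G = 1].
Proof.
move=> q13 z1 z2 d12 Y0.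
have n1 := sphere_dot q1; have n2 := sphere_dot q2; have n3 := sphere_dot q3.
have d13 : dot (val q1) (val q3) < 1.
  by rewrite lt_neqAle sphere_dot_le1 andbT; apply/eqP => /sphere_dot_eq1.
move: n1 n2 n3 d12 d13; rewrite !dotE z1 z2 => n1 n2 n3 d12 d13.
pose r := 1 - val q3 0 2%:R ^+ 2.
have [|||||||] := @level_numbers R (val q1 0 0) (val q1 0 1) (val q2 0 0) (val q2 0 1)
  (val q3 0 0) (val q3 0 1) r.
- by rewrite /r -n1; ring.
- by rewrite /r -n2; ring.
- by rewrite /r -n3; ring.
- by rewrite /r lerBlDr lerDl sqr_ge0.
- by move: d12; rewrite lerD2r.
- by rewrite /r ltrBrDr expr2.
- exact: Y0.
set a0 := val q2 0 0 + val q3 0 0; set a1 := val q2 0 1 + val q3 0 1.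
set X := a0 * _ + a1 * _; set Y := _ - _ in Y0 *; move=> X0 X2 X1 XYN.
have Y3 : - a1 * val q3 0 0 + a0 * val q3 0 1 = Y by rewrite /Y /a0 /a1; ring.
have Y2 : - a1 * val q2 0 0 + a0 * val q2 0 1 = - Y by rewrite /Y /a0 /a1; ring.
pose y1 := - a1 * val q1 0 0 + a0 * val q1 0 1.
have [x0 [e [m [c [[x00 e0 x0e m0] [mc ce c1 N0]]]]]] := level_parameters y1 X0 Y0 X1 XYN.
pose u := horizontal a0 a1; pose v := horizontal (- a1) a0.
have uE y : dot u y = a0 * y 0 0 + a1 * y 0 1 by exact: dot_horizontal.
have vE y : dot v y = - a1 * y 0 0 + a0 * y 0 1 by exact: dot_horizontal.
have U1 : dot u (val q1) = a0 * val q1 0 0 + a1 * val q1 0 1 by exact: uE.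
have V1 : dot v (val q1) = y1 by exact: vE.
have U2 : dot u (val q2) = X by rewrite uE.
have V2 : dot v (val q2) = - Y by rewrite vE.
have U3 : dot u (val q3) = X by exact: uE.
have V3 : dot v (val q3) = Y by rewrite vE.
rewrite -U1 in c1; have cX : c * (X - x0) <= Y - m * x0 by rewrite -x0e [x0 + e]addrC addrK.
clearbody X Y y1; clear X1 X2 Y2 Y3 XYN.
pose k := (2 * m)^-1.
have k0 : 0 < k by rewrite invr_gt0 mulr_gt0.
have km : k * m = 2^-1 by rewrite /k; field; exact: lt0r_neq0.
have sat : x0 ^+ 2 + (x0 / (2 * k)) ^+ 2 <= a0 ^+ 2 + a1 ^+ 2.
  rewrite (_ : x0 / (2 * k) = m * x0)//; rewrite /k; field; exact: lt0r_neq0.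
have J := level_integral_le1 x00 k0 e0 sat.
have capE (s : R) : [set x : sphere R | m * x0 - c * x0 <= dot (s *: v - c *: u) (val x)] =
    [set x : sphere R | c * (dot u (val x) - x0) <= s * dot v (val x) - m * x0].
  by apply/seteqP; split => x /=; rewrite dotDl dotNl !dotZl level_cap.
apply: (@defect_attained R p1 p2 p3 tau p12 p13 p23 qm ext omega om
  (radial_step x0 e a0 a1) (angular_step x0 k a0 a1)
  [set x : sphere R | c * (dot u (val x) - x0) <= 1 * dot v (val x) - m * x0]
  [set x : sphere R | c * (dot u (val x) - x0) <= -1 * dot v (val x) - m * x0]
  [set x : sphere R | X <= dot u (val x)]).
- exact: elementary_affine_step.
- exact: elementary_angular_step.
- by rewrite -capE; exact: closed_cap.
- by rewrite -capE; exact: closed_cap.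
- exact: closed_cap.
- rewrite -capE; apply: caps; rewrite capE; right; left; split; rewrite /= mul1r.
    by rewrite V1; apply: le_trans c1 _; rewrite lerD2r lerNl -normrN ler_norm.
  by rewrite U3 V3.
- rewrite -capE; apply: caps; rewrite capE; left; split; rewrite /= mulN1r.
    by rewrite V1; apply: le_trans c1 _; rewrite lerD2r lerN2 ler_norm.
  by rewrite U2 V2 opprK.
- by apply: caps; right; right; split; rewrite /= ?U2 ?U3.
- move=> x /=; rewrite mul1r /radial_step /affine_step /angular_step /cone_step -/u -/v.
  move: (dot u _) (dot v _) => U V UV; have [Ux|xU] := leP U x0.
    by left; rewrite step_le0// mulrC -mulrBl pmulr_lle0 ?invr_gt0// subr_le0.
  right; have [-> _] := regularized_ge x00 (ltW xU).
  by rewrite step_ge1//; exact: cap_saturation UV.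
- move=> x /=; rewrite mulN1r /radial_step /affine_step /angular_step /cone_step -/u -/v.
  move: (dot u _) (dot v _) => U V UV; have [Ux|xU] := leP U x0.
    by left; rewrite step_le0// mulrC -mulrBl pmulr_lle0 ?invr_gt0// subr_le0.
  right; have [-> _] := regularized_ge x00 (ltW xU).
  by rewrite step_le0//; exact: cap_saturationN UV.
- move=> x /= XU; rewrite /radial_step /affine_step -/u step_ge1//.
  rewrite mulrC -mulrBl ler_pdivlMr// mul1r; move: XU; rewrite -x0e.
  by rewrite lerBrDl.
- exact: J.
Qed.

End Level.

(** * The maximum *)

Section Cross.
Variable R : realType.

(** Otherwise the second and third vectors are opposite; then the two other
    products are opposite too, so the largest of the three, [- r], would be
    nonnegative. *)
Lemma cross_neq0 (x1 y1 x2 y2 x3 y3 r : R) :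
  x2 ^+ 2 + y2 ^+ 2 = r -> x3 ^+ 2 + y3 ^+ 2 = r ->
  x1 * x2 + y1 * y2 <= x2 * x3 + y2 * y3 -> x1 * x3 + y1 * y3 <= x2 * x3 + y2 * y3 ->
  x2 * x3 + y2 * y3 < r -> x2 * y3 - y2 * x3 != 0.
Proof.
move=> e2 e3 d12 d13 d23; apply/eqP => Y0.
set D := x2 * x3 + y2 * y3 in d12 d13 d23.
have D2 : D ^+ 2 = r ^+ 2.
  transitivity ((x2 ^+ 2 + y2 ^+ 2) * (x3 ^+ 2 + y3 ^+ 2) - (x2 * y3 - y2 * x3) ^+ 2).
    by rewrite /D; ring.
  by rewrite e2 e3 Y0 expr0n subr0 expr2.
have Dr : D = - r.
  have /eqP : D ^+ 2 == r ^+ 2 by apply/eqP.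
  by move/eqP; rewrite eqf_sqr => /orP[/eqP De|/eqP//]; move: d23; rewrite De ltxx.
have S : (x2 + x3) ^+ 2 + (y2 + y3) ^+ 2 = 0.
  transitivity ((x2 ^+ 2 + y2 ^+ 2) + (x3 ^+ 2 + y3 ^+ 2) + 2 * D); first by rewrite /D; ring.
  by rewrite e2 e3 Dr; ring.
have x23 : x3 = - x2.
  have : (x2 + x3) ^+ 2 == 0.
    by rewrite eq_le sqr_ge0 andbT -S lerDl sqr_ge0.
  by rewrite sqrf_eq0 => /eqP; lra.
have y23 : y3 = - y2.
  have : (y2 + y3) ^+ 2 == 0.
    by rewrite eq_le sqr_ge0 andbT -S lerDr sqr_ge0.
  by rewrite sqrf_eq0 => /eqP; lra.
by move: d13 d12 d23; rewrite Dr x23 y23 !mulrN; lra.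
Qed.

Lemma extreme_or_level (z1 z2 z3 : R) : (z1 = z2 /\ z1 = z3) \/ exists sg,
  [\/ 0 < sg * (z2 - z1) /\ 0 < sg * (z3 - z1),
      0 < sg * (z1 - z2) /\ 0 < sg * (z3 - z2) |
      0 < sg * (z1 - z3) /\ 0 < sg * (z2 - z3)].
Proof.
have [h12|h12|h12] := ltgtP z1 z2; have [h13|h13|h13] := ltgtP z1 z3;
  have [h23|h23|h23] := ltgtP z2 z3; try (by left; split); right;
  solve [ exists 1; constructor 1; split; lra | exists 1; constructor 2; split; lra
        | exists 1; constructor 3; split; lra | exists (-1); constructor 1; split; lra
        | exists (-1); constructor 2; split; lra | exists (-1); constructor 3; split; lra
        | exfalso; lra].
Qed.

End Cross.

Section Attained.
Variables (R : realType) (p1 p2 p3 : sphere R) (tau : set (sphere R) -> R).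
Hypotheses (p12 : p1 <> p2) (p13 : p1 <> p3) (p23 : p2 <> p3).
Hypotheses (qm : is_quasi_measure tau) (ext : extends_three_point p1 p2 p3 tau).
Variable omega : sphere R -> 'rV[R]_3 -> 'rV[R]_3 -> R.
Hypothesis om : is_area_form omega.

Let attained := exists F G, [/\ smooth F, smooth G, bracket_L1 omega F G = 1 &
    quasi_defect (quasi_state_of tau) F G = 1].

Let defect_attained_closest q1 q2 q3 :
  (forall A, two_marked q1 q2 q3 A -> two_marked p1 p2 p3 A) ->
  q1 <> q2 -> q1 <> q3 -> q2 <> q3 ->
  val q1 0 2%:R = val q3 0 2%:R -> val q2 0 2%:R = val q3 0 2%:R ->
  dot (val q1) (val q2) <= dot (val q2) (val q3) ->
  dot (val q1) (val q3) <= dot (val q2) (val q3) -> attained.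
Proof.
move=> mk q12 q13 q23 z1 z2 d12 d13.
have caps u (c : R) : two_marked q1 q2 q3 [set x : sphere R | c <= dot u (val x)] ->
    tau [set x : sphere R | c <= dot u (val x)] = 1.
  by move/mk; exact: (tau_cap p12 p13 p23 ext).
have caps' u (c : R) : two_marked q1 q3 q2 [set x : sphere R | c <= dot u (val x)] ->
    tau [set x : sphere R | c <= dot u (val x)] = 1.
  by move=> h; apply: caps; move: h; rewrite /two_marked; tauto.
have : val q2 0 0 * val q3 0 1 - val q2 0 1 * val q3 0 0 != 0.
  have n2 := sphere_dot q2; have n3 := sphere_dot q3.
  have d23 : dot (val q2) (val q3) < 1.
    by rewrite lt_neqAle sphere_dot_le1 andbT; apply/eqP => /sphere_dot_eq1.
  move: n2 n3 d12 d13 d23; rewrite !dotE z1 z2 => n2 n3 d12 d13 d23.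
  apply: (@cross_neq0 _ (val q1 0 0) (val q1 0 1) _ _ _ _ (1 - val q3 0 2%:R ^+ 2)).
  - by rewrite -n2; ring.
  - by rewrite -n3; ring.
  - by move: d12; rewrite lerD2r.
  - by move: d13; rewrite lerD2r.
  - by rewrite ltrBrDr expr2.
rewrite neq_lt => /orP[Y0|Y0].
- have Y0' : 0 < val q3 0 0 * val q2 0 1 - val q3 0 1 * val q2 0 0.
    by rewrite mulrC [X in _ - X]mulrC -oppr_lt0 opprB.
  rewrite (dotC (val q2)) in d13.
  exact: (defect_attained_level p12 p13 p23 qm ext om caps' q12 (etrans z1 (esym z2)) (esym z2) d13 Y0').
- exact: (defect_attained_level p12 p13 p23 qm ext om caps).
Qed.

Lemma defect_attained_three_points : attained.
Proof.
have caps q1 q2 q3 : (forall A, two_marked q1 q2 q3 A -> two_marked p1 p2 p3 A) ->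
    forall u (c : R), two_marked q1 q2 q3 [set x : sphere R | c <= dot u (val x)] ->
    tau [set x : sphere R | c <= dot u (val x)] = 1.
  by move=> mk u c /mk; exact: (tau_cap p12 p13 p23 ext).
have m213 A : two_marked p2 p1 p3 A -> two_marked p1 p2 p3 A.
  by rewrite /two_marked; tauto.
have m312 A : two_marked p3 p1 p2 A -> two_marked p1 p2 p3 A.
  by rewrite /two_marked; tauto.
have m123 A : two_marked p1 p2 p3 A -> two_marked p1 p2 p3 A by [].
have := @extreme_or_level R (val p1 0 2%:R) (val p2 0 2%:R) (val p3 0 2%:R).
move=> [[z12 z13]|[sg [[h h']|[h h']|[h h']]]].
- have [d12|/ltW d12] := leP (dot (val p1) (val p2)) (dot (val p2) (val p3)).
    have [d13|/ltW d13] := leP (dot (val p1) (val p3)) (dot (val p2) (val p3)).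
      by apply: (defect_attained_closest m123) => //; rewrite -z12.
    apply: (defect_attained_closest m213) => //; rewrite -?z12// ?(dotC (val p2) (val p1))//.
    + by move=> e; apply: p12.
    + exact: le_trans d13.
  have [d13|/ltW d13] := leP (dot (val p1) (val p3)) (dot (val p1) (val p2)).
    apply: (defect_attained_closest m312) => //; rewrite -?z13// ?(dotC (val p3))//.
    + by move=> e; apply: p13.
    + by move=> e; apply: p23.
  apply: (defect_attained_closest m213) => //; rewrite -?z12// ?(dotC (val p2) (val p1))//.
  + by move=> e; apply: p12.
  + exact: le_trans d13.
- exact: (defect_attained_extreme p12 p13 p23 qm ext om (caps _ _ _ m123) p23 h h').
- exact: (defect_attained_extreme p12 p13 p23 qm ext om (caps _ _ _ m213) p13 h h').
- exact: (defect_attained_extreme p12 p13 p23 qm ext om (caps _ _ _ m312) p12 h h').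
Qed.

End Attained.

Theorem theorem1 (R : realType) (p1 p2 p3 : sphere R)
    (zeta : (sphere R -> R) -> R)
    (omega : sphere R -> 'rV[R]_3 -> 'rV[R]_3 -> R) :
  p1 <> p2 -> p1 <> p3 -> p2 <> p3 ->
  is_aarnes_three_point p1 p2 p3 zeta ->
  is_area_form omega ->
  let ratios := [set q : R | exists F G : sphere R -> R,
    [/\ smooth F, smooth G, bracket_L1 omega F G <> 0 &
        q = quasi_defect zeta F G ^+ 2 / bracket_L1 omega F G]] in
  ratios 1 /\ ubound ratios 1.
Proof.
move=> p12 p13 p23 [_ [tau [qm ext zE]]] om ratios.
have defectE F G : smooth F -> smooth G ->
    quasi_defect zeta F G = quasi_defect (quasi_state_of tau) F G.
  move=> /smooth_continuous cF /smooth_continuous cG.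
  have cFG : continuous (F \+ G) by move=> x; exact: (continuousD (cF x) (cG x)).
  by rewrite /quasi_defect !zE.
split.
  have [F [G [sF sG L1 D1]]] := defect_attained_three_points p12 p13 p23 qm ext om.
  exists F, G; split => //; rewrite L1; first exact/eqP/oner_neq0.
  by rewrite defectE// D1 expr1n divr1.
move=> _ [F [G [sF sG Ln0 ->]]]; rewrite defectE//.
have [L0 DL] := defect_sqr_le_bracket p12 p13 p23 qm ext om sF sG Ln0.
by rewrite ler_pdivrMr// mul1r.
Qed.
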